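(* Let $T>0$, and let $\lambda\colon[0,T]\to\mathbb{R}$ be such that $|\lambda(t_1)-\lambda(t_2)|\le M|t_1-t_2|^{\frac12+\delta}$ for all $t_1,t_2\in[0,T]$, where $M>0$ and $\delta\in(0,\tfrac12]$ are constants. Let $\gamma=\gamma^\lambda$ be the slit generated by $\lambda$. Then: (a) $\Gamma(t):=\gamma(t^2)$ is $C^{1,\delta}$ regular on $[0,\sqrt T]$; and (b) the slit $\gamma(t)$ grows vertically at $t=0$. With the extra assumption that $\|\lambda\|_{\mathrm{Lip}(1/2)}\le1$, these statements are quantitative: $$\|\Gamma\|_{C^{1,\delta}([0,\sqrt T])}\le N\qquad\text{and}\qquad \inf_{t\in[0,\sqrt T]}|\Gamma'(t)|\ge\frac1N,$$ where $N=N(M,T,\delta)>0$ depends only on $M$, $T$ and $\delta$. Furthermore, $$|\Gamma'(t)-2i|\le N\,t^{2\delta}\qquad(0<t\le\sqrt T).$$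
   Context: Let $\mathbb{H}=\{z\in\mathbb{C}:\operatorname{Im} z>0\}$. For a continuous $\lambda\colon[0,T]\to\mathbb{R}$ (a driving function), let $g_t(z)$ be the solution of the chordal Loewner equation $\partial_t g_t(z)=\frac{2}{g_t(z)-\lambda(t)}$, $g_0(z)=z$, and let $H_t$ be the set of $z\in\mathbb{H}$ for which the solution is well defined up to time $t$ (i.e. $g_s(z)\ne\lambda(s)$ for $s\in[0,t]$). Then $g_t$ maps $H_t$ conformally onto $\mathbb{H}$. Put $\|\lambda\|_{\mathrm{Lip}(1/2)}=\sup_{t_1\ne t_2\in[0,T]}|\lambda(t_1)-\lambda(t_2)|/|t_1-t_2|^{1/2}$. It is known (Marshall–Rohde, Lind) that if $\|\lambda\|_{\mathrm{Lip}(1/2)}<4$, at least locally (i.e. on sufficiently short subintervals), then $\lambda$ generates a slit $\gamma=\gamma^{\lambda}\colon[0,T]\to\overline{\mathbb{H}}$: a simple curve with $\gamma(0)=\lambda(0)\in\mathbb{R}$, $\gamma(t)\in\mathbb{H}$ for $0<t\le T$, and $H_t=\mathbb{H}\setminus\gamma([0,t])$ for all $t$; moreover $\gamma(t)=\lim_{y\downarrow0}g_t^{-1}(\lambda(t)+iy)$. For a function $\phi$ on a closed interval $I$, $n\in\mathbb{N}$, $0<\alpha\le1$: $\|\phi\|_{C^{n,\alpha}(I)}=\sum_{k=0}^n\sup_I|\phi^{(k)}|+\sup_{t_1\ne t_2\in I}\frac{|\phi^{(n)}(t_1)-\phi^{(n)}(t_2)|}{|t_1-t_2|^\alpha}$,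 with one-sided derivatives at endpoints. A curve is ''$C^{n,\alpha}$ regular'' on $I$ if it is $C^{n,\alpha}$ on $I$ (finite $C^{n,\alpha}(I)$ norm) and its derivative is nonzero everywhere on $I$. ''The slit grows vertically at $t=0$'' means $\arg(\gamma(t)-\gamma(0))\to\pi/2$ as $t\downarrow0$.
   Formalization: The norm bound is proved as ‖Γ‖ ≤ N + |λ(0)|, since the bound by N(M,T,δ) alone fails for constant λ = c with |c| large (then Γ(0) = c); for λ(0) = 0 it is the stated bound. *)

(* Defs.v *)
From Stdlib Require Import Reals.
From Coquelicot Require Import Coquelicot.
Open Scope R_scope.

Definition Icc (a b t : R) : Prop := a <= t <= b.

(* Derivative at t of f : R -> C relative to [a,b]: one-sided at a and at b,
   two-sided inside.  [is_derive] is the same with the filter [locally t]. *)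
Definition is_derive_on (a b : R) (f : R -> C) (t : R) (l : C) : Prop :=
  filterdiff (K := R_AbsRing) (U := R_NormedModule) (V := C_R_NormedModule)
    f (within (Icc a b) (locally t))
    (fun y : R => scal (V := C_R_NormedModule) y l).

Definition ex_derive_on (a b : R) (f : R -> C) (t : R) : Prop :=
  exists l : C, is_derive_on a b f t l.

(* For a < b and a <= t <= b the derivative is unique when it exists, and this
   is its value; otherwise the value is unspecified. *)
Definition Derive_on (a b : R) (f : R -> C) (t : R) : C :=
  iota (T := C_R_CompleteNormedModule) (is_derive_on a b f t).

Fixpoint Derive_n_on (a b : R) (n : nat) (f : R -> C) : R -> C :=
  match n with
  | O => f
  | S m => Derive_on a b (Derive_n_on a b m f)
  end.

Definition ex_derive_n_on (a b : R) (n : nat) (f : R -> C) : Prop :=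
  forall k : nat, (k < n)%nat ->
  forall t : R, a <= t <= b -> ex_derive_on a b (Derive_n_on a b k f) t.

Definition sup_norm (a b : R) (f : R -> C) : Rbar :=
  Lub_Rbar (fun x => exists t, a <= t <= b /\ x = Cmod (f t)).

Definition holder_seminorm (alpha a b : R) (f : R -> C) : Rbar :=
  Lub_Rbar (fun x => exists t1 t2,
    a <= t1 <= b /\ a <= t2 <= b /\ t1 <> t2 /\
    x = Cmod (f t1 - f t2)%C / Rpower (Rabs (t1 - t2)) alpha).

Fixpoint sum_sup_norm (a b : R) (n : nat) (f : R -> C) : Rbar :=
  match n with
  | O => sup_norm a b f
  | S m => Rbar_plus (sum_sup_norm a b m f)
                     (sup_norm a b (Derive_n_on a b n f))
  end.

(* Meaningful for a < b and [ex_derive_n_on a b n f]. *)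
Definition Cna_norm (n : nat) (alpha a b : R) (f : R -> C) : Rbar :=
  Rbar_plus (sum_sup_norm a b n f)
            (holder_seminorm alpha a b (Derive_n_on a b n f)).

Definition Cna (n : nat) (alpha a b : R) (f : R -> C) : Prop :=
  ex_derive_n_on a b n f /\ is_finite (Cna_norm n alpha a b f).

Definition Cna_regular (n : nat) (alpha a b : R) (f : R -> C) : Prop :=
  Cna n alpha a b f /\
  forall t : R, a <= t <= b -> Derive_on a b f t <> RtoC 0.

Definition lip_half_norm (T : R) (lam : R -> R) : Rbar :=
  Lub_Rbar (fun x => exists t1 t2,
    0 <= t1 <= T /\ 0 <= t2 <= T /\ t1 <> t2 /\
    x = Rabs (lam t1 - lam t2) / sqrt (Rabs (t1 - t2))).

(* s |-> g s is the solution g_s(z), 0 <= s <= t, of the chordal Loewner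
   equation driven by lam and started at z. *)
Definition loewner_solution (lam : R -> R) (t : R) (z : C) (g : R -> C) : Prop :=
  g 0 = z /\
  forall s : R, 0 <= s <= t ->
    g s <> RtoC (lam s) /\
    is_derive_on 0 t g s (RtoC 2 / (g s - RtoC (lam s)))%C.

Definition upper_half_plane (z : C) : Prop := 0 < Im z.

Definition loewner_domain (lam : R -> R) (t : R) (z : C) : Prop :=
  upper_half_plane z /\ exists g : R -> C, loewner_solution lam t z g.

(* gam is the slit generated by lam on [0,T].  These conditions determine gam
   on [0,T], since gam t is the only point of the half-plane that lies in every
   domain of index s < t but not in the domain of index t. *)
Definition generates_slit (lam : R -> R) (T : R) (gam : R -> C) : Prop :=
  continuous_on (T := R_UniformSpace) (U := C_UniformSpace) (Icc 0 T) gam /\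
  (forall s t : R, 0 <= s <= T -> 0 <= t <= T -> gam s = gam t -> s = t) /\
  gam 0 = RtoC (lam 0) /\
  (forall t : R, 0 < t <= T -> upper_half_plane (gam t)) /\
  (forall t : R, 0 <= t <= T -> forall z : C,
     loewner_domain lam t z <->
     upper_half_plane z /\ ~ exists s : R, 0 <= s <= t /\ z = gam s).

(* Principal argument, in (-PI, PI], for z <> 0. *)
Definition Carg (z : C) : R :=
  if Rle_dec 0 (Im z) then acos (Re z / Cmod z) else - acos (Re z / Cmod z).

Definition grows_vertically (gam : R -> C) : Prop :=
  filterlim (fun t : R => Carg (gam t - gam 0)%C)
    (at_right 0) (locally (PI / 2)).

(* [Rpower 0 _] is 1 in the standard library, so the diagonal t1 = t2 imposes
   nothing, as with 0 in its place. *)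
Definition holder_driving (M beta T : R) (lam : R -> R) : Prop :=
  forall t1 t2 : R, 0 <= t1 <= T -> 0 <= t2 <= T ->
    Rabs (lam t1 - lam t2) <= M * Rpower (Rabs (t1 - t2)) beta.

Definition square_param (gam : R -> C) (t : R) : C := gam (t ^ 2).

(* Main.v *)
Require Import Defs.
From Stdlib Require Import ssreflect Reals Ranalysis5 Lra Lia Classical ClassicalEpsilon.
From Coquelicot Require Import Coquelicot.
Open Scope R_scope.
Open Scope general_if_scope.

(** For a point z of the half-plane let W(s) = g_s(z) - lam(s).  When z is the
tip gam(t), the function W lives on [0,t) and shrinks to 0 as s tends to t; for
a constant driving function it is 2i sqrt(t-s) and gam(t) - gam(0) is
2i sqrt(t).  The proof compares the general case with this model at three
levels.

One tip.  The solution started at gam(t) exists up to every s < t but not up to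
t, so |W| comes arbitrarily close to 0 ([flow_extends]).  On time scales below
some eta the Hölder condition makes lam vary by at most a quarter of the square
root of the elapsed time.  If |Re W| > Im W held at a time s0 > t - eta, then
Re g_s would run away from lam(s0) at square-root speed, faster than lam can
follow ([escape]), and W would stay away from 0.  So |Re W| <= Im W near t
([tip_cone]); in this cone (Im W)^2 loses at least 2 per unit of time, which
gives Im W >= sqrt(t-s).  Finally Y = g_s - lam(t) satisfies
(Y^2)' = 4 + 4 (lam(s) - lam(t)) / W, whence Y^2 = -4(t-s) + O((t-s)^(1+delta))
and W = 2i sqrt(t-s) (1 + O((t-s)^delta)): this is [tip_estimate].

Two tips.  The difference G of the solutions started at gam(t1) and gam(t2),
t1 < t2, satisfies the linear equation G' = -2 G / (W1 W2).  Divided by twice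
the difference of the model square roots it becomes [slope], which is half the
difference quotient of Gamma(x) = gam(x^2) at s = 0, and which the first step
controls at s = t1.  In between, its logarithmic derivative is
O((t1-s)^(delta-1)), an integrable quantity, because the model part cancels.
Hence the difference quotients of Gamma stay within O(t2^delta) of 2i and away
from 0 ([slope_estimate]).

Three tips.  For t1 < t2 < t3 put h = t3 - t1.  The ratio of the two successive
slopes satisfies a linear equation whose coefficient is the difference of two
logarithmic derivatives.  That is O((t1-s)^(delta-1)), and by a second
cancellation also O(h (t1-s)^(delta-2)).  The first bound for t1 - s < h
and the second for t1 - s > h integrate to O(h^delta), so successive difference
quotients of Gamma differ by O(h^delta) ([slope_variation]).

A function whose successive difference quotients over x < y < z differ by
O((z-x)^delta) is of class C^(1,delta) by Cauchy's criterion, and the bounds on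
the quotients pass to the derivative ([regularity_of_quotients]). *)

(** * Complex-valued functions of a real variable, and linear equations *)

(** Stated on the two components, so that the calculus of real functions applies. *)
Definition cder (f : R -> C) (x : R) (l : C) : Prop :=
  is_derive (fun s => fst (f s)) x (fst l) /\
  is_derive (fun s => snd (f s)) x (snd l).

Lemma cder_eq f x l l' : cder f x l -> l = l' -> cder f x l'.
Proof. intros H <-; exact H. Qed.

Lemma cder_ext_loc f g x l :
  locally x (fun s => f s = g s) -> cder f x l -> cder g x l.
Proof.
  intros He [H1 H2]; split.
  - apply (is_derive_ext_loc (fun s => fst (f s))); auto.
    apply: filter_imp He => s -> //.
  - apply (is_derive_ext_loc (fun s => snd (f s))); auto.
    apply: filter_imp He => s -> //.
Qed.

Lemma cder_const (c : C) x : cder (fun _ => c) x (RtoC 0).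
Proof. split; apply: is_derive_const. Qed.

Lemma cder_minus f g x lf lg :
  cder f x lf -> cder g x lg -> cder (fun s => (f s - g s)%C) x (lf - lg)%C.
Proof.
  intros [F1 F2] [G1 G2]; split.
  - exact (is_derive_minus _ _ _ _ _ F1 G1).
  - exact (is_derive_minus _ _ _ _ _ F2 G2).
Qed.

Lemma is_derive_Rmult (f g : R -> R) x lf lg :
  is_derive f x lf -> is_derive g x lg ->
  is_derive (fun s => f s * g s) x (lf * g x + f x * lg).
Proof.
  intros F G. apply: (is_derive_mult f g x lf lg F G). exact Rmult_comm.
Qed.

Lemma cder_mult f g x lf lg :
  cder f x lf -> cder g x lg ->
  cder (fun s => (f s * g s)%C) x (lf * g x + f x * lg)%C.
Proof.
  intros [F1 F2] [G1 G2]; split; simpl.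
  - evar_last.
    + apply: is_derive_minus; apply is_derive_Rmult; eassumption.
    + unfold minus, plus, opp; simpl; ring.
  - evar_last.
    + apply: is_derive_plus; apply is_derive_Rmult; eassumption.
    + unfold minus, plus, opp; simpl; ring.
Qed.

Lemma cder_RtoC f x l : is_derive f x l -> cder (fun s => RtoC (f s)) x (RtoC l).
Proof. intros H; split; [exact H | apply: is_derive_const]. Qed.

Lemma Cnorm2_pos (z : C) : z <> RtoC 0 -> 0 < fst z ^ 2 + snd z ^ 2.
Proof.
  intros Hz. destruct (Req_dec (fst z) 0) as [H1|H1]; [|nra].
  destruct (Req_dec (snd z) 0) as [H2|H2]; [|nra].
  destruct Hz. destruct z; simpl in *; subst; reflexivity.
Qed.

Lemma cder_inv f x l :
  f x <> RtoC 0 -> cder f x l -> cder (fun s => (/ f s)%C) x (- l / (f x * f x))%C.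
Proof.
  intros Hz [F1 F2]. pose proof (Cnorm2_pos _ Hz) as Hp.
  assert (HD : is_derive (fun s => fst (f s) ^ 2 + snd (f s) ^ 2) x
      (2 * fst (f x) * fst l + 2 * snd (f x) * snd l)).
  { evar_last.
    - apply: is_derive_plus; apply: is_derive_pow; eassumption.
    - unfold plus; simpl; ring. }
  assert (Hne : (fst (f x) ^ 2 - snd (f x) ^ 2) ^ 2 + (2 * fst (f x) * snd (f x)) ^ 2 <> 0).
  { replace (_ + _) with ((fst (f x) ^ 2 + snd (f x) ^ 2) ^ 2) by ring.
    apply pow_nonzero; lra. }
  split; simpl.
  - evar_last.
    + apply: is_derive_div; [exact F1 | exact HD | lra].
    + simpl. field. split; [|lra].
      intros E; apply Hne; rewrite <- E; ring.
  - evar_last.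
    + apply: is_derive_div; [apply: is_derive_opp; exact F2 | exact HD | lra].
    + unfold opp; simpl. field. split; [|lra].
      intros E; apply Hne; rewrite <- E; ring.
Qed.

Lemma deriv_nonneg_incr (f df : R -> R) a b :
  a <= b -> (forall x, a <= x <= b -> is_derive f x (df x)) ->
  (forall x, a <= x <= b -> 0 <= df x) -> f a <= f b.
Proof.
  intros [Hab| ->] Hd Hp; [|lra].
  destruct (MVT_cor2 f df a b Hab) as (c & Hc & Hcab).
  { intros c Hc; apply is_derive_Reals; auto. }
  specialize (Hp c ltac:(lra)). nra.
Qed.

Lemma Cmod_sqr (z : C) : Cmod z * Cmod z = fst z ^ 2 + snd z ^ 2.
Proof. unfold Cmod; apply sqrt_sqrt; nra. Qed.

Lemma Cauchy_Schwarz2 (z w : C) : fst z * fst w + snd z * snd w <= Cmod z * Cmod w.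
Proof.
  apply Rsqr_incr_0_var; [|apply Rmult_le_pos; apply Cmod_ge_0].
  unfold Rsqr. replace (Cmod z * Cmod w * (Cmod z * Cmod w))
    with ((Cmod z * Cmod z) * (Cmod w * Cmod w)) by ring.
  rewrite !Cmod_sqr. pose proof (pow2_ge_0 (fst z * snd w - snd z * fst w)). nra.
Qed.

(** The real mean value theorem applied to the component of f in the direction
of f b - f a. *)
Lemma complex_mean_value (f df : R -> C) (phi dphi : R -> R) a b :
  a <= b ->
  (forall x, a <= x <= b -> cder f x (df x)) ->
  (forall x, a <= x <= b -> is_derive phi x (dphi x)) ->
  (forall x, a <= x <= b -> Cmod (df x) <= dphi x) ->
  Cmod (f b - f a)%C <= phi b - phi a.
Proof.
  intros Hab Hf Hphi Hle.
  set (w := (f b - f a)%C).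
  assert (Hmono : phi a <= phi b).
  { apply (deriv_nonneg_incr phi dphi); auto.
    intros x Hx. eapply Rle_trans; [apply Cmod_ge_0 | auto]. }
  destruct (Req_dec (Cmod w) 0) as [Hw|Hw]; [lra|].
  assert (Hwp : 0 < Cmod w) by (pose proof (Cmod_ge_0 w); lra).
  assert (H : Cmod w * phi a - (fst w * fst (f a) + snd w * snd (f a)) <=
              Cmod w * phi b - (fst w * fst (f b) + snd w * snd (f b))).
  { apply (deriv_nonneg_incr
      (fun x => Cmod w * phi x - (fst w * fst (f x) + snd w * snd (f x)))
      (fun x => Cmod w * dphi x - (fst w * fst (df x) + snd w * snd (df x)))); auto.
    - intros x Hx. destruct (Hf x Hx) as [F1 F2].
      apply: is_derive_minus; [apply: is_derive_scal; auto|].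
      apply: is_derive_plus; apply: is_derive_scal; auto.
    - intros x Hx. pose proof (Cauchy_Schwarz2 w (df x)).
      pose proof (Hle x Hx). nra. }
  assert (Hs : fst w * (fst (f b) - fst (f a)) + snd w * (snd (f b) - snd (f a))
    = Cmod w * Cmod w) by (rewrite Cmod_sqr; unfold w; simpl; ring).
  nra.
Qed.

Lemma is_derive_Cmod_sqr (f : R -> C) x l :
  cder f x l ->
  is_derive (fun s => fst (f s) ^ 2 + snd (f s) ^ 2) x
    (2 * (fst (f x) * fst l + snd (f x) * snd l)).
Proof.
  intros [F1 F2]. evar_last.
  - apply: is_derive_plus; apply: is_derive_pow; eassumption.
  - unfold plus; simpl; ring.
Qed.

Lemma is_derive_exp_comp (K : R -> R) x k :
  is_derive K x k -> is_derive (fun s => exp (K s)) x (k * exp (K x)).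
Proof.
  intros H. apply: (is_derive_comp exp K); [apply is_derive_exp | exact H].
Qed.

(** |Z|^2 exp(2K) is nondecreasing and |Z|^2 exp(-2K) is nonincreasing; working
with the squared modulus avoids dividing by |Z|, which may vanish. *)
Lemma linear_ode_bound (Z a : R -> C) (K k : R -> R) p q :
  p <= q ->
  (forall x, p <= x <= q -> cder Z x (a x * Z x)%C) ->
  (forall x, p <= x <= q -> is_derive K x (k x)) ->
  (forall x, p <= x <= q -> Cmod (a x) <= k x) ->
  Cmod (Z p) <= Cmod (Z q) * exp (K q - K p) /\
  Cmod (Z q) <= Cmod (Z p) * exp (K q - K p).
Proof.
  intros Hpq HZ HK Hk.
  assert (Hre : forall x, p <= x <= q ->
     Rabs (fst (Z x) * fst (a x * Z x)%C + snd (Z x) * snd (a x * Z x)%C)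
      <= k x * (fst (Z x) ^ 2 + snd (Z x) ^ 2)).
  { intros x Hx.
    replace (_ + _) with (fst (a x) * (fst (Z x) ^ 2 + snd (Z x) ^ 2)) by (simpl; ring).
    rewrite Rabs_mult (Rabs_pos_eq (_ + _)); [|nra].
    apply Rmult_le_compat_r; [nra|].
    eapply Rle_trans; [apply re_le_Cmod | auto]. }
  assert (Hd : forall c x, p <= x <= q ->
     is_derive (fun s => (fst (Z s) ^ 2 + snd (Z s) ^ 2) * exp (c * K s)) x
      (exp (c * K x) * (2 * (fst (Z x) * fst (a x * Z x)%C + snd (Z x) * snd (a x * Z x)%C)
        + c * k x * (fst (Z x) ^ 2 + snd (Z x) ^ 2)))).
  { intros c x Hx. evar_last.
    - apply is_derive_Rmult; [apply is_derive_Cmod_sqr; auto|].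
      apply (is_derive_exp_comp (fun s => c * K s)). apply: is_derive_scal; auto.
    - simpl; ring. }
  assert (Hsq : forall u v e, 0 <= e -> fst u ^ 2 + snd u ^ 2 <=
     (fst v ^ 2 + snd v ^ 2) * (e * e) -> Cmod u <= Cmod v * e).
  { intros u v e He Hu. apply Rsqr_incr_0_var; [|apply Rmult_le_pos; [apply Cmod_ge_0|lra]].
    unfold Rsqr. rewrite Cmod_sqr.
    replace (Cmod v * e * (Cmod v * e)) with ((Cmod v * Cmod v) * (e * e)) by ring.
    rewrite Cmod_sqr. exact Hu. }
  assert (Hee : exp (K q - K p) * exp (K q - K p) = exp (2 * (K q - K p)))
    by (rewrite <- exp_plus; f_equal; ring).
  split; apply Hsq; try (left; apply exp_pos); rewrite Hee.
  - assert (H := deriv_nonneg_incr _ _ p q Hpq (Hd 2)).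
    cbv beta in H.
    assert (H' : (fst (Z p) ^ 2 + snd (Z p) ^ 2) * exp (2 * K p) <=
                 (fst (Z q) ^ 2 + snd (Z q) ^ 2) * exp (2 * K q)).
    { apply H. intros x Hx. apply Rmult_le_pos; [left; apply exp_pos|].
      specialize (Hre x Hx). apply Rabs_le_between in Hre. lra. }
    replace (2 * (K q - K p)) with (2 * K q + - (2 * K p)) by ring.
    rewrite exp_plus exp_Ropp.
    pose proof (exp_pos (2 * K p)).
    apply Rmult_le_reg_r with (exp (2 * K p)); [lra|].
    eapply Rle_trans; [exact H'|]. right; field; lra.
  - assert (H := deriv_nonneg_incr
      (fun s => - ((fst (Z s) ^ 2 + snd (Z s) ^ 2) * exp (-2 * K s)))
      (fun x => - (exp (-2 * K x) * (2 * (fst (Z x) * fst (a x * Z x)%C + snd (Z x) * snd (a x * Z x)%C)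
        + -2 * k x * (fst (Z x) ^ 2 + snd (Z x) ^ 2)))) p q Hpq).
    assert (H' : - ((fst (Z p) ^ 2 + snd (Z p) ^ 2) * exp (-2 * K p)) <=
                 - ((fst (Z q) ^ 2 + snd (Z q) ^ 2) * exp (-2 * K q))).
    { apply H.
      - intros x Hx. apply: is_derive_opp. apply Hd; auto.
      - intros x Hx. pose proof (exp_pos (-2 * K x)).
        specialize (Hre x Hx). apply Rabs_le_between in Hre. nra. }
    replace (2 * (K q - K p)) with (- (-2 * K q) + -2 * K p) by ring.
    rewrite exp_plus exp_Ropp.
    pose proof (exp_pos (-2 * K q)).
    apply Rmult_le_reg_r with (exp (-2 * K q)); [lra|].
    eapply Rle_trans; [apply Ropp_le_cancel; exact H'|]. right; field; lra.
Qed.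

(** By [linear_ode_bound] the speed |Z'| is at most the derivative of
- |Z q| exp(K q - K). *)
Lemma linear_ode_variation (Z a : R -> C) (K k : R -> R) p q :
  p <= q ->
  (forall x, p <= x <= q -> cder Z x (a x * Z x)%C) ->
  (forall x, p <= x <= q -> is_derive K x (k x)) ->
  (forall x, p <= x <= q -> Cmod (a x) <= k x) ->
  Cmod (Z q - Z p)%C <= Cmod (Z q) * (exp (K q - K p) - 1).
Proof.
  intros Hpq HZ HK Hk.
  assert (H := complex_mean_value Z (fun x => a x * Z x)%C
    (fun x => Cmod (Z q) * - exp (K q - K x))
    (fun x => Cmod (Z q) * (k x * exp (K q - K x))) p q Hpq HZ).
  assert (H' : Cmod (Z q - Z p)%C <=
     Cmod (Z q) * - exp (K q - K q) - Cmod (Z q) * - exp (K q - K p)).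
  { apply H.
    - intros x Hx. apply: is_derive_scal. evar_last.
      + apply: is_derive_opp. apply (is_derive_exp_comp (fun s => K q - K s)).
        apply: is_derive_minus; [apply: is_derive_const | auto].
      + unfold minus, opp, plus, zero; simpl; ring.
    - intros x Hx. rewrite Cmod_mult.
      destruct (linear_ode_bound Z a K k x q) as [B _]; [lra | | | |].
      1,2,3: intros r Hr; auto with real; (apply HZ || apply HK || apply Hk); lra.
      pose proof (Hk x Hx). pose proof (Cmod_ge_0 (Z x)). pose proof (Cmod_ge_0 (a x)).
      nra. }
  replace (K q - K q) with 0 in H' by ring. rewrite exp_0 in H'. lra.
Qed.

(** * One-sided derivatives and extension of solutions *)

Lemma norm_C_R (z : C) : norm (K := R_AbsRing) (V := C_R_NormedModule) z = Cmod z.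
Proof.
  unfold norm; simpl. unfold prod_norm, Cmod. f_equal.
  unfold norm; simpl. unfold abs; simpl. rewrite !Rmult_1_r -!Rabs_mult.
  rewrite !Rabs_pos_eq //; nra.
Qed.

(** Differentiability at t relative to P in epsilon-delta form: it covers both
the relative derivative of the Loewner equation and the two-sided one. *)
Definition small_o_at (P : R -> Prop) (f : R -> C) (t : R) (l : C) : Prop :=
  forall eps, 0 < eps -> exists d, 0 < d /\ forall s, P s -> Rabs (s - t) < d ->
    Cmod (f s - f t - RtoC (s - t) * l)%C <= eps * Rabs (s - t).

Lemma is_derive_on_iff a b f t l : a <= t <= b ->
  is_derive_on a b f t l <-> small_o_at (Icc a b) f t l.
Proof.
  intros Ht. unfold is_derive_on.
  assert (Hn : forall s,
    norm (K := R_AbsRing) (V := C_R_NormedModule) (minus (minus (f s) (f t))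
       (scal (V := C_R_NormedModule) (minus (G := R_NormedModule) s t) l)) = Cmod (f s - f t - RtoC (s - t) * l)%C).
  { intros s. rewrite norm_C_R. f_equal.
    unfold minus, plus, opp, scal; simpl. unfold prod_scal, scal; simpl.
    unfold mult, plus, opp; simpl.
    apply injective_projections; simpl; ring. }
  assert (Hn' : forall s, norm (K := R_AbsRing) (V := R_NormedModule) (minus (G := R_NormedModule) s t) = Rabs (s - t)).
  { intros s. reflexivity. }
  assert (Hp : ProperFilter' (within (Icc a b) (locally t))).
  { constructor; [|apply within_filter; apply locally_filter].
    intros [d Hd]. apply (Hd t); [apply ball_center | exact Ht]. }
  split.
  - intros [_ H] eps Heps.
    assert (Hl : is_filter_lim (within (Icc a b) (locally t)) t).
    { intros P HP. apply: filter_imp HP. intros x Hx _; exact Hx. }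
    destruct (H t Hl (mkposreal eps Heps)) as [d Hd].
    exists d; split; [apply cond_pos|]. intros s Hs Hst.
    rewrite -Hn -Hn'. apply Hd; [exact Hst | exact Hs].
  - intros H. split; [apply: is_linear_scal_l|].
    intros x Hx eps.
    assert (E : x = t).
    { apply (is_filter_lim_unique (K := R_AbsRing) (V := R_NormedModule)
        (F := within (Icc a b) (locally t))); auto.
      intros P HP. apply: filter_imp HP. intros y Hy _; exact Hy. }
    subst x. destruct (H eps (cond_pos eps)) as (d & Hd & H').
    exists (mkposreal d Hd). intros s Hs Hi. rewrite Hn Hn'. apply H'; auto.
Qed.

Lemma cder_iff f t l : cder f t l <-> small_o_at (fun _ => True) f t l.
Proof.
  split.
  - intros [H1 H2] eps Heps.
    assert (He : 0 < eps / 2) by lra.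
    destruct H1 as [_ H1], H2 as [_ H2].
    destruct (H1 t (fun P H => H) (mkposreal _ He)) as [d1 D1].
    destruct (H2 t (fun P H => H) (mkposreal _ He)) as [d2 D2].
    exists (Rmin d1 d2); split; [apply Rmin_pos; apply cond_pos|].
    intros s _ Hs.
    assert (B1 : Rabs (fst (f s) - fst (f t) - (s - t) * fst l) <= eps / 2 * Rabs (s - t)).
    { apply D1. apply: Rlt_le_trans Hs _. apply Rmin_l. }
    assert (B2 : Rabs (snd (f s) - snd (f t) - (s - t) * snd l) <= eps / 2 * Rabs (s - t)).
    { apply D2. apply: Rlt_le_trans Hs _. apply Rmin_r. }
    set (z := (f s - f t - RtoC (s - t) * l)%C).
    replace (fst (f s) - fst (f t) - (s - t) * fst l) with (fst z) in B1 by (unfold z; simpl; ring).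
    replace (snd (f s) - snd (f t) - (s - t) * snd l) with (snd z) in B2 by (unfold z; simpl; ring).
    assert (Hz : z = (RtoC (fst z) + RtoC (snd z) * Ci)%C)
      by (apply injective_projections; simpl; ring).
    rewrite Hz. eapply Rle_trans; [apply Cmod_triangle|].
    rewrite Cmod_mult Cmod_Ci !Cmod_R. lra.
  - intros H. split.
    + split; [apply: is_linear_scal_l|]. intros x Hx eps.
      rewrite -(is_filter_lim_locally_unique t x Hx).
      destruct (H eps (cond_pos eps)) as (d & Hd & H').
      exists (mkposreal d Hd). intros s Hs.
      specialize (H' s I Hs).
      eapply Rle_trans; [|exact H'].
      eapply Rle_trans; [|apply re_le_Cmod]. right.
      unfold norm; simpl; unfold abs; simpl. f_equal.
      unfold minus, plus, opp, scal; simpl; unfold mult; simpl; ring.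
    + split; [apply: is_linear_scal_l|]. intros x Hx eps.
      rewrite -(is_filter_lim_locally_unique t x Hx).
      destruct (H eps (cond_pos eps)) as (d & Hd & H').
      exists (mkposreal d Hd). intros s Hs.
      specialize (H' s I Hs).
      eapply Rle_trans; [|exact H'].
      eapply Rle_trans; [|eapply Rle_trans; [apply Rmax_r | apply Rmax_Cmod]]. right.
      unfold norm; simpl; unfold abs; simpl. f_equal.
      unfold minus, plus, opp, scal; simpl; unfold mult; simpl; ring.
Qed.

(** Extending a solution by its tangent lines turns the one-sided derivatives at
the ends of its interval into two-sided ones. *)
Definition linear_extension (a b : R) (f l : R -> C) (r : R) : C :=
  if Rlt_dec r a then (f a + RtoC (r - a) * l a)%C
  else if Rlt_dec b r then (f b + RtoC (r - b) * l b)%C else f r.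

Lemma linear_extension_in a b f l r : a <= r <= b -> linear_extension a b f l r = f r.
Proof.
  intros Hr. unfold linear_extension.
  destruct (Rlt_dec r a); [lra|]. destruct (Rlt_dec b r); [lra|]. reflexivity.
Qed.

Lemma linear_extension_cder a b f l t : a <= t <= b ->
  small_o_at (Icc a b) f t (l t) -> cder (linear_extension a b f l) t (l t).
Proof.
  intros Ht H. apply cder_iff. intros eps Heps.
  destruct (H eps Heps) as (d & Hd & B).
  exists (Rmin d (Rmin (if Rlt_dec a t then t - a else 1) (if Rlt_dec t b then b - t else 1))).
  split.
  { repeat apply Rmin_pos; auto; [destruct (Rlt_dec a t) | destruct (Rlt_dec t b)]; lra. }
  intros s _ Hs.
  assert (S1 := Rlt_le_trans _ _ _ Hs (Rmin_l _ _)).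
  assert (S2 := Rlt_le_trans _ _ _ Hs (Rmin_r _ _)).
  assert (S3 := Rlt_le_trans _ _ _ S2 (Rmin_l _ _)).
  assert (S4 := Rlt_le_trans _ _ _ S2 (Rmin_r _ _)).
  assert (Z : forall z : C, z = RtoC 0 -> Cmod z <= eps * Rabs (s - t)).
  { intros z ->. rewrite Cmod_0. apply Rmult_le_pos; [lra | apply Rabs_pos]. }
  rewrite (linear_extension_in a b f l t Ht). unfold linear_extension.
  destruct (Rlt_dec s a) as [Hsa|Hsa]; [|destruct (Rlt_dec b s) as [Hbs|Hbs]].
  - destruct (Rlt_dec a t) as [Hat|Hat].
    + exfalso. rewrite Rabs_left in S3; lra.
    + assert (E : t = a) by lra. subst t. apply Z. ring.
  - destruct (Rlt_dec t b) as [Hat|Hat].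
    + exfalso. rewrite Rabs_pos_eq in S4; lra.
    + assert (E : t = b) by lra. subst t. apply Z. ring.
  - apply B; [unfold Icc; lra | exact S1].
Qed.

(** A solution of the Loewner equation on [0,t] with two-sided derivatives, also
at 0 and t; it is [linear_extension] that makes this possible. *)
Definition flow_on (lam : R -> R) (t : R) (g : R -> C) : Prop :=
  forall r, 0 <= r <= t -> g r <> RtoC (lam r) /\
     cder g r (RtoC 2 / (g r - RtoC (lam r)))%C.

Lemma flow_of_solution lam t z g : 0 <= t -> loewner_solution lam t z g ->
  exists h, h 0 = z /\ flow_on lam t h.
Proof.
  intros Ht [H0 H].
  exists (linear_extension 0 t g (fun r => RtoC 2 / (g r - RtoC (lam r)))%C).
  split; [rewrite linear_extension_in //; lra|].
  intros r Hr. destruct (H r Hr) as [Hne Hd].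
  rewrite linear_extension_in //. split; [exact Hne|].
  apply linear_extension_cder; [exact Hr|]. apply is_derive_on_iff; assumption.
Qed.

(** * The Loewner flow: positivity, uniqueness, continuation *)

Lemma im_le_Cmod (z : C) : Rabs (snd z) <= Cmod z.
Proof. eapply Rle_trans; [apply Rmax_r | apply Rmax_Cmod]. Qed.

Lemma cder_continuity f t l : cder f t l ->
  continuity_pt (fun s => fst (f s)) t /\ continuity_pt (fun s => snd (f s)) t.
Proof.
  intros [H1 H2]; split; apply continuity_pt_filterlim;
    apply: ex_derive_continuous; eexists; eassumption.
Qed.

Lemma flow_on_le lam t t' g : t <= t' -> flow_on lam t' g -> flow_on lam t g.
Proof. intros Ht H r Hr; apply H; lra. Qed.

Lemma fst_two_div (w : C) : fst (RtoC 2 / w)%C = 2 * fst w / (fst w ^ 2 + snd w ^ 2).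
Proof. simpl. unfold Rdiv. ring. Qed.

Lemma snd_two_div (w : C) : snd (RtoC 2 / w)%C = - 2 * snd w / (fst w ^ 2 + snd w ^ 2).
Proof. simpl. unfold Rdiv. ring. Qed.

Lemma flow_Im_deriv lam t g r : flow_on lam t g -> 0 <= r <= t ->
  is_derive (fun s => snd (g s)) r
    (- 2 * snd (g r) / ((fst (g r) - lam r) ^ 2 + snd (g r) ^ 2)).
Proof.
  intros H Hr. destruct (H r Hr) as [_ [_ Hd]]. evar_last; [exact Hd|].
  rewrite snd_two_div. simpl. unfold Rdiv. rewrite ?Ropp_0 ?Rplus_0_r. reflexivity.
Qed.

Lemma flow_Re_deriv lam t g r : flow_on lam t g -> 0 <= r <= t ->
  is_derive (fun s => fst (g s)) r
    (2 * (fst (g r) - lam r) / ((fst (g r) - lam r) ^ 2 + snd (g r) ^ 2)).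
Proof.
  intros H Hr. destruct (H r Hr) as [_ [Hd _]]. evar_last; [exact Hd|].
  rewrite fst_two_div. simpl. unfold Rdiv. rewrite ?Ropp_0 ?Rplus_0_r. reflexivity.
Qed.

Lemma flow_normsq_pos lam t g r : flow_on lam t g -> 0 <= r <= t ->
  0 < (fst (g r) - lam r) ^ 2 + snd (g r) ^ 2.
Proof.
  intros H Hr. destruct (H r Hr) as [Hne _].
  assert (H' := Cnorm2_pos (g r - RtoC (lam r))%C).
  simpl in H'. replace (snd (g r) + - 0) with (snd (g r)) in H' by ring.
  apply H'. intros E. apply Hne.
  replace (g r) with ((g r - RtoC (lam r)) + RtoC (lam r))%C by ring.
  rewrite E. ring.
Qed.

(** Im g satisfies a linear equation whose coefficient is bounded on the compact
interval, so it cannot vanish; a change of sign would need a zero. *)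
Lemma flow_Im_pos lam t g : (forall x, continuity_pt lam x) ->
  flow_on lam t g -> 0 < snd (g 0) -> forall r, 0 <= r <= t -> 0 < snd (g r).
Proof.
  intros Hc H H0.
  assert (Hnz : forall r, 0 <= r <= t -> snd (g r) <> 0).
  { intros r Hr.
    set (n := fun s => (fst (g s) - lam s) * (fst (g s) - lam s) + snd (g s) * snd (g s)).
    assert (Hn : forall s, 0 <= s <= r -> 0 < n s).
    { intros s Hs. assert (P := flow_normsq_pos lam t g s H ltac:(lra)). unfold n. nra. }
    destruct (continuity_ab_min n 0 r) as (m & Hm & Hmr); [lra | |].
    { intros c Hcr. destruct (H c ltac:(lra)) as [_ Hd].
      destruct (cder_continuity _ _ _ Hd) as [C1 C2].
      apply: continuity_pt_plus; apply: continuity_pt_mult => //;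
        apply: continuity_pt_minus => //. }
    assert (Hmp := Hn m Hmr).
    destruct (linear_ode_bound (fun s => RtoC (snd (g s)))
      (fun s => RtoC (- 2 / n s)) (fun s => 2 / n m * s) (fun _ => 2 / n m) 0 r) as [B _].
    - lra.
    - intros x Hx. eapply cder_eq.
      + apply cder_RtoC. apply (flow_Im_deriv lam t); [exact H | lra].
      + rewrite -RtoC_mult. f_equal. assert (P := Hn x Hx).
        replace ((fst (g x) - lam x) ^ 2 + snd (g x) ^ 2) with (n x) by (unfold n; ring).
        field. lra.
    - intros x Hx. auto_derive; auto. ring.
    - intros x Hx. rewrite Cmod_R. assert (Hx' := Hn x Hx).
      rewrite Rabs_left; [|apply Ropp_lt_cancel; unfold Rdiv; rewrite Ropp_0;
        assert (0 < / n x) by (apply Rinv_0_lt_compat; lra); lra].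
      replace (- (-2 / n x)) with (2 / n x) by (field; lra).
      apply Rmult_le_compat_l; [lra|]. apply Rinv_le_contravar; [lra | apply Hm; lra].
    - intros E. rewrite E Cmod_0 Rmult_0_l Cmod_R in B.
      pose proof (Rle_abs (snd (g 0))). lra. }
  intros r Hr. destruct (Rlt_dec 0 (snd (g r))) as [|Hn]; [assumption|exfalso].
  assert (Hlt : snd (g r) < 0) by (specialize (Hnz r Hr); lra).
  destruct (IVT_interv (fun s => - snd (g s)) 0 r) as (z & Hz & Hz0).
  - intros a Ha. destruct (H a ltac:(lra)) as [_ Hd].
    destruct (cder_continuity _ _ _ Hd) as [_ C2]. apply: continuity_pt_opp => //.
  - destruct (Req_dec r 0) as [->|]; lra.
  - lra.
  - lra.
  - apply (Hnz z); lra.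
Qed.

Lemma flow_Im_decr lam t g r s : (forall x, continuity_pt lam x) ->
  flow_on lam t g -> 0 < snd (g 0) -> 0 <= r -> r <= s -> s <= t ->
  snd (g s) <= snd (g r).
Proof.
  intros Hc H H0 Hr Hrs Hs. apply Ropp_le_cancel.
  apply (deriv_nonneg_incr (fun s => - snd (g s))
    (fun r => - (- 2 * snd (g r) / ((fst (g r) - lam r) ^ 2 + snd (g r) ^ 2)))).
  - lra.
  - intros x Hx. apply: is_derive_opp. apply (flow_Im_deriv lam t); [exact H|lra].
  - intros x Hx.
    assert (P := flow_normsq_pos lam t g x H ltac:(lra)).
    assert (Q := flow_Im_pos lam t g Hc H H0 x ltac:(lra)).
    unfold Rdiv. assert (0 < / ((fst (g x) - lam x) ^ 2 + snd (g x) ^ 2)) by (apply Rinv_0_lt_compat; lra).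
    assert (0 < snd (g x) * / ((fst (g x) - lam x) ^ 2 + snd (g x) ^ 2)) by (apply Rmult_lt_0_compat; lra). lra.
Qed.

Lemma flow_Im_le_Cmod (lam : R -> R) (g : R -> C) r : snd (g r) <= Cmod (g r - RtoC (lam r))%C.
Proof.
  eapply Rle_trans; [|apply im_le_Cmod]. simpl.
  eapply Rle_trans; [apply Rle_abs|]. right; f_equal; ring.
Qed.

(** The difference of two solutions obeys a linear equation.  It gives uniqueness
here, and the comparison of two tips later. *)
Lemma flow_difference lam t g h r : flow_on lam t g -> flow_on lam t h -> 0 <= r <= t ->
  cder (fun s => (g s - h s)%C) r
    (- RtoC 2 / ((g r - RtoC (lam r)) * (h r - RtoC (lam r))) * (g r - h r))%C.
Proof.
  intros Hg Hh Hr. destruct (Hg r Hr) as [Ng Dg], (Hh r Hr) as [Nh Dh].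
  eapply cder_eq; [apply cder_minus; eassumption|].
  assert (N : forall z : C, z <> RtoC (lam r) -> (z - RtoC (lam r))%C <> RtoC 0).
  { intros z Hz E. apply Hz. replace z with ((z - RtoC (lam r)) + RtoC (lam r))%C by ring.
    rewrite E. ring. }
  field. split; apply N; assumption.
Qed.

(** The imaginary parts decrease, so their final values bound |W| from below and
the coefficient in [flow_difference] is bounded. *)
Lemma flow_unique lam t g h : (forall x, continuity_pt lam x) ->
  flow_on lam t g -> flow_on lam t h -> 0 < snd (g 0) -> g 0 = h 0 ->
  forall r, 0 <= r <= t -> g r = h r.
Proof.
  intros Hc Hg Hh H0 E r Hr.
  assert (H0' : 0 < snd (h 0)) by (rewrite -E; exact H0).
  set (yg := snd (g r)). set (yh := snd (h r)).
  assert (Pg : 0 < yg) by (apply (flow_Im_pos lam t g); auto).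
  assert (Ph : 0 < yh) by (apply (flow_Im_pos lam t h); auto).
  assert (Pgh : 0 < yg * yh) by (apply Rmult_lt_0_compat; assumption).
  destruct (linear_ode_bound (fun s => (g s - h s)%C)
     (fun s => (- RtoC 2 / ((g s - RtoC (lam s)) * (h s - RtoC (lam s))))%C)
     (fun s => 2 / (yg * yh) * s) (fun _ => 2 / (yg * yh)) 0 r) as [_ B].
  - lra.
  - intros x Hx. apply (flow_difference lam t); auto; lra.
  - intros x Hx. auto_derive; auto. ring.
  - intros x Hx.
    assert (Bg : yg <= Cmod (g x - RtoC (lam x))%C).
    { eapply Rle_trans; [|apply flow_Im_le_Cmod]. apply (flow_Im_decr lam t); auto; lra. }
    assert (Bh : yh <= Cmod (h x - RtoC (lam x))%C).
    { eapply Rle_trans; [|apply flow_Im_le_Cmod]. apply (flow_Im_decr lam t); auto; lra. }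
    assert (Bgh : yg * yh <= Cmod (g x - RtoC (lam x))%C * Cmod (h x - RtoC (lam x))%C)
      by (apply Rmult_le_compat; lra).
    rewrite Cmod_div.
    + rewrite Cmod_opp Cmod_R Cmod_mult Rabs_pos_eq; [|lra].
      apply Rmult_le_compat_l; [lra|]. apply Rinv_le_contravar; lra.
    + apply Cmod_gt_0. rewrite Cmod_mult. lra.
  - rewrite E in B. replace (h 0 - h 0)%C with (RtoC 0) in B by ring.
    rewrite Cmod_0 Rmult_0_l in B.
    assert (Z : (g r - h r)%C = RtoC 0) by (apply Cmod_eq_0; pose proof (Cmod_ge_0 (g r - h r)%C); lra).
    replace (g r) with ((g r - h r) + h r)%C by ring. rewrite Z. ring.
Qed.

(** Solutions on all the intervals [0,s], s < t, agree by uniqueness.  At time r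
the value is taken from the solution on [0,(r+t)/2], which is defined on a
neighbourhood of r. *)
Lemma flow_glue lam t z : (forall x, continuity_pt lam x) -> 0 < t -> 0 < snd z ->
  (forall s, 0 <= s < t -> exists g, g 0 = z /\ flow_on lam s g) ->
  exists g, g 0 = z /\ forall s, s < t -> flow_on lam s g.
Proof.
  intros Hc Ht Hz H.
  set (F := fun s => epsilon (inhabits (fun _ : R => z)) (fun g => g 0 = z /\ flow_on lam s g)).
  assert (HF : forall s, 0 <= s < t -> F s 0 = z /\ flow_on lam s (F s)).
  { intros s Hs. apply (epsilon_spec (inhabits (fun _ : R => z)) (fun g => g 0 = z /\ flow_on lam s g)).
    apply H; exact Hs. }
  assert (HU : forall s s' r, 0 <= r -> r <= s -> s < t -> r <= s' -> s' < t -> F s r = F s' r).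
  { intros s s' r Hr Hs Hst Hs' Hst'.
    destruct (HF s ltac:(lra)) as [A1 A2], (HF s' ltac:(lra)) as [B1 B2].
    apply (flow_unique lam r); auto.
    - apply (flow_on_le lam r s); [lra | exact A2].
    - apply (flow_on_le lam r s'); [lra | exact B2].
    - rewrite A1; exact Hz.
    - rewrite A1 B1; reflexivity.
    - lra. }
  set (G := fun r => F ((Rmax 0 r + t) / 2) r).
  assert (HG : forall r, 0 <= r -> G r = F ((r + t) / 2) r).
  { intros r Hr. unfold G. rewrite Rmax_right; auto. }
  exists G. split.
  - rewrite HG; [|lra]. apply HF; lra.
  - intros s Hs r Hr. destruct (HF ((r + t) / 2) ltac:(lra)) as [_ A].
    destruct (A r ltac:(lra)) as [N D]. rewrite HG; [|lra]. split; [exact N|].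
    apply: cder_ext_loc D.
    assert (Hd : 0 < (t - r) / 2) by lra.
    destruct (Req_dec r 0) as [->|Hr0].
    + exists (mkposreal _ Hd). intros x Hx. unfold ball in Hx; simpl in Hx.
      unfold AbsRing_ball, abs, minus, plus, opp in Hx; simpl in Hx.
      apply Rabs_lt_between in Hx. unfold G. unfold Rmax. destruct (Rle_dec 0 x) as [Hx0|Hx0].
      * apply HU; lra.
      * reflexivity.
    + assert (Hd' : 0 < Rmin ((t - r) / 2) r) by (apply Rmin_pos; lra).
      exists (mkposreal _ Hd'). intros x Hx. unfold ball in Hx; simpl in Hx.
      unfold AbsRing_ball, abs, minus, plus, opp in Hx; simpl in Hx.
      apply Rabs_lt_between in Hx.
      pose proof (Rmin_l ((t - r) / 2) r). pose proof (Rmin_r ((t - r) / 2) r).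
      rewrite HG; [|lra]. apply HU; lra.
Qed.

Lemma Cmod_minus_sym (z w : C) : Cmod (z - w)%C = Cmod (w - z)%C.
Proof. rewrite -Cmod_opp. f_equal. ring. Qed.

(** Cauchy's criterion at the left of t, with the rate of convergence kept. *)
Lemma gauge_left_limit (g : R -> C) (w : R -> R) t :
  (forall u v, 0 <= u -> u <= v -> v < t -> Cmod (g v - g u)%C <= w u) ->
  (forall e, 0 < e -> exists u, 0 <= u < t /\ w u <= e) ->
  exists L : C, forall u, 0 <= u < t -> Cmod (L - g u)%C <= w u.
Proof.
  intros H Hw.
  assert (HL : exists L : C_R_CompleteNormedModule,
    filterlim (g : R -> C_R_CompleteNormedModule) (at_left t) (locally L)).
  { apply (filterlim_locally_cauchy (F := at_left t) (U := C_R_CompleteNormedModule)).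
    intros [e He]. destruct (Hw (e / 4) ltac:(lra)) as (u0 & Hu0 & B).
    exists (fun u => u0 < u < t). split.
    - assert (Hd : 0 < t - u0) by lra. exists (mkposreal _ Hd). intros y Hy Hyt. split; [|exact Hyt].
      apply Rabs_lt_between in Hy. simpl in Hy. unfold minus, plus, opp in Hy; simpl in Hy. lra.
    - intros u v Hu Hv. apply (norm_compat1 (V := C_R_NormedModule)). rewrite norm_C_R.
      change (Cmod (g v - g u)%C < e).
      assert (Bu := H u0 u ltac:(lra) ltac:(lra) ltac:(lra)).
      assert (Bv := H u0 v ltac:(lra) ltac:(lra) ltac:(lra)).
      replace (g v - g u)%C with ((g v - g u0) - (g u - g u0))%C by ring.
      unfold Cminus at 1. eapply Rle_lt_trans; [apply Cmod_triangle|]. rewrite Cmod_opp. lra. }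
  destruct HL as [L HL]. exists L. intros u Hu.
  apply le_epsilon. intros e He.
  assert (He2 : 0 < e / 4) by lra.
  assert (HB : at_left t (fun v => ball (M := C_R_CompleteNormedModule) L (e / 4) (g v))).
  { apply HL. exists (mkposreal _ He2). intros y Hy; exact Hy. }
  destruct HB as [d HB].
  set (v := Rmax u (t - d / 2)).
  pose proof (cond_pos d) as Hd.
  assert (Hv : u <= v /\ t - d / 2 <= v /\ v < t).
  { unfold v. repeat split; [apply Rmax_l | apply Rmax_r | apply Rmax_lub_lt; lra]. }
  assert (Bv : ball (M := C_R_CompleteNormedModule) L (e / 4) (g v)).
  { apply HB; [|lra]. apply Rabs_lt_between. unfold minus, plus, opp; simpl. lra. }
  destruct Bv as [B1 B2].
  assert (N : Cmod (L - g v)%C <= e / 2).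
  { assert (Hz : (L - g v)%C = (RtoC (fst L - fst (g v)) + RtoC (snd L - snd (g v)) * Ci)%C)
      by (apply injective_projections; simpl; ring).
    rewrite Hz. eapply Rle_trans; [apply Cmod_triangle|].
    rewrite Cmod_mult Cmod_Ci !Cmod_R.
    change (Rabs (fst (g v) - fst L) < e / 4) in B1.
    change (Rabs (snd (g v) - snd L) < e / 4) in B2.
    rewrite (Rabs_minus_sym (fst L)) (Rabs_minus_sym (snd L)). lra. }
  replace (L - g u)%C with ((L - g v) + (g v - g u))%C by ring.
  eapply Rle_trans; [apply Cmod_triangle|].
  assert (Q := H u v ltac:(lra) ltac:(lra) ltac:(lra)). lra.
Qed.

(** Away from the singularity g is Lipschitz, hence has a limit at t, and the
extended function still satisfies the equation at t because its derivative
converges. *)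
Lemma flow_extends lam t g c : (forall x, continuity_pt lam x) -> 0 < t -> 0 < c ->
  (forall s, s < t -> flow_on lam s g) ->
  (forall s, 0 <= s < t -> c <= Cmod (g s - RtoC (lam s))%C) ->
  exists h, loewner_solution lam t (g 0) h.
Proof.
  intros Hc Ht Hcp Hg Hb.
  assert (Hlip : forall u v, 0 <= u -> u <= v -> v < t -> Cmod (g v - g u)%C <= 2 / c * (v - u)).
  { intros u v Hu Huv Hv.
    assert (Q := complex_mean_value g (fun r => RtoC 2 / (g r - RtoC (lam r)))%C
      (fun r => 2 / c * r) (fun _ => 2 / c) u v Huv).
    replace (2 / c * (v - u)) with (2 / c * v - 2 / c * u) by ring.
    apply Q.
    - intros x Hx. apply (Hg v Hv); lra.
    - intros x Hx. auto_derive; auto. ring.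
    - intros x Hx. assert (Bx := Hb x ltac:(lra)). rewrite Cmod_div.
      + rewrite Cmod_R Rabs_pos_eq; [|lra]. apply Rmult_le_compat_l; [lra|].
        apply Rinv_le_contravar; lra.
      + apply Cmod_gt_0; lra. }
  assert (Hk : 0 < 2 / c) by (apply Rdiv_lt_0_compat; lra).
  destruct (gauge_left_limit g (fun u => 2 / c * (t - u)) t) as [L HL].
  { intros u v Hu Huv Hv. eapply Rle_trans; [apply Hlip; lra|]. apply Rmult_le_compat_l; lra. }
  { intros e He. exists (Rmax 0 (t - e / (2 / c))).
    assert (He' : 0 < e / (2 / c)) by (apply Rdiv_lt_0_compat; lra).
    pose proof (Rmax_l 0 (t - e / (2 / c))). pose proof (Rmax_r 0 (t - e / (2 / c))).
    assert (Rmax 0 (t - e / (2 / c)) < t) by (apply Rmax_lub_lt; lra).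
    split; [lra|]. apply Rle_trans with (2 / c * (e / (2 / c))); [apply Rmult_le_compat_l; lra|].
    right; field; lra. }
  assert (Hlam : forall e, 0 < e -> exists d, 0 < d /\ forall s, t - d < s < t -> Rabs (lam s - lam t) <= e).
  { intros e He. destruct (Hc t e He) as (d & Hd & B). exists d; split; [exact Hd|].
    intros s Hs. left. apply B. split; [split; [exact I | lra]|].
    unfold dist; simpl; unfold R_dist. rewrite Rabs_left; lra. }
  assert (HW : forall e, 0 < e -> exists d, 0 < d /\ forall s, 0 <= s < t -> t - d < s ->
     Cmod ((L - RtoC (lam t)) - (g s - RtoC (lam s)))%C <= e).
  { intros e He. destruct (Hlam (e / 2) ltac:(lra)) as (d & Hd & B).
    exists (Rmin d (e / 2 / (2 / c))). split; [apply Rmin_pos; auto; apply Rdiv_lt_0_compat; lra|].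
    intros s Hs Hds.
    pose proof (Rmin_l d (e / 2 / (2 / c))). pose proof (Rmin_r d (e / 2 / (2 / c))).
    replace (_ - _)%C with ((L - g s) + RtoC (lam s - lam t))%C
      by (rewrite RtoC_minus; ring).
    eapply Rle_trans; [apply Cmod_triangle|]. rewrite Cmod_R.
    assert (B1 := HL s Hs). assert (B2 := B s ltac:(lra)).
    assert (2 / c * (t - s) <= e / 2).
    { apply Rle_trans with (2 / c * (e / 2 / (2 / c))); [apply Rmult_le_compat_l; lra|].
      right; field; lra. }
    lra. }
  assert (HWt : c <= Cmod (L - RtoC (lam t))%C).
  { apply le_epsilon. intros e He. destruct (HW e He) as (d & Hd & B).
    set (s := Rmax 0 (t - d / 2)).
    assert (Hs : 0 <= s /\ t - d / 2 <= s /\ s < t).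
    { unfold s; repeat split; [apply Rmax_l | apply Rmax_r | apply Rmax_lub_lt; lra]. }
    assert (B1 := B s ltac:(lra) ltac:(lra)). assert (B2 := Hb s ltac:(lra)).
    rewrite Cmod_minus_sym in B1.
    replace (g s - RtoC (lam s))%C with ((g s - RtoC (lam s)) - (L - RtoC (lam t)) + (L - RtoC (lam t)))%C in B2 by ring.
    assert (B3 := Cmod_triangle ((g s - RtoC (lam s)) - (L - RtoC (lam t)))%C (L - RtoC (lam t))%C).
    lra. }
  set (h := fun s => if Rlt_dec s t then g s else L).
  assert (hlt : forall s, s < t -> h s = g s).
  { intros s Hs; unfold h; destruct (Rlt_dec s t); [reflexivity|lra]. }
  assert (ht : h t = L).
  { unfold h; destruct (Rlt_dec t t); [lra|reflexivity]. }
  exists h. split; [apply hlt; lra|]. intros s Hs.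
  destruct (Rlt_dec s t) as [Hst|Hst].
  - rewrite (hlt s Hst). destruct (Hg s Hst s ltac:(lra)) as [N D]. split; [exact N|].
    apply is_derive_on_iff; [exact Hs|]. apply cder_iff in D.
    intros e He. destruct (D e He) as (d & Hd & B).
    exists (Rmin d (t - s)). split; [apply Rmin_pos; lra|]. intros r Hr Hrs.
    pose proof (Rmin_l d (t - s)). pose proof (Rmin_r d (t - s)).
    rewrite (hlt s Hst) hlt; [|apply Rabs_lt_between in Hrs; lra].
    apply B; [exact I | lra].
  - assert (E : s = t) by lra. subst s. rewrite ht. split.
    { intros E. rewrite E in HWt. replace (RtoC (lam t) - RtoC (lam t))%C with (RtoC 0) in HWt by ring.
      rewrite Cmod_0 in HWt. lra. }
    apply is_derive_on_iff; [exact Hs|].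
    set (Wt := (L - RtoC (lam t))%C) in *.
    (* |2/W - 2/Wt| <= 2 |W - Wt| / c^2, which this choice bounds by e. *)
    intros e He. destruct (HW (e * c * c / 2)) as (d & Hd & B).
    { apply Rdiv_lt_0_compat; [|lra]. repeat apply Rmult_lt_0_compat; lra. }
    exists d; split; [exact Hd|]. intros r Hr Hrt. rewrite ht.
    destruct (Rlt_dec r t) as [Hr1|Hr1].
    2: { assert (E : r = t) by (unfold Icc in Hr; lra). subst r. rewrite ht.
         replace (_ - _)%C with (RtoC 0); [rewrite Cmod_0; apply Rmult_le_pos; [lra|apply Rabs_pos]|].
         replace (t - t) with 0 by ring. ring. }
    rewrite (hlt r Hr1). rewrite (Rabs_left (r - t)) in Hrt |- *; [|lra].
    apply Rle_trans with (e * (t - r)); [|right; ring].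
    apply le_epsilon. intros e2 He2.
    (* The mean value inequality applies only before t, hence r2 < t so close
       to t that replacing r2 by t costs at most e2. *)
    set (k2 := 2 / c + Cmod (RtoC 2 / Wt)%C + 1).
    assert (Hk2 : 0 < k2) by (unfold k2; pose proof (Cmod_ge_0 (RtoC 2 / Wt)%C); lra).
    set (r2 := Rmax r (t - e2 / k2)).
    assert (He2k : 0 < e2 / k2) by (apply Rdiv_lt_0_compat; lra).
    assert (Hr2 : r <= r2 /\ t - e2 / k2 <= r2 /\ r2 < t).
    { unfold r2; repeat split; [apply Rmax_l | apply Rmax_r | apply Rmax_lub_lt; lra]. }
    assert (Q := complex_mean_value (fun x => (g x - RtoC x * (RtoC 2 / Wt))%C)
      (fun x => (RtoC 2 / (g x - RtoC (lam x)) - RtoC 2 / Wt)%C)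
      (fun x => e * x) (fun _ => e) r r2 ltac:(lra)).
    assert (Q' : Cmod (g r2 - RtoC r2 * (RtoC 2 / Wt) - (g r - RtoC r * (RtoC 2 / Wt)))%C <= e * r2 - e * r).
    { apply Q.
      - intros x Hx. eapply cder_eq.
        + apply cder_minus; [apply (Hg r2); unfold Icc in Hr; lra|].
          apply cder_mult; [apply cder_RtoC; apply: is_derive_id | apply cder_const].
        + unfold one; simpl. ring.
      - intros x Hx. auto_derive; auto. ring.
      - intros x Hx. unfold Icc in Hr.
        assert (Bx := Hb x ltac:(lra)). assert (B1 := B x ltac:(lra) ltac:(lra)).
        assert (N1 : (g x - RtoC (lam x))%C <> RtoC 0) by (apply Cmod_gt_0; lra).
        assert (N2 : Wt <> RtoC 0) by (apply Cmod_gt_0; lra).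
        replace (_ - _)%C with (RtoC 2 * (Wt - (g x - RtoC (lam x))) / ((g x - RtoC (lam x)) * Wt))%C
          by (field; auto).
        rewrite Cmod_div; [|apply Cmult_neq_0; auto].
        rewrite !Cmod_mult Cmod_R Rabs_pos_eq; [|lra].
        assert (c * c <= Cmod (g x - RtoC (lam x))%C * Cmod Wt) by (apply Rmult_le_compat; lra).
        apply Rle_div_l; [nra|]. nra. }
    assert (Q2 := HL r2 ltac:(unfold Icc in Hr; lra)).
    replace (g r - L - RtoC (r - t) * (RtoC 2 / Wt))%C with
      (- (g r2 - RtoC r2 * (RtoC 2 / Wt) - (g r - RtoC r * (RtoC 2 / Wt)))
       + (- (L - g r2) + RtoC (t - r2) * (RtoC 2 / Wt)))%C
      by (rewrite !RtoC_minus; ring).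
    eapply Rle_trans; [apply Cmod_triangle|]. rewrite Cmod_opp.
    assert (Q3 := Cmod_triangle (- (L - g r2))%C (RtoC (t - r2) * (RtoC 2 / Wt))%C).
    rewrite Cmod_opp Cmod_mult Cmod_R (Rabs_pos_eq (t - r2)) in Q3; [|lra].
    assert (Q4 : k2 * (t - r2) <= e2).
    { apply Rle_trans with (k2 * (e2 / k2)); [apply Rmult_le_compat_l; lra|].
      right; field; lra. }
    unfold k2 in Q4. nra.
Qed.

(** * One tip: comparison with a vertical slit *)

(** At the last point where f is nonnegative, f vanishes and increases. *)
Lemma barrier (f df : R -> R) a b : a <= b ->
  (forall x, a <= x <= b -> is_derive f x (df x)) -> 0 <= f a ->
  (forall x, a <= x <= b -> f x = 0 -> 0 < df x) -> 0 <= f b.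
Proof.
  intros Hab Hd Ha Hz. destruct (Rle_dec 0 (f b)) as [|Hb]; [assumption|exfalso].
  assert (Hb' : f b < 0) by lra. clear Hb.
  assert (Hcont : forall x, a <= x <= b -> forall e, 0 < e -> exists d, 0 < d /\
    forall y, Rabs (y - x) < d -> Rabs (f y - f x) < e).
  { intros x Hx e He.
    assert (Hc : continuous f x) by (apply: ex_derive_continuous; eexists; apply Hd; exact Hx).
    destruct (Hc (fun y => Rabs (y - f x) < e)) as [d B].
    - exists (mkposreal e He). intros y Hy; exact Hy.
    - exists d. split; [apply cond_pos | intros y Hy; apply (B y Hy)]. }
  destruct (completeness (fun x => a <= x <= b /\ 0 <= f x)) as [m [Hub Hlub]].
  { exists b. intros x [Hx _]; lra. }
  { exists a. split; [lra|exact Ha]. }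
  assert (Ham : a <= m) by (apply Hub; split; [lra|exact Ha]).
  assert (Hmb : m <= b) by (apply Hlub; intros x [Hx _]; lra).
  assert (Hfm : 0 <= f m).
  { destruct (Rle_dec 0 (f m)) as [|Hn]; [assumption|exfalso].
    destruct (Hcont m ltac:(lra) (- f m) ltac:(lra)) as (d & Hdp & B).
    assert (m <= m - d); [|lra]. apply Hlub. intros x [Hx Hfx].
    destruct (Rle_dec x (m - d)) as [|Hn']; [assumption|exfalso].
    assert (x <= m) by (apply Hub; auto).
    assert (Q := B x). rewrite Rabs_left1 in Q; [|lra].
    specialize (Q ltac:(lra)). apply Rabs_lt_between in Q. lra. }
  assert (Hmb' : m < b).
  { destruct (Req_dec m b) as [E|]; [|lra]. subst m. lra. }
  assert (Hneg : forall x, m < x <= b -> f x < 0).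
  { intros x Hx. destruct (Rlt_dec (f x) 0) as [|Hn]; [assumption|exfalso].
    assert (x <= m) by (apply Hub; split; lra). lra. }
  assert (Hfm0 : f m = 0).
  { destruct (Req_dec (f m) 0) as [|Hn]; [assumption|exfalso].
    destruct (Hcont m ltac:(lra) (f m) ltac:(lra)) as (d & Hdp & B).
    set (x := Rmin b (m + d / 2)).
    assert (Hx : m < x /\ x <= b /\ x <= m + d / 2).
    { unfold x; repeat split; [apply Rmin_glb_lt; lra | apply Rmin_l | apply Rmin_r]. }
    assert (Q := B x). rewrite Rabs_pos_eq in Q; [|lra].
    specialize (Q ltac:(lra)). apply Rabs_lt_between in Q.
    assert (Q' := Hneg x ltac:(lra)). lra. }
  assert (Hp := Hz m ltac:(lra) Hfm0).
  assert (HD := Hd m ltac:(lra)). apply is_derive_Reals in HD.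
  destruct (HD (df m) Hp) as [d B].
  pose proof (cond_pos d) as Hdp.
  set (x := Rmin (b - m) (d / 2)).
  assert (Hx : 0 < x /\ x <= b - m /\ x <= d / 2).
  { unfold x; repeat split; [apply Rmin_pos; lra | apply Rmin_l | apply Rmin_r]. }
  assert (Q := B x ltac:(lra)). rewrite (Rabs_pos_eq x) in Q; [|lra].
  specialize (Q ltac:(lra)). rewrite Hfm0 in Q. apply Rabs_lt_between in Q.
  assert (Q' := Hneg (m + x) ltac:(lra)).
  assert ((f (m + x) - 0) / x < 0).
  { apply Rdiv_neg_pos; lra. }
  lra.
Qed.

(** The model sqrt(d^2 + r) has speed 1/(2x) where it equals x.  A point at
distance D within a quarter of x from the driving function, at height y <= x,
moves faster. *)
Lemma barrier_slope d y x D : 0 < d -> 0 < y <= d -> d <= x ->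
  Rabs (D - x) <= x / 4 -> / (2 * x) < 2 * D / (D ^ 2 + y ^ 2).
Proof.
  intros Hd Hy Hx HD. apply Rabs_le_between in HD.
  assert (0 < D ^ 2 + y ^ 2) by nra.
  apply Rmult_lt_reg_r with (2 * x * (D ^ 2 + y ^ 2)); [nra|].
  replace (/ (2 * x) * (2 * x * (D ^ 2 + y ^ 2))) with (D ^ 2 + y ^ 2) by (field; lra).
  replace (2 * D / (D ^ 2 + y ^ 2) * (2 * x * (D ^ 2 + y ^ 2))) with (4 * D * x) by (field; lra).
  assert (0 <= (D - 3/4 * x) * (5/4 * x - D)) by (apply Rmult_le_pos; lra).
  nra.
Qed.

(** Once a point is at least as far from the driving function horizontally as it
is high, its abscissa stays beyond L(s0) + sqrt(d^2 + (s - s0)), where d is the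
initial distance, and L moves by at most sqrt(s - s0)/4. *)
Lemma escape (X y L : R -> R) s0 s : s0 <= s ->
  (forall r, s0 <= r <= s -> is_derive X r (2 * (X r - L r) / ((X r - L r) ^ 2 + y r ^ 2))) ->
  (forall r, s0 <= r <= s -> 0 < y r <= y s0) ->
  (forall r, s0 <= r <= s -> Rabs (L r - L s0) <= sqrt (r - s0) / 4) ->
  y s0 <= X s0 - L s0 ->
  3 / 4 * (X s0 - L s0) <= X s - L s.
Proof.
  intros Hs HX Hy HL H0. set (d := X s0 - L s0) in *.
  assert (Hy0 := Hy s0 ltac:(lra)).
  assert (Hd : 0 < d) by lra.
  assert (Hd2 : forall r, s0 <= r -> 0 < d ^ 2 + (r - s0)) by (intros; nra).
  assert (Hsq : forall r, s0 <= r -> d <= sqrt (d ^ 2 + (r - s0)) /\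
     sqrt (r - s0) <= sqrt (d ^ 2 + (r - s0))).
  { intros r Hr. split; [|apply sqrt_le_1_alt; nra].
    rewrite -{1}(sqrt_pow2 d); [|lra]. apply sqrt_le_1_alt; lra. }
  assert (B : 0 <= X s - L s0 - sqrt (d ^ 2 + (s - s0))).
  { apply (barrier (fun r => X r - L s0 - sqrt (d ^ 2 + (r - s0)))
      (fun r => 2 * (X r - L r) / ((X r - L r) ^ 2 + y r ^ 2) - / (2 * sqrt (d ^ 2 + (r - s0)))) s0); auto.
    - intros r Hr. apply: is_derive_minus.
      + evar_last; [apply: is_derive_minus; [apply HX; exact Hr | apply: is_derive_const]|].
        unfold minus, plus, opp, zero; simpl; ring.
      + auto_derive; [specialize (Hd2 r ltac:(lra)); unfold Rminus in Hd2; lra|].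
        unfold Rminus. simpl. field. apply Rgt_not_eq, sqrt_lt_R0.
        specialize (Hd2 r ltac:(lra)). simpl in Hd2. lra.
    - replace (s0 - s0) with 0 by ring. rewrite Rplus_0_r sqrt_pow2; [|lra]. unfold d; lra.
    - intros r Hr E. destruct (Hsq r ltac:(lra)) as [S1 S2].
      assert (Hlt := barrier_slope d (y r) (sqrt (d ^ 2 + (r - s0))) (X r - L r) Hd).
      specialize (Hy r Hr). specialize (HL r Hr).
      specialize (Hlt ltac:(lra) S1).
      assert (Rabs (X r - L r - sqrt (d ^ 2 + (r - s0))) <= sqrt (d ^ 2 + (r - s0)) / 4).
      { replace (_ - _ - _) with (- (L r - L s0)) by lra. rewrite Rabs_Ropp. lra. }
      specialize (Hlt ltac:(assumption)). lra. }
  destruct (Hsq s Hs) as [S1 S2]. specialize (HL s ltac:(lra)).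
  apply Rabs_le_between in HL. lra.
Qed.

(** The Hölder condition with exponent 1/2 + delta on the whole line, the power
being split as the square root times the gain delta. *)
Definition holder_line (M delta : R) (lam : R -> R) : Prop :=
  forall a b, a <> b -> Rabs (lam a - lam b) <= M * (sqrt (Rabs (a - b)) * Rpower (Rabs (a - b)) delta).

(** The flow line of a tip: the solution lives exactly on [0,t), which is
expressed by the distance to the singularity having infimum 0. *)
Definition tip_flow (lam : R -> R) (t : R) (g : R -> C) : Prop :=
  0 < t /\ (forall s, s < t -> flow_on lam s g) /\ 0 < snd (g 0) /\
  forall c, 0 < c -> exists s, 0 <= s < t /\ Cmod (g s - RtoC (lam s))%C < c.

Lemma Rpower_pos x y : 0 < Rpower x y.
Proof. apply exp_pos. Qed.

Lemma holder_gauge_vanishes H delta e : 0 < H -> 0 < delta -> 0 < e ->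
  exists d, 0 < d /\ forall r, 0 < r <= d -> H * Rpower r delta <= e.
Proof.
  intros HH Hd He. exists (Rpower (e / H) (/ delta)). split; [apply Rpower_pos|].
  intros r Hr. assert (Q : Rpower r delta <= Rpower (Rpower (e / H) (/ delta)) delta)
    by (apply Rle_Rpower_l; lra).
  rewrite Rpower_mult in Q. replace (/ delta * delta) with 1 in Q by (field; lra).
  assert (0 < e / H) by (apply Rdiv_lt_0_compat; lra).
  rewrite Rpower_1 in Q; [|assumption].
  apply Rle_trans with (H * (e / H)); [apply Rmult_le_compat_l; lra | right; field; lra].
Qed.

(** On short scales the gain delta makes the Hölder-1/2 constant small; 1/4 is small
enough for [barrier_slope]. *)
Lemma holder_small M delta lam eta : holder_line M delta lam ->
  (forall tau, 0 < tau <= eta -> M * Rpower tau delta <= 1 / 4) ->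
  forall a b, Rabs (a - b) <= eta -> Rabs (lam a - lam b) <= sqrt (Rabs (a - b)) / 4.
Proof.
  intros HL Heta a b Hab. pose proof (sqrt_pos (Rabs (a - b))) as Hs.
  destruct (Req_dec a b) as [->|Hne].
  - replace (lam b - lam b) with 0 by ring. rewrite Rabs_R0. lra.
  - assert (Hp : 0 < Rabs (a - b)) by (apply Rabs_pos_lt; lra).
    specialize (HL a b Hne). specialize (Heta _ (conj Hp Hab)). nra.
Qed.

Lemma holder_continuity M delta lam : 0 < M -> 0 < delta -> holder_line M delta lam ->
  forall x, continuity_pt lam x.
Proof.
  intros HM Hd HL x e He.
  destruct (holder_gauge_vanishes M delta (1 / 4) HM Hd ltac:(lra)) as (eta & Heta & Hs).
  exists (Rmin eta (e * e)). split; [apply Rmin_pos; nra|].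
  intros y [_ Hy]. unfold dist in *; simpl in *; unfold R_dist in *.
  pose proof (Rmin_l eta (e * e)). pose proof (Rmin_r eta (e * e)).
  eapply Rle_lt_trans; [apply (holder_small M delta lam eta HL Hs); lra|].
  assert (sqrt (Rabs (y - x)) <= e); [|lra].
  rewrite -(sqrt_square e); [|lra]. apply sqrt_le_1_alt. lra.
Qed.

(** Otherwise [escape], applied to Re g or to its opposite, keeps the point at a
positive distance from lam up to time t. *)
Lemma tip_cone M delta lam eta t g : 0 < M -> 0 < delta -> holder_line M delta lam ->
  (forall tau, 0 < tau <= eta -> M * Rpower tau delta <= 1 / 4) ->
  tip_flow lam t g -> forall s, 0 <= s -> t - eta <= s -> s < t ->
  Rabs (fst (g s) - lam s) <= snd (g s).
Proof.
  intros HM Hd HL Heta (Ht & Hg & H0 & Hinf) s0 Hs0 Hse Hst.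
  assert (Hc := holder_continuity M delta lam HM Hd HL).
  destruct (Rle_dec (Rabs (fst (g s0) - lam s0)) (snd (g s0))) as [|Hn]; [assumption|exfalso].
  assert (Hpos : forall s, 0 <= s < t -> 0 < snd (g s)).
  { intros s Hs. apply (flow_Im_pos lam s g Hc (Hg s ltac:(lra)) H0); lra. }
  assert (Hdec : forall r s, 0 <= r -> r <= s -> s < t -> snd (g s) <= snd (g r)).
  { intros r s Hr Hrs Hs. apply (flow_Im_decr lam s g r s Hc (Hg s Hs) H0); lra. }
  assert (Hfar : forall s, s0 <= s < t -> 3 / 4 * Rabs (fst (g s0) - lam s0) <= Rabs (fst (g s) - lam s)).
  { intros s Hs.
    assert (Hesc : forall sg, (sg = 1 \/ sg = -1) -> snd (g s0) <= sg * (fst (g s0) - lam s0) ->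
      3 / 4 * (sg * (fst (g s0) - lam s0)) <= sg * (fst (g s) - lam s)).
    { intros sg Hsg HD.
      assert (Hsg2 : sg * sg = 1) by (destruct Hsg as [->| ->]; ring).
      assert (Hsga : Rabs sg = 1) by (destruct Hsg as [->| ->]; [apply Rabs_R1 | rewrite Rabs_Ropp Rabs_R1; reflexivity]).
      rewrite (Rmult_minus_distr_l sg (fst (g s0))) (Rmult_minus_distr_l sg (fst (g s))).
      apply (escape (fun r => sg * fst (g r)) (fun r => snd (g r)) (fun r => sg * lam r)).
      - lra.
      - intros r Hr. evar_last.
        + apply: is_derive_scal. apply (flow_Re_deriv lam s); [apply Hg; lra | lra].
        + unfold Rdiv. replace ((sg * fst (g r) - sg * lam r) ^ 2) with (sg * sg * (fst (g r) - lam r) ^ 2) by ring.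
          rewrite Hsg2 Rmult_1_l. ring.
      - intros r Hr. split; [apply Hpos; lra | apply Hdec; lra].
      - intros r Hr. rewrite -Rmult_minus_distr_l Rabs_mult Hsga Rmult_1_l.
        rewrite -(Rabs_pos_eq (r - s0)); [|lra].
        apply (holder_small M delta lam eta HL Heta). rewrite Rabs_pos_eq; lra.
      - lra. }
    destruct (Rle_dec 0 (fst (g s0) - lam s0)) as [Hp|Hp].
    - rewrite (Rabs_pos_eq (fst (g s0) - lam s0)) in Hn |- *; [|lra].
      assert (Q := Hesc 1 (or_introl eq_refl) ltac:(lra)).
      pose proof (Rle_abs (fst (g s) - lam s)). lra.
    - rewrite (Rabs_left1 (fst (g s0) - lam s0)) in Hn |- *; [|lra].
      assert (Q := Hesc (-1) (or_intror eq_refl) ltac:(lra)).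
      pose proof (Rle_abs (- (fst (g s) - lam s))) as Q'. rewrite Rabs_Ropp in Q'. lra. }
  assert (Hy0 := Hpos s0 ltac:(lra)).
  destruct (Hinf (3 / 4 * snd (g s0)) ltac:(lra)) as (s & Hs & Hlt).
  destruct (Rle_dec s0 s) as [Hle|Hle].
  - assert (Q := Hfar s ltac:(lra)).
    assert (Q' := re_le_Cmod (g s - RtoC (lam s))%C). unfold Re in Q'; simpl in Q'.
    unfold Rminus in *. lra.
  - assert (Q := Hdec s s0 ltac:(lra) ltac:(lra) ltac:(lra)).
    assert (Q' := flow_Im_le_Cmod lam g s). lra.
Qed.

(** In the cone, (y^2)' = -4 y^2/(D^2 + y^2) <= -2, and y^2 stays
nonnegative up to time t. *)
Lemma tip_Im_lower M delta lam eta t g : 0 < M -> 0 < delta -> holder_line M delta lam ->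
  (forall tau, 0 < tau <= eta -> M * Rpower tau delta <= 1 / 4) ->
  tip_flow lam t g -> forall s, 0 <= s -> t - eta <= s -> s < t ->
  sqrt (t - s) <= snd (g s).
Proof.
  intros HM Hd HL Heta HT s Hs Hse Hst.
  assert (Hcone := tip_cone M delta lam eta t g HM Hd HL Heta HT).
  destruct HT as (Ht & Hg & H0 & Hinf).
  assert (Hc := holder_continuity M delta lam HM Hd HL).
  assert (Hpos : forall s, 0 <= s < t -> 0 < snd (g s)).
  { intros r Hr. apply (flow_Im_pos lam r g Hc (Hg r ltac:(lra)) H0); lra. }
  assert (B : t - s <= snd (g s) ^ 2).
  { apply le_epsilon. intros e He.
    set (s' := Rmax s (t - e)).
    assert (Hs' : s <= s' /\ t - e <= s' /\ s' < t).
    { unfold s'; repeat split; [apply Rmax_l | apply Rmax_r | apply Rmax_lub_lt; lra]. }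
    assert (Q : - (snd (g s) ^ 2 + 2 * s) <= - (snd (g s') ^ 2 + 2 * s')).
    { apply (deriv_nonneg_incr (fun r => - (snd (g r) ^ 2 + 2 * r))
       (fun r => - (2 * snd (g r) * (- 2 * snd (g r) / ((fst (g r) - lam r) ^ 2 + snd (g r) ^ 2)) + 2))).
      - lra.
      - intros r Hr. apply: is_derive_opp. apply: is_derive_plus.
        + evar_last; [apply: is_derive_pow; apply (flow_Im_deriv lam s'); [apply Hg; lra | lra]|].
          simpl. ring.
        + auto_derive; auto. ring.
      - intros r Hr. assert (C := Hcone r ltac:(lra) ltac:(lra) ltac:(lra)).
        assert (P := Hpos r ltac:(lra)).
        apply Rabs_le_between in C.
        set (D := fst (g r) - lam r) in *. set (y := snd (g r)) in *.
        assert (Hn : 0 < D ^ 2 + y ^ 2) by nra.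
        replace (- (2 * y * (-2 * y / (D ^ 2 + y ^ 2)) + 2))
          with (2 * (y ^ 2 - D ^ 2) / (D ^ 2 + y ^ 2)) by (field; lra).
        apply Rdiv_le_0_compat; nra. }
    pose proof (pow2_ge_0 (snd (g s'))). lra. }
  rewrite -(sqrt_pow2 (snd (g s))); [|left; apply Hpos; lra].
  apply sqrt_le_1_alt. exact B.
Qed.

(** In the cone |W| is at most 2 Im W, and Im g decreases to 0. *)
Lemma tip_limit M delta lam eta t g : 0 < M -> 0 < delta -> 0 < eta -> holder_line M delta lam ->
  (forall tau, 0 < tau <= eta -> M * Rpower tau delta <= 1 / 4) ->
  tip_flow lam t g -> forall e, 0 < e -> exists s1, 0 <= s1 < t /\
  forall s, s1 <= s < t -> Cmod (g s - RtoC (lam s))%C <= e.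
Proof.
  intros HM Hd Hep HL Heta HT e He.
  assert (Hcone := tip_cone M delta lam eta t g HM Hd HL Heta HT).
  destruct HT as (Ht & Hg & H0 & Hinf).
  assert (Hc := holder_continuity M delta lam HM Hd HL).
  destruct (Hinf (e / 2) ltac:(lra)) as (s0 & Hs0 & B0).
  exists (Rmax s0 (t - eta)).
  pose proof (Rmax_l s0 (t - eta)). pose proof (Rmax_r s0 (t - eta)).
  split; [split; [lra | apply Rmax_lub_lt; lra]|].
  intros s Hs. assert (C := Hcone s ltac:(lra) ltac:(lra) ltac:(lra)).
  assert (D := flow_Im_decr lam s g s0 s Hc (Hg s ltac:(lra)) H0 ltac:(lra) ltac:(lra) ltac:(lra)).
  assert (Q := flow_Im_le_Cmod lam g s0).
  assert (P := flow_Im_pos lam s g Hc (Hg s ltac:(lra)) H0 s ltac:(lra)).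
  replace (g s - RtoC (lam s))%C with (RtoC (fst (g s) - lam s) + RtoC (snd (g s)) * Ci)%C
    by (apply injective_projections; simpl; ring).
  eapply Rle_trans; [apply Cmod_triangle|].
  rewrite Cmod_mult Cmod_Ci !Cmod_R (Rabs_pos_eq (snd (g s))); lra.
Qed.

Lemma Rpower_sqrt_split x d : 0 < x -> Rpower x (1 / 2 + d) = sqrt x * Rpower x d.
Proof. intros Hx. rewrite Rpower_plus. f_equal. rewrite -Rpower_sqrt //. f_equal. lra. Qed.

Lemma is_derive_Rpower_gap t s a : s < t ->
  is_derive (fun s => Rpower (t - s) a) s (- a * Rpower (t - s) (a - 1)).
Proof.
  intros Hs. evar_last.
  - unfold Rpower. apply is_derive_exp_comp. apply: is_derive_scal.
    apply: (is_derive_comp ln (fun s => t - s)).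
    + apply is_derive_ln. lra.
    + apply: is_derive_minus; [apply: is_derive_const | apply: is_derive_id].
  - unfold scal, minus, plus, opp, zero, one; simpl. unfold mult; simpl.
    change (exp (a * ln (t - s))) with (Rpower (t - s) a).
    replace (Rpower (t - s) a) with (Rpower (t - s) (a - 1) * (t - s)).
    + field. lra.
    + rewrite -{2}(Rpower_1 (t - s)); [|lra]. rewrite -Rpower_plus. f_equal. ring.
Qed.

(** The sharp form of the comparison with the vertical slit.  For t - s > eta the
lower bound comes from the monotonicity of Im g, at the cost of the factor
sqrt(eta/T). *)
Lemma tip_estimate T M delta : 0 < T -> 0 < M -> 0 < delta ->
  exists c0 C1, 0 < c0 /\ 0 < C1 /\
  forall lam t g, holder_line M delta lam -> t <= T -> tip_flow lam t g ->
  forall s, 0 <= s < t ->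
    c0 * sqrt (t - s) <= snd (g s) /\
    Cmod (g s - RtoC (lam s) - RtoC (2 * sqrt (t - s)) * Ci)%C
      <= C1 * (sqrt (t - s) * Rpower (t - s) delta).
Proof.
  intros HT HM Hd. destruct (holder_gauge_vanishes M delta (1 / 4) HM Hd ltac:(lra)) as (eta & Hep & Heta).
  set (c0 := Rmin 1 (sqrt (eta / T))).
  assert (Hc0 : 0 < c0).
  { apply Rmin_pos; [lra | apply sqrt_lt_R0, Rdiv_lt_0_compat; lra]. }
  assert (Hc01 : c0 <= 1) by apply Rmin_l.
  exists c0, (2 * M / c0 + M).
  assert (HMc : 0 < M / c0) by (apply Rdiv_lt_0_compat; lra).
  split; [exact Hc0|]. split; [unfold Rdiv in *; lra|].
  intros lam t g HL HtT HTip.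
  assert (Hlow : forall s, 0 <= s < t -> c0 * sqrt (t - s) <= snd (g s)).
  { intros s Hs. destruct (Rle_dec (t - eta) s) as [Hse|Hse].
    - assert (B := tip_Im_lower M delta lam eta t g HM Hd HL Heta HTip s ltac:(lra) Hse ltac:(lra)).
      pose proof (sqrt_pos (t - s)). nra.
    - assert (B := tip_Im_lower M delta lam eta t g HM Hd HL Heta HTip (t - eta) ltac:(lra) ltac:(lra) ltac:(lra)).
      destruct HTip as (Ht & Hg & H0 & _).
      assert (D := flow_Im_decr lam (t - eta) g s (t - eta) (holder_continuity M delta lam HM Hd HL)
        (Hg (t - eta) ltac:(lra)) H0 ltac:(lra) ltac:(lra) ltac:(lra)).
      replace (t - (t - eta)) with eta in B by ring.
      apply Rle_trans with (sqrt (eta / T) * sqrt T).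
      + apply Rmult_le_compat; [lra | apply sqrt_pos | apply Rmin_r | apply sqrt_le_1_alt; lra].
      + rewrite -sqrt_mult_alt; [|left; apply Rdiv_lt_0_compat; lra].
        replace (eta / T * T) with eta by (field; lra). lra. }
  assert (Hlim := tip_limit M delta lam eta t g HM Hd Hep HL Heta HTip).
  destruct HTip as (Ht & Hg & H0 & _).
  intros s Hs. split; [apply Hlow; exact Hs|].
  set (F := fun r => ((g r - RtoC (lam t)) * (g r - RtoC (lam t)) + RtoC (4 * (t - r)))%C).
  set (A := 4 * M / c0).
  assert (HA : 0 < A) by (unfold A, Rdiv in *; lra).
  assert (HF : Cmod (F s) <= A * Rpower (t - s) (1 + delta)).
  { apply le_epsilon. intros e He.
    (* F tends to 0 at t, since W does and lam is continuous. *)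
    assert (Hst : exists s', s <= s' < t /\ Cmod (F s') <= e).
    { (* With |Y| <= k and t - s' <= k^2 the modulus of F is at most 5 k. *)
      set (k := Rmin 1 (e / 8)).
      assert (Hk : 0 < k) by (apply Rmin_pos; lra).
      assert (Hk1 : k <= 1) by apply Rmin_l.
      assert (Hk2 : k <= e / 8) by apply Rmin_r.
      destruct (Hlim (k / 2) ltac:(lra)) as (s1 & Hs1 & B1).
      set (s2 := Rmax (Rmax s s1) (Rmax (t - eta) (t - k * k))).
      pose proof (Rmax_l (Rmax s s1) (Rmax (t - eta) (t - k * k))) as R1.
      pose proof (Rmax_r (Rmax s s1) (Rmax (t - eta) (t - k * k))) as R2.
      pose proof (Rmax_l s s1). pose proof (Rmax_r s s1).
      pose proof (Rmax_l (t - eta) (t - k * k)). pose proof (Rmax_r (t - eta) (t - k * k)).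
      fold s2 in R1, R2.
      assert (Hkk : 0 < k * k) by (apply Rmult_lt_0_compat; lra).
      assert (Hs2 : s2 < t) by (unfold s2; repeat apply Rmax_lub_lt; lra).
      exists s2. split; [lra|].
      assert (B2 := B1 s2 ltac:(lra)).
      assert (B3 : Rabs (lam s2 - lam t) <= k / 2).
      { assert (Hab : Rabs (s2 - t) = t - s2) by (rewrite Rabs_left; lra).
        assert (Q := holder_small M delta lam eta HL Heta s2 t). rewrite Hab in Q.
        specialize (Q ltac:(lra)).
        assert (sqrt (t - s2) <= k); [|lra].
        rewrite -(sqrt_square k); [|lra]. apply sqrt_le_1_alt. lra. }
      assert (B4 : Cmod (g s2 - RtoC (lam t))%C <= k).
      { replace (g s2 - RtoC (lam t))%C with ((g s2 - RtoC (lam s2)) + RtoC (lam s2 - lam t))%C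
          by (rewrite RtoC_minus; ring).
        eapply Rle_trans; [apply Cmod_triangle|]. rewrite Cmod_R. lra. }
      unfold F. eapply Rle_trans; [apply Cmod_triangle|].
      rewrite Cmod_mult Cmod_R Rabs_pos_eq; [|lra].
      pose proof (Cmod_ge_0 (g s2 - RtoC (lam t))%C). nra. }
    destruct Hst as (s' & Hs' & Bs').
    assert (Q := complex_mean_value F
      (fun r => (RtoC (4 * (lam r - lam t)) / (g r - RtoC (lam r)))%C)
      (fun r => - (A / (1 + delta)) * Rpower (t - r) (1 + delta)) (fun r => A * Rpower (t - r) delta) s s' ltac:(lra)).
    assert (Q' : Cmod (F s' - F s)%C <= - (A / (1 + delta)) * Rpower (t - s') (1 + delta)
       - - (A / (1 + delta)) * Rpower (t - s) (1 + delta)).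
    { apply Q.
      - intros r Hr. destruct (Hg s' ltac:(lra) r ltac:(lra)) as [N D].
        assert (N' : (g r - RtoC (lam r))%C <> RtoC 0).
        { intros E. apply N. replace (g r) with ((g r - RtoC (lam r)) + RtoC (lam r))%C by ring.
          rewrite E; ring. }
        assert (DY : cder (fun r => (g r - RtoC (lam t))%C) r (RtoC 2 / (g r - RtoC (lam r)))%C).
        { eapply cder_eq; [apply cder_minus; [exact D | apply cder_const]|]. ring. }
        assert (DF := cder_mult _ _ _ _ _ DY DY).
        assert (DL : cder (fun r => RtoC (- (4 * (t - r)))) r (RtoC 4)).
        { apply cder_RtoC. auto_derive; auto. ring. }
        eapply cder_eq.
        + apply: cder_ext_loc; [|exact (cder_minus _ _ _ _ _ DF DL)].
          apply filter_forall. intros x. unfold F. rewrite RtoC_opp. ring.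
        + rewrite RtoC_mult RtoC_minus. field. exact N'.
      - intros r Hr. evar_last; [apply: is_derive_scal; apply is_derive_Rpower_gap; lra|].
        unfold scal; simpl; unfold mult; simpl.
        replace (1 + delta - 1) with delta by ring. field. lra.
      - intros r Hr. assert (Hne : r <> t) by lra. assert (B := HL r t Hne).
        assert (Hab : Rabs (r - t) = t - r) by (rewrite Rabs_left; lra). rewrite Hab in B.
        assert (Hsq : 0 < sqrt (t - r)) by (apply sqrt_lt_R0; lra).
        assert (Lw := Hlow r ltac:(lra)). assert (Lc := flow_Im_le_Cmod lam g r).
        assert (Hpos : 0 < c0 * sqrt (t - r)) by (apply Rmult_lt_0_compat; lra).
        rewrite Cmod_div; [|apply Cmod_gt_0; lra].
        rewrite Cmod_R Rabs_mult (Rabs_pos_eq 4); [|lra].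
        apply Rle_div_l; [lra|].
        assert (0 < Rpower (t - r) delta) by apply Rpower_pos.
        apply Rle_trans with (A * Rpower (t - r) delta * (c0 * sqrt (t - r))).
        + replace (A * Rpower (t - r) delta * (c0 * sqrt (t - r)))
            with (4 * (M * (sqrt (t - r) * Rpower (t - r) delta))) by (unfold A; field; lra).
          lra.
        + apply Rmult_le_compat_l; [|lra]. apply Rmult_le_pos; lra. }
    assert (0 < Rpower (t - s') (1 + delta)) by apply Rpower_pos.
    assert (0 < Rpower (t - s) (1 + delta)) by apply Rpower_pos.
    assert (HA1 : 0 < A / (1 + delta)) by (apply Rdiv_lt_0_compat; lra).
    assert (HA2 : A / (1 + delta) <= A) by (apply Rle_div_l; nra).
    replace (F s) with (F s' + - (F s' - F s))%C by ring.
    eapply Rle_trans; [apply Cmod_triangle|]. rewrite Cmod_opp. nra. }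
  assert (Hsq : 0 < sqrt (t - s)) by (apply sqrt_lt_R0; lra).
  assert (Hsqq : sqrt (t - s) * sqrt (t - s) = t - s) by (apply sqrt_sqrt; lra).
  assert (HY : Cmod (g s - RtoC (lam t) - RtoC (2 * sqrt (t - s)) * Ci)%C
     <= A / 2 * (sqrt (t - s) * Rpower (t - s) delta)).
  { (* The second factor has imaginary part at least 2 sqrt (t - s). *)
    assert (E : F s = ((g s - RtoC (lam t) - RtoC (2 * sqrt (t - s)) * Ci) *
       (g s - RtoC (lam t) + RtoC (2 * sqrt (t - s)) * Ci))%C).
    { unfold F. rewrite -{1}Hsqq. apply injective_projections; simpl; ring. }
    rewrite E Cmod_mult in HF.
    assert (L : 2 * sqrt (t - s) <= Cmod (g s - RtoC (lam t) + RtoC (2 * sqrt (t - s)) * Ci)%C).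
    { eapply Rle_trans; [|apply im_le_Cmod]. eapply Rle_trans; [|apply Rle_abs].
      simpl. assert (Lw := Hlow s Hs). nra. }
    assert (E2 : Rpower (t - s) (1 + delta) = sqrt (t - s) * sqrt (t - s) * Rpower (t - s) delta).
    { rewrite Rpower_plus Rpower_1; [|lra]. rewrite Hsqq. reflexivity. }
    rewrite E2 in HF.
    clear E E2.
    set (u := Cmod (g s - RtoC (lam t) - RtoC (2 * sqrt (t - s)) * Ci)%C) in *.
    assert (0 <= u) by apply Cmod_ge_0.
    apply Rmult_le_reg_r with (2 * sqrt (t - s)); [lra|].
    apply Rle_trans with (A * (sqrt (t - s) * sqrt (t - s) * Rpower (t - s) delta)).
    - eapply Rle_trans; [|exact HF]. apply Rmult_le_compat_l; lra.
    - right. field. }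
  replace (g s - RtoC (lam s) - RtoC (2 * sqrt (t - s)) * Ci)%C with
   ((g s - RtoC (lam t) - RtoC (2 * sqrt (t - s)) * Ci) + RtoC (lam t - lam s))%C
   by (rewrite RtoC_minus; ring).
  eapply Rle_trans; [apply Cmod_triangle|]. rewrite Cmod_R.
  assert (Hne : t <> s) by lra. assert (B := HL t s Hne).
  rewrite (Rabs_pos_eq (t - s)) in B; [|lra].
  replace (2 * M / c0 + M) with (A / 2 + M) by (unfold A; field; lra). lra.
Qed.

(** * Singular end points, and two algebraic estimates *)

(** Left continuity restricted to nonnegative times, where flows are controlled. *)
Definition left_cont (f : R -> C) (t : R) : Prop :=
  forall e, 0 < e -> exists d, 0 < d /\ forall r, t - d < r < t -> 0 <= r -> Cmod (f r - f t)%C <= e.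

Lemma left_cont_const c t : left_cont (fun _ => c) t.
Proof.
  intros e He. exists 1; split; [lra|]. intros r _ _.
  replace (c - c)%C with (RtoC 0) by ring. rewrite Cmod_0; lra.
Qed.

Lemma left_cont_plus f g t : left_cont f t -> left_cont g t ->
  left_cont (fun r => (f r + g r)%C) t.
Proof.
  intros F G e He. destruct (F (e / 2) ltac:(lra)) as (d1 & D1 & B1).
  destruct (G (e / 2) ltac:(lra)) as (d2 & D2 & B2).
  exists (Rmin d1 d2); split; [apply Rmin_pos; lra|]. intros r Hr Hr0.
  pose proof (Rmin_l d1 d2). pose proof (Rmin_r d1 d2).
  specialize (B1 r ltac:(lra) Hr0). specialize (B2 r ltac:(lra) Hr0).
  replace (_ - _)%C with ((f r - f t) + (g r - g t))%C by ring.
  eapply Rle_trans; [apply Cmod_triangle|]. lra.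
Qed.

Lemma left_cont_mult f g t : left_cont f t -> left_cont g t ->
  left_cont (fun r => (f r * g r)%C) t.
Proof.
  intros F G e He.
  set (k := Cmod (f t) + Cmod (g t) + 1).
  pose proof (Cmod_ge_0 (f t)) as Ff. pose proof (Cmod_ge_0 (g t)) as Fg.
  assert (Hk : 0 < k) by (unfold k; lra).
  set (e1 := Rmin 1 (e / k)).
  assert (He1 : 0 < e1) by (apply Rmin_pos; [lra | apply Rdiv_lt_0_compat; lra]).
  assert (He11 : e1 <= 1) by apply Rmin_l.
  assert (He1k : e1 * k <= e).
  { apply Rle_trans with (e / k * k); [apply Rmult_le_compat_r; [lra|apply Rmin_r] | right; field; lra]. }
  destruct (F e1 He1) as (d1 & D1 & B1). destruct (G e1 He1) as (d2 & D2 & B2).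
  exists (Rmin d1 d2); split; [apply Rmin_pos; lra|]. intros r Hr Hr0.
  pose proof (Rmin_l d1 d2). pose proof (Rmin_r d1 d2).
  specialize (B1 r ltac:(lra) Hr0). specialize (B2 r ltac:(lra) Hr0).
  replace (_ - _)%C with ((f r - f t) * (g r - g t) + ((f r - f t) * g t + f t * (g r - g t)))%C by ring.
  eapply Rle_trans; [apply Cmod_triangle|].
  eapply Rle_trans; [apply Rplus_le_compat_l, Cmod_triangle|].
  rewrite !Cmod_mult.
  pose proof (Cmod_ge_0 (f r - f t)%C). pose proof (Cmod_ge_0 (g r - g t)%C).
  unfold k in He1k. nra.
Qed.

Lemma cder_left_cont f t l : cder f t l -> left_cont f t.
Proof.
  intros H e He. apply cder_iff in H. destruct (H 1 ltac:(lra)) as (d & Hd & B).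
  pose proof (Cmod_ge_0 l).
  set (k := 1 + Cmod l). assert (Hk : 0 < k) by (unfold k; lra).
  exists (Rmin d (e / k)). split; [apply Rmin_pos; auto; apply Rdiv_lt_0_compat; lra|].
  intros r Hr _. pose proof (Rmin_l d (e / k)). pose proof (Rmin_r d (e / k)).
  assert (Hab : Rabs (r - t) = t - r) by (rewrite Rabs_left; lra).
  specialize (B r I). rewrite Hab in B. specialize (B ltac:(lra)).
  replace (f r - f t)%C with ((f r - f t - RtoC (r - t) * l) + RtoC (r - t) * l)%C by ring.
  eapply Rle_trans; [apply Cmod_triangle|]. rewrite Cmod_mult Cmod_R Hab.
  assert (k * (t - r) <= e).
  { apply Rle_trans with (k * (e / k)); [apply Rmult_le_compat_l; lra | right; field; lra]. }
  unfold k in *. lra.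
Qed.

Lemma left_cont_sqrt_gap t : left_cont (fun r => RtoC (sqrt (t - r))) t.
Proof.
  intros e He. exists (e * e). split; [nra|]. intros r Hr _.
  replace (t - t) with 0 by ring. rewrite sqrt_0 -RtoC_minus Cmod_R Rminus_0_r.
  rewrite Rabs_pos_eq; [|apply sqrt_pos].
  rewrite -(sqrt_square e); [|lra]. apply sqrt_le_1_alt. lra.
Qed.

(** The two bounds for a linear equation up to an end point where the
coefficient is singular but has a bounded potential K. *)
Lemma linear_ode_limit (Z a : R -> C) (K k : R -> R) p q kap :
  0 <= p < q -> left_cont Z q ->
  (forall x, p <= x < q -> cder Z x (a x * Z x)%C) ->
  (forall x, p <= x < q -> is_derive K x (k x)) ->
  (forall x, p <= x < q -> Cmod (a x) <= k x) ->
  (forall x, p <= x < q -> K x - K p <= kap) ->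
  Cmod (Z q - Z p)%C <= Cmod (Z q) * (exp kap - 1) /\
  Cmod (Z q) <= Cmod (Z p) * exp kap.
Proof.
  intros Hpq HL HZ HK Hk Hkap.
  assert (Hkap0 : 0 <= kap) by (specialize (Hkap p ltac:(lra)); lra).
  assert (Hexp : 1 <= exp kap) by (rewrite -exp_0; destruct Hkap0 as [h|<-]; [left; apply exp_increasing; lra | lra]).
  assert (Happ : forall e, 0 < e -> exists r, p <= r < q /\ Cmod (Z r - Z q)%C <= e).
  { intros e He. destruct (HL e He) as (d & Hd & B).
    exists (Rmax p (q - d / 2)).
    pose proof (Rmax_l p (q - d / 2)). pose proof (Rmax_r p (q - d / 2)).
    assert (Rmax p (q - d / 2) < q) by (apply Rmax_lub_lt; lra).
    split; [lra|]. apply B; lra. }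
  assert (Hr : forall r, p <= r < q ->
    Cmod (Z r - Z p)%C <= Cmod (Z r) * (exp kap - 1) /\ Cmod (Z r) <= Cmod (Z p) * exp kap).
  { intros r Hr. assert (Hle : exp (K r - K p) <= exp kap).
    { specialize (Hkap r Hr). destruct Hkap as [h|h]; [left; apply exp_increasing; exact h | rewrite h; lra]. }
    pose proof (Cmod_ge_0 (Z r)). pose proof (Cmod_ge_0 (Z p)).
    destruct (linear_ode_bound Z a K k p r ltac:(lra)) as [_ B];
      [intros x Hx; apply HZ; lra | intros x Hx; apply HK; lra | intros x Hx; apply Hk; lra |].
    assert (B' := linear_ode_variation Z a K k p r ltac:(lra)).
    split.
    - eapply Rle_trans; [apply B'; intros x Hx; [apply HZ | apply HK | apply Hk]; lra|].
      apply Rmult_le_compat_l; lra.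
    - eapply Rle_trans; [exact B|]. apply Rmult_le_compat_l; lra. }
  split; apply le_epsilon; intros e He.
  - destruct (Happ (e / exp kap)) as (r & Hrr & Br); [apply Rdiv_lt_0_compat; lra|].
    destruct (Hr r Hrr) as [B _].
    replace (Z q - Z p)%C with (- (Z r - Z q) + (Z r - Z p))%C by ring.
    eapply Rle_trans; [apply Cmod_triangle|]. rewrite Cmod_opp.
    assert (B2 : Cmod (Z r) <= Cmod (Z q) + e / exp kap).
    { replace (Z r) with (Z q + (Z r - Z q))%C by ring.
      eapply Rle_trans; [apply Cmod_triangle|]. lra. }
    assert (B3 : (Cmod (Z q) + e / exp kap) * (exp kap - 1) + e / exp kap = Cmod (Z q) * (exp kap - 1) + e)
      by (field; lra).
    assert (Cmod (Z r) * (exp kap - 1) <= (Cmod (Z q) + e / exp kap) * (exp kap - 1))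
      by (apply Rmult_le_compat_r; lra).
    lra.
  - destruct (Happ e He) as (r & Hrr & Br). destruct (Hr r Hrr) as [_ B].
    replace (Z q) with (- (Z r - Z q) + Z r)%C by ring.
    eapply Rle_trans; [apply Cmod_triangle|]. rewrite Cmod_opp. lra.
Qed.

(** The two terms cancel when Wj = 2i uj.  Over a common denominator the numerator
is v1 W2 + 2i u1 v2, where vj = Wj - 2i uj is the error. *)
Lemma pair_coefficient_bound c0 C1 B e u1 u2 W1 W2 :
  0 < c0 -> 0 <= C1 -> 0 <= e -> 2 + C1 * e <= B -> 0 < u1 -> 0 < u2 ->
  c0 * u1 <= Cmod W1 -> c0 * u2 <= Cmod W2 ->
  Cmod (W1 - RtoC (2 * u1) * Ci)%C <= C1 * (u1 * e) ->
  Cmod (W2 - RtoC (2 * u2) * Ci)%C <= C1 * (u2 * e) ->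
  Cmod (- RtoC 2 / (W1 * W2) - RtoC (/ (2 * (u1 * u2))))%C
    <= C1 * (B + 2) / (2 * c0 ^ 2) * (e / (u1 * u2)).
Proof.
  intros Hc HC He HB Hu1 Hu2 L1 L2 V1 V2.
  assert (P1 : 0 < c0 * u1) by (apply Rmult_lt_0_compat; lra).
  assert (P2 : 0 < c0 * u2) by (apply Rmult_lt_0_compat; lra).
  assert (N1 : W1 <> RtoC 0) by (apply Cmod_gt_0; lra).
  assert (N2 : W2 <> RtoC 0) by (apply Cmod_gt_0; lra).
  assert (U2 : Cmod W2 <= B * u2).
  { replace W2 with ((W2 - RtoC (2 * u2) * Ci) + RtoC (2 * u2) * Ci)%C by ring.
    eapply Rle_trans; [apply Cmod_triangle|]. rewrite (Cmod_mult _ Ci) Cmod_Ci Cmod_R Rabs_pos_eq; [|lra].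
    nra. }
  set (v1 := (W1 - RtoC (2 * u1) * Ci)%C) in *. set (v2 := (W2 - RtoC (2 * u2) * Ci)%C) in *.
  assert (Hu : 0 < u1 * u2) by (apply Rmult_lt_0_compat; lra).
  replace (- RtoC 2 / (W1 * W2) - RtoC (/ (2 * (u1 * u2))))%C with
    (- ((v1 * W2 + RtoC (2 * u1) * Ci * v2) / (RtoC (2 * (u1 * u2)) * (W1 * W2))))%C.
  2: { rewrite RtoC_inv; [|lra]. unfold v1, v2. rewrite !RtoC_mult.
       assert (RtoC u1 <> RtoC 0) by (intros E; apply RtoC_inj in E; lra).
       assert (RtoC u2 <> RtoC 0) by (intros E; apply RtoC_inj in E; lra).
       assert (RtoC 2 <> RtoC 0) by (intros E; apply RtoC_inj in E; lra).
       assert (HCi : (Ci * Ci)%C = (- RtoC 1)%C) by (apply injective_projections; simpl; ring).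
       replace ((W1 - RtoC 2 * RtoC u1 * Ci) * W2 + RtoC 2 * RtoC u1 * Ci * (W2 - RtoC 2 * RtoC u2 * Ci))%C
         with (W1 * W2 - RtoC 2 * RtoC 2 * RtoC u1 * RtoC u2 * (Ci * Ci))%C by ring.
       rewrite HCi. field. auto. }
  rewrite Cmod_opp Cmod_div.
  2: { apply Cmult_neq_0; [intros E; apply RtoC_inj in E; lra | apply Cmult_neq_0; auto]. }
  rewrite !Cmod_mult Cmod_R Rabs_pos_eq; [|lra].
  assert (Hnum : Cmod (v1 * W2 + RtoC (2 * u1) * Ci * v2)%C <= C1 * (B + 2) * e * (u1 * u2)).
  { eapply Rle_trans; [apply Cmod_triangle|].
    rewrite !Cmod_mult Cmod_Ci Cmod_R Rabs_pos_eq; [|lra].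
    assert (Cmod v1 * Cmod W2 <= C1 * (u1 * e) * (B * u2))
      by (apply Rmult_le_compat; auto; apply Cmod_ge_0).
    assert (2 * u1 * 1 * Cmod v2 <= 2 * u1 * (C1 * (u2 * e))) by nra.
    lra. }
  assert (Hden : c0 * u1 * (c0 * u2) <= Cmod W1 * Cmod W2) by (apply Rmult_le_compat; lra).
  assert (0 < c0 * u1 * (c0 * u2)) by (apply Rmult_lt_0_compat; lra).
  apply Rle_trans with (C1 * (B + 2) * e * (u1 * u2) / (2 * (u1 * u2) * (c0 * u1 * (c0 * u2)))).
  - unfold Rdiv. apply Rmult_le_compat.
    + apply Cmod_ge_0.
    + left; apply Rinv_0_lt_compat. repeat apply Rmult_lt_0_compat; try lra; apply Cmod_gt_0; auto.
    + exact Hnum.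
    + apply Rinv_le_contravar; [apply Rmult_lt_0_compat; lra | apply Rmult_le_compat_l; lra].
  - right. field. repeat split; lra.
Qed.

(** The same cancellation for W1 W2 W3 = (2i)^3 u1 u2 u3 = -8i u1 u2 u3 and Z = i. *)
Lemma triple_coefficient_bound c0 C1 C2 B e u1 u2 u3 W1 W2 W3 Z :
  0 < c0 -> 0 <= C1 -> 0 <= e -> 2 + C1 * e <= B -> 0 < u1 -> 0 < u2 -> 0 < u3 ->
  c0 * u1 <= Cmod W1 -> c0 * u2 <= Cmod W2 -> c0 * u3 <= Cmod W3 ->
  Cmod (W1 - RtoC (2 * u1) * Ci)%C <= C1 * (u1 * e) ->
  Cmod (W2 - RtoC (2 * u2) * Ci)%C <= C1 * (u2 * e) ->
  Cmod (W3 - RtoC (2 * u3) * Ci)%C <= C1 * (u3 * e) ->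
  Cmod (Z - Ci)%C <= C2 * e ->
  Cmod (RtoC 4 * Z / (W1 * W2 * W3) + RtoC (/ (2 * (u1 * u2 * u3))))%C
    <= (8 * C2 + C1 * (B ^ 2 + 2 * B + 4)) / (2 * c0 ^ 3) * (e / (u1 * u2 * u3)).
Proof.
  intros Hc HC He HB Hu1 Hu2 Hu3 L1 L2 L3 V1 V2 V3 HZ.
  assert (P1 : 0 < c0 * u1) by (apply Rmult_lt_0_compat; lra).
  assert (P2 : 0 < c0 * u2) by (apply Rmult_lt_0_compat; lra).
  assert (P3 : 0 < c0 * u3) by (apply Rmult_lt_0_compat; lra).
  assert (N1 : W1 <> RtoC 0) by (apply Cmod_gt_0; lra).
  assert (N2 : W2 <> RtoC 0) by (apply Cmod_gt_0; lra).
  assert (N3 : W3 <> RtoC 0) by (apply Cmod_gt_0; lra).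
  assert (HCe : 0 <= C1 * e) by (apply Rmult_le_pos; lra).
  assert (U : forall u W, 0 < u -> Cmod (W - RtoC (2 * u) * Ci)%C <= C1 * (u * e) -> Cmod W <= B * u).
  { intros u W Hu HW. replace W with ((W - RtoC (2 * u) * Ci) + RtoC (2 * u) * Ci)%C by ring.
    eapply Rle_trans; [apply Cmod_triangle|]. rewrite (Cmod_mult _ Ci) Cmod_Ci Cmod_R Rabs_pos_eq; [|lra].
    nra. }
  assert (U2 := U u2 W2 Hu2 V2). assert (U3 := U u3 W3 Hu3 V3). clear U.
  set (v1 := (W1 - RtoC (2 * u1) * Ci)%C) in *. set (v2 := (W2 - RtoC (2 * u2) * Ci)%C) in *.
  set (v3 := (W3 - RtoC (2 * u3) * Ci)%C) in *.
  assert (Hu : 0 < u1 * u2 * u3) by (repeat apply Rmult_lt_0_compat; lra).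
  assert (NN : (W1 * W2 * W3)%C <> RtoC 0) by (repeat apply Cmult_neq_0; auto).
  replace (RtoC 4 * Z / (W1 * W2 * W3) + RtoC (/ (2 * (u1 * u2 * u3))))%C with
    ((RtoC (8 * (u1 * u2 * u3)) * (Z - Ci) +
      (v1 * (W2 * W3) + (RtoC (2 * u1) * Ci * v2 * W3 + RtoC (2 * u1) * Ci * (RtoC (2 * u2) * Ci) * v3))) /
      (RtoC (2 * (u1 * u2 * u3)) * (W1 * W2 * W3)))%C.
  2: { rewrite RtoC_inv; [|lra]. unfold v1, v2, v3.
       replace (8 * (u1 * u2 * u3)) with (2 * 2 * 2 * (u1 * u2 * u3)) by ring.
       replace (RtoC 4) with (RtoC 2 * RtoC 2)%C by (rewrite -RtoC_mult; f_equal; ring).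
       rewrite !RtoC_mult.
       assert (RtoC u1 <> RtoC 0) by (intros E; apply RtoC_inj in E; lra).
       assert (RtoC u2 <> RtoC 0) by (intros E; apply RtoC_inj in E; lra).
       assert (RtoC u3 <> RtoC 0) by (intros E; apply RtoC_inj in E; lra).
       assert (RtoC 2 <> RtoC 0) by (intros E; apply RtoC_inj in E; lra).
       assert (HCi : (Ci * Ci)%C = (- RtoC 1)%C) by (apply injective_projections; simpl; ring).
       match goal with |- (?num / _)%C = _ =>
         replace num with (RtoC 2 * RtoC 2 * RtoC 2 * (RtoC u1 * RtoC u2 * RtoC u3) * Z
           + (W1 * W2 * W3) - RtoC 2 * RtoC 2 * RtoC 2 * (RtoC u1 * RtoC u2 * RtoC u3) * Ci * (RtoC 1 + Ci * Ci))%C by ring end.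
       rewrite HCi. field. repeat split; auto. }
  rewrite Cmod_div.
  2: { apply Cmult_neq_0; [intros E; apply RtoC_inj in E; lra | exact NN]. }
  assert (Hnum : Cmod (RtoC (8 * (u1 * u2 * u3)) * (Z - Ci) +
      (v1 * (W2 * W3) + (RtoC (2 * u1) * Ci * v2 * W3 + RtoC (2 * u1) * Ci * (RtoC (2 * u2) * Ci) * v3)))%C
      <= (8 * C2 + C1 * (B ^ 2 + 2 * B + 4)) * e * (u1 * u2 * u3)).
  { eapply Rle_trans; [apply Cmod_triangle|].
    eapply Rle_trans; [apply Rplus_le_compat_l, Cmod_triangle|].
    eapply Rle_trans; [apply Rplus_le_compat_l, Rplus_le_compat_l, Cmod_triangle|].
    rewrite !Cmod_mult Cmod_Ci !Cmod_R !Rabs_pos_eq; [|lra|lra|lra].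
    assert (A1 : Cmod v1 * (Cmod W2 * Cmod W3) <= C1 * (u1 * e) * (B * u2 * (B * u3))).
    { apply Rmult_le_compat; auto; [apply Cmod_ge_0 | apply Rmult_le_pos; apply Cmod_ge_0|].
      apply Rmult_le_compat; auto; apply Cmod_ge_0. }
    assert (A2 : Cmod v2 * Cmod W3 <= C1 * (u2 * e) * (B * u3))
      by (apply Rmult_le_compat; auto; apply Cmod_ge_0).
    assert (A2' : 2 * u1 * 1 * Cmod v2 * Cmod W3 <= 2 * u1 * (C1 * (u2 * e) * (B * u3))).
    { replace (2 * u1 * 1 * Cmod v2 * Cmod W3) with (2 * u1 * (Cmod v2 * Cmod W3)) by ring.
      apply Rmult_le_compat_l; lra. }
    assert (A3 : 2 * u1 * 1 * (2 * u2 * 1) * Cmod v3 <= 2 * u1 * 1 * (2 * u2 * 1) * (C1 * (u3 * e))).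
    { apply Rmult_le_compat_l; auto. apply Rmult_le_pos; lra. }
    assert (A4 : 8 * (u1 * u2 * u3) * Cmod (Z - Ci)%C <= 8 * (u1 * u2 * u3) * (C2 * e))
      by (apply Rmult_le_compat_l; lra).
    replace ((8 * C2 + C1 * (B ^ 2 + 2 * B + 4)) * e * (u1 * u2 * u3)) with
      (8 * (u1 * u2 * u3) * (C2 * e) + (C1 * (u1 * e) * (B * u2 * (B * u3)) +
       (2 * u1 * (C1 * (u2 * e) * (B * u3)) + 2 * u1 * 1 * (2 * u2 * 1) * (C1 * (u3 * e))))) by ring.
    lra. }
  assert (Hden : c0 * u1 * (c0 * u2) * (c0 * u3) <= Cmod (W1 * W2 * W3)%C).
  { rewrite !Cmod_mult. repeat apply Rmult_le_compat; try lra. apply Rmult_le_pos; lra. }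
  assert (0 < c0 * u1 * (c0 * u2) * (c0 * u3)) by (repeat apply Rmult_lt_0_compat; lra).
  rewrite (Cmod_mult (RtoC (2 * (u1 * u2 * u3)))) Cmod_R Rabs_pos_eq; [|lra].
  apply Rle_trans with ((8 * C2 + C1 * (B ^ 2 + 2 * B + 4)) * e * (u1 * u2 * u3) /
     (2 * (u1 * u2 * u3) * (c0 * u1 * (c0 * u2) * (c0 * u3)))).
  - unfold Rdiv. apply Rmult_le_compat.
    + apply Cmod_ge_0.
    + left; apply Rinv_0_lt_compat. apply Rmult_lt_0_compat; lra.
    + exact Hnum.
    + apply Rinv_le_contravar; [apply Rmult_lt_0_compat; lra | apply Rmult_le_compat_l; lra].
  - right. field. repeat split; lra.
Qed.

(** * Two and three tips: difference quotients of the slit *)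

(** What the comparison of several tips uses about one tip.  The curve is given
the value lam t at its end, so that quotients make sense up to the end of the
shorter curve, even when t = 0. *)
Definition tip_curve (lam : R -> R) (delta c0 C1 t : R) (g : R -> C) : Prop :=
  g t = RtoC (lam t) /\
  (forall s, s < t -> flow_on lam s g) /\
  forall s, 0 <= s < t ->
    c0 * sqrt (t - s) <= Cmod (g s - RtoC (lam s))%C /\
    Cmod (g s - RtoC (lam s) - RtoC (2 * sqrt (t - s)) * Ci)%C
      <= C1 * (sqrt (t - s) * Rpower (t - s) delta).

(** The difference of two solutions divided by 2 (sqrt(t2-s) - sqrt(t1-s)),
written with the conjugate square roots; for constant driving it is i. *)
Definition slope (t1 t2 : R) (g1 g2 : R -> C) (s : R) : C :=
  ((g2 s - g1 s) * RtoC ((sqrt (t1 - s) + sqrt (t2 - s)) / (2 * (t2 - t1))))%C.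

(** The logarithmic derivative of [slope]. *)
Definition slope_coef (lam : R -> R) (t1 t2 : R) (g1 g2 : R -> C) (s : R) : C :=
  (- RtoC 2 / ((g1 s - RtoC (lam s)) * (g2 s - RtoC (lam s)))
   - RtoC (/ (2 * (sqrt (t1 - s) * sqrt (t2 - s)))))%C.

Lemma Rpower_decr a b c : 0 < a <= b -> c <= 0 -> Rpower b c <= Rpower a c.
Proof.
  intros Hab Hc. replace c with (- (- c)) by ring. rewrite !(Rpower_Ropp _ (- c)).
  apply Rinv_le_contravar; [apply Rpower_pos | apply Rle_Rpower_l; lra].
Qed.

Lemma Rpower_div_sqrt x d : 0 < x -> Rpower x d / sqrt x = Rpower x (d - 1 / 2).
Proof.
  intros Hx. rewrite -Rpower_sqrt //. unfold Rdiv. rewrite -Rpower_Ropp -Rpower_plus.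
  f_equal. lra.
Qed.

Lemma Rpower_div x d : 0 < x -> Rpower x d / x = Rpower x (d - 1).
Proof.
  intros Hx. rewrite -{2}(Rpower_1 x) //. unfold Rdiv. rewrite -Rpower_Ropp -Rpower_plus.
  f_equal.
Qed.

(** This is where delta <= 1/2 enters: the exponent delta - 1/2 of b is
nonpositive. *)
Lemma Rpower_gap_bound a b d : d <= 1 / 2 -> 0 < a <= b ->
  Rpower b d / (sqrt a * sqrt b) <= Rpower a (d - 1).
Proof.
  intros Hd Hab.
  assert (Ha : 0 < sqrt a) by (apply sqrt_lt_R0; lra).
  assert (Hb : 0 < sqrt b) by (apply sqrt_lt_R0; lra).
  replace (Rpower b d / (sqrt a * sqrt b)) with (Rpower b d / sqrt b / sqrt a) by (field; lra).
  rewrite Rpower_div_sqrt; [|lra].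
  replace (d - 1) with (d - 1 / 2 - 1 / 2) by lra. rewrite -(Rpower_div_sqrt a); [|lra].
  apply Rmult_le_compat_r; [left; apply Rinv_0_lt_compat; exact Ha|].
  apply Rpower_decr; lra.
Qed.

(** The derivative of sqrt(t1-s) + sqrt(t2-s) is that function times
-1/(2 sqrt(t1-s) sqrt(t2-s)). *)
Lemma slope_cder lam delta c0 C1 t1 t2 g1 g2 s : 0 < c0 ->
  tip_curve lam delta c0 C1 t1 g1 -> tip_curve lam delta c0 C1 t2 g2 ->
  t1 < t2 -> 0 <= s < t1 ->
  cder (slope t1 t2 g1 g2) s (slope_coef lam t1 t2 g1 g2 s * slope t1 t2 g1 g2 s)%C.
Proof.
  intros Hc (_ & F1 & B1) (_ & F2 & B2) H12 Hs.
  destruct (B1 s ltac:(lra)) as [L1 _]. destruct (B2 s ltac:(lra)) as [L2 _].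
  assert (U1 : 0 < sqrt (t1 - s)) by (apply sqrt_lt_R0; lra).
  assert (U2 : 0 < sqrt (t2 - s)) by (apply sqrt_lt_R0; lra).
  assert (N1 : (g1 s - RtoC (lam s))%C <> RtoC 0) by (apply Cmod_gt_0; nra).
  assert (N2 : (g2 s - RtoC (lam s))%C <> RtoC 0) by (apply Cmod_gt_0; nra).
  assert (DG := flow_difference lam s g2 g1 s (F2 s ltac:(lra)) (F1 s ltac:(lra)) ltac:(lra)).
  assert (DR : is_derive (fun s => (sqrt (t1 - s) + sqrt (t2 - s)) / (2 * (t2 - t1))) s
    (- (/ (2 * (sqrt (t1 - s) * sqrt (t2 - s)))) * ((sqrt (t1 - s) + sqrt (t2 - s)) / (2 * (t2 - t1))))).
  { auto_derive; [repeat split; lra|]. unfold Rminus in *. field. lra. }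
  eapply cder_eq; [exact (cder_mult _ _ _ _ _ DG (cder_RtoC _ _ _ DR))|].
  unfold slope_coef, slope. rewrite (RtoC_mult (- _)) RtoC_opp. field. split; assumption.
Qed.

Lemma tip_curve_left_cont M lam delta c0 C1 t g : 0 < M -> 0 < delta -> 0 <= C1 ->
  holder_line M delta lam -> tip_curve lam delta c0 C1 t g -> left_cont g t.
Proof.
  intros HM Hd HC HL (E & F & B) e He.
  set (K := 2 + (C1 + M) * Rpower 1 delta).
  assert (HP : 0 < Rpower 1 delta) by apply Rpower_pos.
  assert (HK : 0 < K) by (unfold K; nra).
  assert (He' : 0 < e / K) by (apply Rdiv_lt_0_compat; lra).
  exists (Rmin 1 ((e / K) * (e / K))). split; [apply Rmin_pos; [lra|nra]|].
  intros r Hr Hr0. pose proof (Rmin_l 1 ((e / K) * (e / K))). pose proof (Rmin_r 1 ((e / K) * (e / K))).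
  destruct (B r ltac:(lra)) as [_ B2].
  assert (Hne : r <> t) by lra. assert (HL' := HL r t Hne).
  assert (Hab : Rabs (r - t) = t - r) by (rewrite Rabs_left; lra). rewrite Hab in HL'.
  assert (Hp : Rpower (t - r) delta <= Rpower 1 delta) by (apply Rle_Rpower_l; lra).
  assert (Hsq : sqrt (t - r) <= e / K).
  { rewrite -(sqrt_square (e / K)); [|lra]. apply sqrt_le_1_alt; lra. }
  pose proof (sqrt_pos (t - r)) as Hs0.
  assert (Hsp : sqrt (t - r) * Rpower (t - r) delta <= sqrt (t - r) * Rpower 1 delta)
    by (apply Rmult_le_compat_l; lra).
  rewrite E.
  replace (g r - RtoC (lam t))%C with ((g r - RtoC (lam r) - RtoC (2 * sqrt (t - r)) * Ci)
     + (RtoC (2 * sqrt (t - r)) * Ci + RtoC (lam r - lam t)))%C by (rewrite RtoC_minus; ring).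
  eapply Rle_trans; [apply Cmod_triangle|].
  eapply Rle_trans; [apply Rplus_le_compat_l, Cmod_triangle|].
  rewrite (Cmod_mult _ Ci) Cmod_Ci !Cmod_R (Rabs_pos_eq (2 * _)); [|lra].
  apply Rle_trans with (K * sqrt (t - r)).
  - unfold K. nra.
  - apply Rle_trans with (K * (e / K)); [apply Rmult_le_compat_l; lra | right; field; lra].
Qed.

Lemma slope_left_cont M lam delta c0 C1 t1 t2 g1 g2 : 0 < M -> 0 < delta -> 0 <= C1 ->
  holder_line M delta lam ->
  tip_curve lam delta c0 C1 t1 g1 -> tip_curve lam delta c0 C1 t2 g2 ->
  0 <= t1 < t2 -> left_cont (slope t1 t2 g1 g2) t1.
Proof.
  intros HM Hd HC HL T1 T2 H12. unfold slope. apply left_cont_mult.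
  - unfold Cminus. apply left_cont_plus.
    + destruct T2 as (_ & F2 & _). destruct (F2 t1 ltac:(lra) t1 ltac:(lra)) as [_ D].
      exact (cder_left_cont _ _ _ D).
    + assert (L1 := tip_curve_left_cont M lam delta c0 C1 t1 g1 HM Hd HC HL T1).
      intros e He. destruct (L1 e He) as (d & Hdp & B). exists d; split; auto.
      intros r Hr Hr0. replace (_ - _)%C with (- (g1 r - g1 t1))%C by ring. rewrite Cmod_opp; auto.
  - assert (L : left_cont (fun r => ((RtoC (sqrt (t1 - r)) + RtoC (sqrt (t2 - r))) * RtoC (/ (2 * (t2 - t1))))%C) t1).
    { apply left_cont_mult; [|apply left_cont_const]. apply left_cont_plus; [apply left_cont_sqrt_gap|].
      apply (cder_left_cont _ _ (RtoC (- / (2 * sqrt (t2 - t1))))). apply cder_RtoC.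
      auto_derive; [lra|]. unfold Rminus. field.
      apply Rgt_not_eq, sqrt_lt_R0; lra. }
    intros e He. destruct (L e He) as (d & Hdp & B). exists d; split; auto.
    intros r Hr Hr0. unfold Rdiv. rewrite !RtoC_mult !RtoC_plus. auto.
Qed.

Lemma slope_at_tip lam delta c0 C1 t1 t2 g1 g2 :
  tip_curve lam delta c0 C1 t1 g1 -> tip_curve lam delta c0 C1 t2 g2 ->
  0 <= t1 < t2 ->
  Cmod (slope t1 t2 g1 g2 t1 - Ci)%C <= C1 / 2 * Rpower (t2 - t1) delta /\
  c0 / 2 <= Cmod (slope t1 t2 g1 g2 t1).
Proof.
  intros (E1 & _ & _) (_ & _ & B2) H12. destruct (B2 t1 ltac:(lra)) as [L2 U2].
  assert (Hu : 0 < sqrt (t2 - t1)) by (apply sqrt_lt_R0; lra).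
  assert (Huu : sqrt (t2 - t1) * sqrt (t2 - t1) = t2 - t1) by (apply sqrt_sqrt; lra).
  assert (Hi : 0 < / (2 * sqrt (t2 - t1))) by (apply Rinv_0_lt_compat; lra).
  assert (ES : slope t1 t2 g1 g2 t1 = ((g2 t1 - RtoC (lam t1)) * RtoC (/ (2 * sqrt (t2 - t1))))%C).
  { unfold slope. rewrite E1. f_equal. f_equal. replace (t1 - t1) with 0 by ring.
    rewrite sqrt_0 -{2}Huu. field. lra. }
  rewrite ES. split.
  - assert (E : ((g2 t1 - RtoC (lam t1)) * RtoC (/ (2 * sqrt (t2 - t1))) - Ci)%C =
      ((g2 t1 - RtoC (lam t1) - RtoC (2 * sqrt (t2 - t1)) * Ci) * RtoC (/ (2 * sqrt (t2 - t1))))%C).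
    { assert (E' : (RtoC (2 * sqrt (t2 - t1)) * RtoC (/ (2 * sqrt (t2 - t1))))%C = RtoC 1).
      { rewrite -RtoC_mult. f_equal. field. lra. }
      replace Ci with (Ci * RtoC 1)%C at 1 by ring. rewrite -E'. ring. }
    rewrite E Cmod_mult Cmod_R Rabs_pos_eq; [|lra].
    apply Rle_trans with (C1 * (sqrt (t2 - t1) * Rpower (t2 - t1) delta) * / (2 * sqrt (t2 - t1))).
    + apply Rmult_le_compat_r; lra.
    + right. field. lra.
  - rewrite Cmod_mult Cmod_R Rabs_pos_eq; [|lra].
    apply Rle_trans with (c0 * sqrt (t2 - t1) * / (2 * sqrt (t2 - t1))).
    + right. field. lra.
    + apply Rmult_le_compat_r; lra.
Qed.

Lemma slope_coef_bound lam delta T c0 C1 t1 t2 g1 g2 s : 0 < c0 -> 0 <= C1 -> 0 < delta <= 1 / 2 ->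
  tip_curve lam delta c0 C1 t1 g1 -> tip_curve lam delta c0 C1 t2 g2 ->
  t1 < t2 <= T -> 0 <= s < t1 ->
  Cmod (slope_coef lam t1 t2 g1 g2 s) <=
    C1 * (2 + C1 * Rpower T delta + 2) / (2 * c0 ^ 2) * Rpower (t1 - s) (delta - 1).
Proof.
  intros Hc HC Hd (_ & _ & B1) (_ & _ & B2) H12 Hs.
  destruct (B1 s ltac:(lra)) as [L1 V1]. destruct (B2 s ltac:(lra)) as [L2 V2].
  assert (U1 : 0 < sqrt (t1 - s)) by (apply sqrt_lt_R0; lra).
  assert (U2 : 0 < sqrt (t2 - s)) by (apply sqrt_lt_R0; lra).
  assert (P12 : Rpower (t1 - s) delta <= Rpower (t2 - s) delta) by (apply Rle_Rpower_l; lra).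
  assert (P2T : Rpower (t2 - s) delta <= Rpower T delta) by (apply Rle_Rpower_l; lra).
  assert (P0 : 0 < Rpower (t2 - s) delta) by apply Rpower_pos.
  assert (A0 : 0 <= C1 * (2 + C1 * Rpower T delta + 2) / (2 * c0 ^ 2)).
  { apply Rdiv_le_0_compat; [|nra]. apply Rmult_le_pos; [lra|].
    assert (0 <= C1 * Rpower T delta) by (apply Rmult_le_pos; lra). lra. }
  unfold slope_coef.
  eapply Rle_trans.
  - apply (pair_coefficient_bound c0 C1 (2 + C1 * Rpower T delta) (Rpower (t2 - s) delta)); auto; try lra.
    + apply Rplus_le_compat_l, Rmult_le_compat_l; lra.
    + eapply Rle_trans; [exact V1|]. apply Rmult_le_compat_l; [lra|]. apply Rmult_le_compat_l; lra.
  - apply Rmult_le_compat_l; [exact A0|]. apply Rpower_gap_bound; lra.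
Qed.

Lemma expm1_le x X : 0 <= x <= X -> exp x - 1 <= x * exp X.
Proof.
  intros Hx. assert (H := exp_ineq1_le (- x)). rewrite exp_Ropp in H.
  assert (Hp := exp_pos x).
  assert (H1 : (1 + - x) * exp x <= 1).
  { apply Rle_trans with (/ exp x * exp x); [apply Rmult_le_compat_r; lra | right; field; lra]. }
  assert (H2 : exp x <= exp X) by (destruct (proj2 Hx) as [h| ->]; [left; apply exp_increasing; exact h | lra]).
  nra.
Qed.

Lemma is_derive_gap_potential t s a c : s < t -> a <> 0 ->
  is_derive (fun s => - (c / a) * Rpower (t - s) a) s (c * Rpower (t - s) (a - 1)).
Proof.
  intros Hs Ha. evar_last; [apply: is_derive_scal; apply is_derive_Rpower_gap; exact Hs|].
  unfold scal; simpl; unfold mult; simpl. field. exact Ha.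
Qed.

(** At s = t1 the slope is known from the estimate for one tip; the integrable
bound on its logarithmic derivative carries it back to any earlier time. *)
Lemma slope_estimate T M delta c0 C1 : 0 < T -> 0 < M -> 0 < delta <= 1 / 2 -> 0 < c0 -> 0 <= C1 ->
  exists C2 c2, 0 < C2 /\ 0 < c2 /\
  forall lam t1 t2 g1 g2 s, holder_line M delta lam ->
  tip_curve lam delta c0 C1 t1 g1 -> tip_curve lam delta c0 C1 t2 g2 ->
  t1 < t2 <= T -> 0 <= s <= t1 ->
  Cmod (slope t1 t2 g1 g2 s - Ci)%C <= C2 * Rpower (t2 - s) delta /\
  c2 <= Cmod (slope t1 t2 g1 g2 s).
Proof.
  intros HT HM Hd Hc HC.
  set (P := Rpower T delta). assert (HP : 0 < P) by apply Rpower_pos.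
  set (A := C1 * (2 + C1 * P + 2) / (2 * c0 ^ 2)).
  assert (HCP : 0 <= C1 * P) by (apply Rmult_le_pos; lra).
  assert (HA : 0 <= A).
  { unfold A. apply Rdiv_le_0_compat; [apply Rmult_le_pos; lra | nra]. }
  assert (HAd : 0 <= A / delta) by (apply Rdiv_le_0_compat; lra).
  set (X := A / delta * P). assert (HX : 0 <= X) by (apply Rmult_le_pos; lra).
  assert (HeX := exp_pos X).
  assert (H0 : 0 <= (1 + C1 / 2 * P) * (A / delta * exp X)).
  { apply Rmult_le_pos; [lra | apply Rmult_le_pos; lra]. }
  exists (1 + C1 / 2 + (1 + C1 / 2 * P) * (A / delta * exp X)), (c0 / 2 * / exp X).
  assert (HeX1 : 1 <= exp X) by (assert (Q := exp_ineq1_le X); lra).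
  assert (HiX : 0 < / exp X) by (apply Rinv_0_lt_compat; exact HeX).
  split; [lra|]. split; [apply Rmult_lt_0_compat; lra|].
  intros lam t1 t2 g1 g2 s HL T1 T2 H12 Hs.
  destruct (slope_at_tip lam delta c0 C1 t1 t2 g1 g2 T1 T2 ltac:(lra)) as [B1 B2].
  assert (Ph : Rpower (t2 - t1) delta <= Rpower (t2 - s) delta) by (apply Rle_Rpower_l; lra).
  assert (PT : Rpower (t2 - t1) delta <= P) by (apply Rle_Rpower_l; lra).
  assert (P0 : 0 < Rpower (t2 - s) delta) by apply Rpower_pos.
  assert (B1' : C1 / 2 * Rpower (t2 - t1) delta <= C1 / 2 * Rpower (t2 - s) delta)
    by (apply Rmult_le_compat_l; lra).
  destruct (Req_dec s t1) as [->|Hne].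
  { split.
    - eapply Rle_trans; [exact B1|]. eapply Rle_trans; [exact B1'|]. apply Rmult_le_compat_r; lra.
    - eapply Rle_trans; [|exact B2]. rewrite -{2}(Rmult_1_r (c0 / 2)). apply Rmult_le_compat_l; [lra|].
      rewrite -Rinv_1. apply Rinv_le_contravar; lra. }
  set (kap := A / delta * Rpower (t1 - s) delta).
  assert (P1 : Rpower (t1 - s) delta <= P) by (apply Rle_Rpower_l; lra).
  assert (P1' : Rpower (t1 - s) delta <= Rpower (t2 - s) delta) by (apply Rle_Rpower_l; lra).
  assert (P10 : 0 < Rpower (t1 - s) delta) by apply Rpower_pos.
  assert (Hkap : 0 <= kap <= X).
  { unfold kap, X; split; [apply Rmult_le_pos; lra | apply Rmult_le_compat_l; lra]. }
  destruct (linear_ode_limit (slope t1 t2 g1 g2) (slope_coef lam t1 t2 g1 g2)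
    (fun r => - (A / delta) * Rpower (t1 - r) delta) (fun r => A * Rpower (t1 - r) (delta - 1)) s t1 kap)
    as [E1 E2].
  - lra.
  - apply (slope_left_cont M lam delta c0 C1); auto; lra.
  - intros x Hx. apply (slope_cder lam delta c0 C1); auto; lra.
  - intros x Hx. apply is_derive_gap_potential; lra.
  - intros x Hx. apply (slope_coef_bound lam delta T c0 C1); auto; lra.
  - intros x Hx. assert (0 < Rpower (t1 - x) delta) by apply Rpower_pos. unfold kap.
    assert (0 <= A / delta * Rpower (t1 - x) delta) by (apply Rmult_le_pos; lra). lra.
  - split.
    + assert (Hup : Cmod (slope t1 t2 g1 g2 t1) <= 1 + C1 / 2 * P).
      { replace (slope t1 t2 g1 g2 t1) with (Ci + (slope t1 t2 g1 g2 t1 - Ci))%C by ring.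
        eapply Rle_trans; [apply Cmod_triangle|]. rewrite Cmod_Ci.
        assert (C1 / 2 * Rpower (t2 - t1) delta <= C1 / 2 * P) by (apply Rmult_le_compat_l; lra). lra. }
      assert (Hex := expm1_le kap X Hkap).
      assert (He1 : 0 <= exp kap - 1) by (assert (Q := exp_ineq1_le kap); lra).
      replace (slope t1 t2 g1 g2 s - Ci)%C with
        (- (slope t1 t2 g1 g2 t1 - slope t1 t2 g1 g2 s) + (slope t1 t2 g1 g2 t1 - Ci))%C by ring.
      eapply Rle_trans; [apply Cmod_triangle|]. rewrite Cmod_opp.
      assert (F1 : Cmod (slope t1 t2 g1 g2 t1) * (exp kap - 1) <= (1 + C1 / 2 * P) * (kap * exp X)).
      { apply Rmult_le_compat; auto. apply Cmod_ge_0. }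
      assert (F2 : (1 + C1 / 2 * P) * (kap * exp X) <= (1 + C1 / 2 * P) * (A / delta * exp X) * Rpower (t2 - s) delta).
      { unfold kap. replace ((1 + C1 / 2 * P) * (A / delta * Rpower (t1 - s) delta * exp X))
          with ((1 + C1 / 2 * P) * (A / delta * exp X) * Rpower (t1 - s) delta) by ring.
        apply Rmult_le_compat_l; lra. }
      lra.
    + assert (Hek : exp kap <= exp X).
      { destruct (proj2 Hkap) as [h| ->]; [left; apply exp_increasing; exact h | lra]. }
      apply Rmult_le_reg_r with (exp X); [exact HeX|].
      replace (c0 / 2 * / exp X * exp X) with (c0 / 2) by (field; lra).
      eapply Rle_trans; [exact B2|]. eapply Rle_trans; [exact E2|].
      apply Rmult_le_compat_l; [apply Cmod_ge_0 | exact Hek].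
Qed.

(** A gap of reciprocals such as 1/W1 - 1/W3 is (W3 - W1)/(W1 W3), and W3 - W1
is 2 (u3 - u1) times the slope from t1 to t3; hence the factor u3 - u1. *)
Lemma slope_coef_difference lam t1 t2 t3 g1 g2 g3 s :
  s < t1 -> t1 < t2 -> t2 < t3 ->
  (g1 s - RtoC (lam s))%C <> RtoC 0 -> (g2 s - RtoC (lam s))%C <> RtoC 0 ->
  (g3 s - RtoC (lam s))%C <> RtoC 0 ->
  (slope_coef lam t1 t2 g1 g2 s - slope_coef lam t2 t3 g2 g3 s)%C =
  (- (RtoC (sqrt (t3 - s) - sqrt (t1 - s)) *
    (RtoC 4 * slope t1 t3 g1 g3 s /
      ((g1 s - RtoC (lam s)) * (g2 s - RtoC (lam s)) * (g3 s - RtoC (lam s)))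
     + RtoC (/ (2 * (sqrt (t1 - s) * sqrt (t2 - s) * sqrt (t3 - s)))))))%C.
Proof.
  intros Hs H12 H23 N1 N2 N3. unfold slope_coef, slope.
  assert (U1 : 0 < sqrt (t1 - s)) by (apply sqrt_lt_R0; lra).
  assert (U2 : 0 < sqrt (t2 - s)) by (apply sqrt_lt_R0; lra).
  assert (U3 : 0 < sqrt (t3 - s)) by (apply sqrt_lt_R0; lra).
  set (u1 := sqrt (t1 - s)) in *. set (u2 := sqrt (t2 - s)) in *. set (u3 := sqrt (t3 - s)) in *.
  assert (HH : t3 - t1 = u3 * u3 - u1 * u1).
  { unfold u3, u1. rewrite !sqrt_sqrt; lra. }
  assert (Hr : RtoC ((u1 + u3) / (2 * (t3 - t1))) = (/ (RtoC 2 * (RtoC (u3 - u1))))%C).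
  { rewrite -RtoC_mult -RtoC_inv; [|nra]. f_equal. rewrite HH. field. split; nra. }
  rewrite Hr.
  assert (Hd : RtoC (u3 - u1) <> RtoC 0) by (intros E; apply RtoC_inj in E; nra).
  assert (HR : (RtoC (/ (2 * (u1 * u2))) - RtoC (/ (2 * (u2 * u3))))%C =
     (RtoC (u3 - u1) * RtoC (/ (2 * (u1 * u2 * u3))))%C).
  { rewrite -RtoC_minus -RtoC_mult. f_equal. field. lra. }
  assert (T2 : RtoC 2 <> RtoC 0) by (intros E; apply RtoC_inj in E; lra).
  set (A := RtoC (/ (2 * (u1 * u2)))) in *.
  set (A' := RtoC (/ (2 * (u2 * u3)))) in *.
  set (A'' := RtoC (/ (2 * (u1 * u2 * u3)))) in *.
  set (d := RtoC (u3 - u1)) in *.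
  replace (RtoC 4) with (RtoC 2 * RtoC 2)%C by (rewrite -RtoC_mult; f_equal; ring).
  match goal with |- (?a - A - (?b - A'))%C = _ =>
    transitivity (a - b - (A - A'))%C; [ring|] end.
  rewrite HR. field. repeat split; auto.
Qed.

Lemma slope_coef_difference_bound lam delta T c0 C1 C2 t1 t2 t3 g1 g2 g3 s :
  0 < c0 -> 0 <= C1 -> 0 <= C2 -> 0 < delta <= 1 / 2 ->
  tip_curve lam delta c0 C1 t1 g1 -> tip_curve lam delta c0 C1 t2 g2 ->
  tip_curve lam delta c0 C1 t3 g3 ->
  Cmod (slope t1 t3 g1 g3 s - Ci)%C <= C2 * Rpower (t3 - s) delta ->
  t1 < t2 -> t2 < t3 <= T -> 0 <= s < t1 ->
  Cmod (slope_coef lam t1 t2 g1 g2 s - slope_coef lam t2 t3 g2 g3 s)%C <=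
    (8 * C2 + C1 * ((2 + C1 * Rpower T delta) ^ 2 + 2 * (2 + C1 * Rpower T delta) + 4)) / (2 * c0 ^ 3)
    * (t3 - t1) * Rpower (t1 - s) (delta - 1 - 1).
Proof.
  intros Hc HC HC2 Hd (_ & _ & B1) (_ & _ & B2) (_ & _ & B3) HZ H12 H23 Hs.
  destruct (B1 s ltac:(lra)) as [L1 V1]. destruct (B2 s ltac:(lra)) as [L2 V2].
  destruct (B3 s ltac:(lra)) as [L3 V3].
  assert (U1 : 0 < sqrt (t1 - s)) by (apply sqrt_lt_R0; lra).
  assert (U2 : 0 < sqrt (t2 - s)) by (apply sqrt_lt_R0; lra).
  assert (U3 : 0 < sqrt (t3 - s)) by (apply sqrt_lt_R0; lra).
  assert (P1 : Rpower (t1 - s) delta <= Rpower (t3 - s) delta) by (apply Rle_Rpower_l; lra).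
  assert (P2 : Rpower (t2 - s) delta <= Rpower (t3 - s) delta) by (apply Rle_Rpower_l; lra).
  assert (P3 : Rpower (t3 - s) delta <= Rpower T delta) by (apply Rle_Rpower_l; lra).
  assert (P0 : 0 < Rpower (t3 - s) delta) by apply Rpower_pos.
  set (B := 2 + C1 * Rpower T delta).
  assert (HB : 0 <= B) by (unfold B; assert (0 <= C1 * Rpower T delta) by (apply Rmult_le_pos; lra); lra).
  set (D := (8 * C2 + C1 * (B ^ 2 + 2 * B + 4)) / (2 * c0 ^ 3)).
  assert (HD : 0 <= D).
  { unfold D. apply Rdiv_le_0_compat.
    - assert (0 <= C1 * (B ^ 2 + 2 * B + 4)) by (apply Rmult_le_pos; nra). lra.
    - assert (0 < c0 ^ 3) by (apply pow_lt; lra). lra. }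
  assert (N1 : (g1 s - RtoC (lam s))%C <> RtoC 0) by (apply Cmod_gt_0; nra).
  assert (N2 : (g2 s - RtoC (lam s))%C <> RtoC 0) by (apply Cmod_gt_0; nra).
  assert (N3 : (g3 s - RtoC (lam s))%C <> RtoC 0) by (apply Cmod_gt_0; nra).
  rewrite slope_coef_difference; auto; try lra.
  rewrite Cmod_opp Cmod_mult Cmod_R.
  assert (S12 : sqrt (t1 - s) <= sqrt (t2 - s)) by (apply sqrt_le_1_alt; lra).
  assert (S13 : sqrt (t1 - s) <= sqrt (t3 - s)) by (apply sqrt_le_1_alt; lra).
  rewrite Rabs_pos_eq; [|lra].
  assert (V : forall u p, 0 < u -> p <= Rpower (t3 - s) delta -> C1 * (u * p) <= C1 * (u * Rpower (t3 - s) delta)).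
  { intros u p Hu Hp. apply Rmult_le_compat_l; [lra|]. apply Rmult_le_compat_l; lra. }
  assert (Q := triple_coefficient_bound c0 C1 C2 B (Rpower (t3 - s) delta)
    (sqrt (t1 - s)) (sqrt (t2 - s)) (sqrt (t3 - s)) _ _ _ _ Hc HC ltac:(lra)
    ltac:(unfold B; apply Rplus_le_compat_l, Rmult_le_compat_l; lra) U1 U2 U3 L1 L2 L3
    (Rle_trans _ _ _ V1 (V _ _ U1 P1)) (Rle_trans _ _ _ V2 (V _ _ U2 P2)) V3 HZ).
  fold D in Q.
  assert (Hgap : sqrt (t3 - s) - sqrt (t1 - s) <= (t3 - t1) / sqrt (t1 - s)).
  { assert (E3 : sqrt (t3 - s) * sqrt (t3 - s) = t3 - s) by (apply sqrt_sqrt; lra).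
    assert (E1 : sqrt (t1 - s) * sqrt (t1 - s) = t1 - s) by (apply sqrt_sqrt; lra).
    apply Rle_div_r; [lra|]. nra. }
  apply Rle_trans with ((t3 - t1) / sqrt (t1 - s) *
     (D * (Rpower (t3 - s) delta / (sqrt (t1 - s) * sqrt (t2 - s) * sqrt (t3 - s))))).
  { apply Rmult_le_compat; auto; [lra | apply Cmod_ge_0]. }
  assert (Hg := Rpower_gap_bound (t1 - s) (t3 - s) delta ltac:(lra) ltac:(lra)).
  rewrite -(Rpower_div _ (delta - 1)); [|lra].
  assert (E1 : sqrt (t1 - s) * sqrt (t1 - s) = t1 - s) by (apply sqrt_sqrt; lra).
  assert (Hp1 : 0 < Rpower (t1 - s) (delta - 1)) by apply Rpower_pos.
  replace ((t3 - t1) / sqrt (t1 - s) *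
     (D * (Rpower (t3 - s) delta / (sqrt (t1 - s) * sqrt (t2 - s) * sqrt (t3 - s)))))
    with (D * (t3 - t1) * (Rpower (t3 - s) delta / (sqrt (t1 - s) * sqrt (t3 - s)) *
       / (sqrt (t1 - s) * sqrt (t2 - s)))) by (field; lra).
  apply Rmult_le_compat_l; [apply Rmult_le_pos; lra|].
  apply Rmult_le_compat; [| | exact Hg |].
  - apply Rdiv_le_0_compat; [lra | apply Rmult_lt_0_compat; lra].
  - left; apply Rinv_0_lt_compat, Rmult_lt_0_compat; lra.
  - apply Rinv_le_contravar; [lra|].
    apply Rle_trans with (sqrt (t1 - s) * sqrt (t1 - s)); [lra|]. apply Rmult_le_compat_l; lra.
Qed.

(** The ratio R of the two slopes is close to 1 at s = t1, since each slope is
close to i there.  The two bounds on its logarithmic derivative are used on the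
two sides of the time t1 - (t3 - t1). *)
Lemma slope_variation T M delta c0 C1 : 0 < T -> 0 < M -> 0 < delta <= 1 / 2 -> 0 < c0 -> 0 <= C1 ->
  exists C3, 0 < C3 /\
  forall lam t1 t2 t3 g1 g2 g3, holder_line M delta lam ->
  tip_curve lam delta c0 C1 t1 g1 -> tip_curve lam delta c0 C1 t2 g2 ->
  tip_curve lam delta c0 C1 t3 g3 -> 0 <= t1 -> t1 < t2 -> t2 < t3 <= T ->
  Cmod (slope t1 t2 g1 g2 0 - slope t2 t3 g2 g3 0)%C <= C3 * Rpower (t3 - t1) delta.
Proof.
  intros HT HM Hd Hc HC.
  destruct (slope_estimate T M delta c0 C1 HT HM Hd Hc HC) as (C2 & c2 & HC2 & Hc2 & HS).
  set (P := Rpower T delta). assert (HP : 0 < P) by apply Rpower_pos.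
  set (B := 2 + C1 * P).
  assert (HCP : 0 <= C1 * P) by (apply Rmult_le_pos; lra).
  set (A := C1 * (B + 2) / (2 * c0 ^ 2)).
  assert (HA : 0 <= A).
  { unfold A, B. apply Rdiv_le_0_compat; [apply Rmult_le_pos; lra | nra]. }
  set (D := (8 * C2 + C1 * (B ^ 2 + 2 * B + 4)) / (2 * c0 ^ 3)).
  assert (HD : 0 <= D).
  { unfold D. apply Rdiv_le_0_compat.
    - assert (0 <= C1 * (B ^ 2 + 2 * B + 4)) by (apply Rmult_le_pos; unfold B; nra). lra.
    - assert (0 < c0 ^ 3) by (apply pow_lt; lra). lra. }
  set (U := 1 + C2 * P).
  assert (HU : 1 <= U) by (unfold U; assert (0 <= C2 * P) by (apply Rmult_le_pos; lra); lra).
  set (k1 := 2 * A / delta). assert (Hk1 : 0 <= k1) by (apply Rdiv_le_0_compat; lra).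
  set (k2 := D / (1 - delta)). assert (Hk2 : 0 <= k2) by (apply Rdiv_le_0_compat; lra).
  set (V := U / c2). assert (HV : 0 < V) by (apply Rdiv_lt_0_compat; lra).
  assert (X1 := exp_pos (k1 * P)). assert (X2 := exp_pos (k2 * P)).
  assert (Z1 : 0 <= V * (k1 * exp (k1 * P))) by (apply Rmult_le_pos; [lra | apply Rmult_le_pos; lra]).
  assert (Z2 : 0 <= V * (k2 * exp (k2 * P))) by (apply Rmult_le_pos; [lra | apply Rmult_le_pos; lra]).
  assert (Z3 : 0 < 2 * C2 / c2) by (apply Rdiv_lt_0_compat; lra).
  exists (U * (V * (k2 * exp (k2 * P)) + V * (k1 * exp (k1 * P)) + 2 * C2 / c2)).
  split; [apply Rmult_lt_0_compat; lra|].
  intros lam t1 t2 t3 g1 g2 g3 HL T1 T2 T3 H1 H12 H23.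
  set (h := t3 - t1). assert (Hh : 0 < h) by (unfold h; lra).
  set (p := Rpower h delta). assert (Hp : 0 < p) by apply Rpower_pos.
  assert (HpP : p <= P) by (apply Rle_Rpower_l; unfold h; lra).
  assert (E12 := fun s => HS lam t1 t2 g1 g2 s HL T1 T2 ltac:(lra)).
  assert (E23 := fun s => HS lam t2 t3 g2 g3 s HL T2 T3 ltac:(lra)).
  assert (E13 := fun s => HS lam t1 t3 g1 g3 s HL T1 T3 ltac:(lra)).
  assert (HUp : forall a b ga gb s, t1 <= a -> a < b -> b <= t3 -> 0 <= s <= t1 ->
     Cmod (slope a b ga gb s - Ci)%C <= C2 * Rpower (b - s) delta -> Cmod (slope a b ga gb s) <= U).
  { intros a b ga gb s Ha Hab Hb Hs HH.
    replace (slope a b ga gb s) with (Ci + (slope a b ga gb s - Ci))%C by ring.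
    eapply Rle_trans; [apply Cmod_triangle|]. rewrite Cmod_Ci. unfold U.
    assert (Rpower (b - s) delta <= P) by (apply Rle_Rpower_l; lra).
    assert (C2 * Rpower (b - s) delta <= C2 * P) by (apply Rmult_le_compat_l; lra). lra. }
  set (R := fun s => (slope t1 t2 g1 g2 s * / slope t2 t3 g2 g3 s)%C).
  assert (N23 : forall s, 0 <= s <= t1 -> slope t2 t3 g2 g3 s <> RtoC 0).
  { intros s Hs. destruct (E23 s ltac:(lra)) as [_ Q]. apply Cmod_gt_0; lra. }
  assert (RV : forall s, 0 <= s <= t1 -> Cmod (R s) <= V).
  { intros s Hs. destruct (E12 s Hs) as [Q1 _]. destruct (E23 s ltac:(lra)) as [_ Q2].
    assert (Q := HUp t1 t2 g1 g2 s ltac:(lra) H12 ltac:(lra) Hs Q1).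
    unfold R. rewrite Cmod_mult Cmod_inv; [|apply N23; exact Hs].
    unfold V, Rdiv. apply Rmult_le_compat; auto; [apply Cmod_ge_0 | left; apply Rinv_0_lt_compat; lra|].
    apply Rinv_le_contravar; lra. }
  set (a := fun s => (slope_coef lam t1 t2 g1 g2 s - slope_coef lam t2 t3 g2 g3 s)%C).
  assert (DR : forall s, 0 <= s < t1 -> cder R s (a s * R s)%C).
  { intros s Hs. assert (Q1 := slope_cder lam delta c0 C1 t1 t2 g1 g2 s Hc T1 T2 H12 Hs).
    assert (Q2 := slope_cder lam delta c0 C1 t2 t3 g2 g3 s Hc T2 T3 ltac:(lra) ltac:(lra)).
    eapply cder_eq; [apply cder_mult; [exact Q1 | apply cder_inv; [apply N23; lra | exact Q2]]|].
    unfold a, R. field. apply N23; lra. }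
  assert (Htip : Cmod (R t1 - RtoC 1)%C <= 2 * C2 / c2 * p).
  { destruct (E12 t1 ltac:(lra)) as [Q1 _]. destruct (E23 t1 ltac:(lra)) as [Q2 Q3].
    assert (N := N23 t1 ltac:(lra)).
    replace (R t1 - RtoC 1)%C with (((slope t1 t2 g1 g2 t1 - Ci) - (slope t2 t3 g2 g3 t1 - Ci)) / slope t2 t3 g2 g3 t1)%C
      by (unfold R; field; exact N).
    rewrite Cmod_div; [|exact N].
    assert (Rpower (t2 - t1) delta <= p) by (apply Rle_Rpower_l; unfold h; lra).
    assert (Q4 : Cmod ((slope t1 t2 g1 g2 t1 - Ci) - (slope t2 t3 g2 g3 t1 - Ci))%C <= 2 * C2 * p).
    { unfold Cminus at 1. eapply Rle_trans; [apply Cmod_triangle|]. rewrite Cmod_opp.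
      assert (C2 * Rpower (t2 - t1) delta <= C2 * p) by (apply Rmult_le_compat_l; lra).
      fold h in Q2. fold p in Q2. lra. }
    replace (2 * C2 / c2 * p) with (2 * C2 * p / c2) by (field; lra).
    unfold Rdiv. apply Rmult_le_compat; auto; [apply Cmod_ge_0 | left; apply Rinv_0_lt_compat; lra|].
    apply Rinv_le_contravar; lra. }
  (* The time where the two bounds on the logarithmic derivative cross. *)
  set (q := Rmax 0 (t1 - h)).
  assert (Hq : 0 <= q /\ t1 - h <= q /\ q <= t1).
  { unfold q; repeat split; [apply Rmax_l | apply Rmax_r | apply Rmax_lub; lra]. }
  assert (HA1 : Cmod (R t1 - R q)%C <= V * (k1 * exp (k1 * P)) * p).
  { destruct (Req_dec q t1) as [->|Hne].
    { replace (R t1 - R t1)%C with (RtoC 0) by ring. rewrite Cmod_0. apply Rmult_le_pos; lra. }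
    assert (Hk : 0 <= k1 * p <= k1 * P).
    { split; [apply Rmult_le_pos; lra | apply Rmult_le_compat_l; lra]. }
    destruct (linear_ode_limit R a (fun r => - k1 * Rpower (t1 - r) delta)
      (fun r => 2 * A * Rpower (t1 - r) (delta - 1)) q t1 (k1 * p)) as [Q _].
    - lra.
    - unfold R. apply left_cont_mult.
      + apply (slope_left_cont M lam delta c0 C1); auto; lra.
      + eapply cder_left_cont. apply cder_inv; [apply N23; lra|].
        apply (slope_cder lam delta c0 C1); auto; lra.
    - intros x Hx. apply DR; lra.
    - intros x Hx. apply is_derive_gap_potential; lra.
    - intros x Hx. unfold a, Cminus. eapply Rle_trans; [apply Cmod_triangle|]. rewrite Cmod_opp.
      assert (Q1 := slope_coef_bound lam delta T c0 C1 t1 t2 g1 g2 x Hc HC Hd T1 T2 ltac:(lra) ltac:(lra)).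
      assert (Q2 := slope_coef_bound lam delta T c0 C1 t2 t3 g2 g3 x Hc HC Hd T2 T3 ltac:(lra) ltac:(lra)).
      fold P in Q1, Q2. fold B in Q1, Q2. fold A in Q1, Q2.
      assert (Q3 : Rpower (t2 - x) (delta - 1) <= Rpower (t1 - x) (delta - 1)) by (apply Rpower_decr; lra).
      assert (A * Rpower (t2 - x) (delta - 1) <= A * Rpower (t1 - x) (delta - 1)) by (apply Rmult_le_compat_l; lra).
      lra.
    - intros x Hx. assert (0 < Rpower (t1 - x) delta) by apply Rpower_pos.
      assert (Rpower (t1 - q) delta <= p) by (apply Rle_Rpower_l; lra).
      assert (k1 * Rpower (t1 - q) delta <= k1 * p) by (apply Rmult_le_compat_l; lra).
      assert (0 <= k1 * Rpower (t1 - x) delta) by (apply Rmult_le_pos; lra). lra.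
    - eapply Rle_trans; [exact Q|].
      replace (V * (k1 * exp (k1 * P)) * p) with (V * (k1 * p * exp (k1 * P))) by ring.
      apply Rmult_le_compat; [apply Cmod_ge_0 | | apply RV; lra | apply expm1_le; exact Hk].
      assert (Q' := exp_ineq1_le (k1 * p)). lra. }
  assert (HA2 : Cmod (R q - R 0)%C <= V * (k2 * exp (k2 * P)) * p).
  { destruct (Req_dec q 0) as [E|Hne].
    { rewrite E. replace (R 0 - R 0)%C with (RtoC 0) by ring. rewrite Cmod_0. apply Rmult_le_pos; lra. }
    assert (Eq : q = t1 - h).
    { unfold q, Rmax in *. destruct (Rle_dec 0 (t1 - h)); lra. }
    set (K := fun r => - (D * h / (delta - 1)) * Rpower (t1 - r) (delta - 1)).
    assert (Hkk : 0 <= k2 * p <= k2 * P).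
    { split; [apply Rmult_le_pos; lra | apply Rmult_le_compat_l; lra]. }
    assert (HKK : 0 <= K q - K 0 <= k2 * p).
    { unfold K. replace (- (D * h / (delta - 1))) with (k2 * h) by (unfold k2; field; lra).
      assert (0 <= k2 * h) by (apply Rmult_le_pos; lra).
      assert (0 < Rpower (t1 - 0) (delta - 1)) by apply Rpower_pos.
      assert (Rpower (t1 - 0) (delta - 1) <= Rpower (t1 - q) (delta - 1)) by (apply Rpower_decr; lra).
      assert (Eh : Rpower (t1 - q) (delta - 1) = p / h).
      { replace (t1 - q) with h by lra. unfold p. rewrite Rpower_div; auto. }
      split.
      - assert (k2 * h * Rpower (t1 - 0) (delta - 1) <= k2 * h * Rpower (t1 - q) (delta - 1))
          by (apply Rmult_le_compat_l; lra). lra.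
      - rewrite Eh. replace (k2 * h * (p / h)) with (k2 * p) by (field; lra).
        assert (0 <= k2 * h * Rpower (t1 - 0) (delta - 1)) by (apply Rmult_le_pos; lra). lra. }
    assert (Q := linear_ode_variation R a K (fun r => D * h * Rpower (t1 - r) (delta - 1 - 1)) 0 q ltac:(lra)).
    eapply Rle_trans; [apply Q|].
    - intros x Hx. apply DR; lra.
    - intros x Hx. apply is_derive_gap_potential; lra.
    - intros x Hx. apply (slope_coef_difference_bound lam delta T c0 C1 C2); auto; try lra.
      apply E13; lra.
    - replace (V * (k2 * exp (k2 * P)) * p) with (V * (k2 * p * exp (k2 * P))) by ring.
      assert (Q' := exp_ineq1_le (K q - K 0)).
      apply Rmult_le_compat; [apply Cmod_ge_0 | lra | apply RV; lra|].
      eapply Rle_trans; [apply (expm1_le _ (k2 * P)); lra|].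
      apply Rmult_le_compat_r; lra. }
  assert (HR0 : Cmod (R 0 - RtoC 1)%C <= (V * (k2 * exp (k2 * P)) + V * (k1 * exp (k1 * P)) + 2 * C2 / c2) * p).
  { replace (R 0 - RtoC 1)%C with (- (R q - R 0) + (- (R t1 - R q) + (R t1 - RtoC 1)))%C by ring.
    eapply Rle_trans; [apply Cmod_triangle|].
    eapply Rle_trans; [apply Rplus_le_compat_l, Cmod_triangle|]. rewrite !Cmod_opp. lra. }
  destruct (E23 0 ltac:(lra)) as [Q1 _].
  assert (Q2 := HUp t2 t3 g2 g3 0 ltac:(lra) ltac:(lra) ltac:(lra) ltac:(lra) Q1).
  assert (N := N23 0 ltac:(lra)).
  replace (slope t1 t2 g1 g2 0 - slope t2 t3 g2 g3 0)%C with (slope t2 t3 g2 g3 0 * (R 0 - RtoC 1))%C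
    by (unfold R; field; exact N).
  rewrite Cmod_mult Rmult_assoc. apply Rmult_le_compat; auto; apply Cmod_ge_0.
Qed.

(** * From difference quotients to regularity *)

Definition dq (f : R -> C) (x y : R) : C := ((f y - f x) / RtoC (y - x))%C.

Lemma RtoC_neq_0 x : x <> 0 -> RtoC x <> RtoC 0.
Proof. intros H E. apply H, RtoC_inj, E. Qed.

Lemma dq_sym f x y : dq f x y = dq f y x.
Proof.
  unfold dq. destruct (Req_dec x y) as [->|H]; [reflexivity|].
  assert (N1 : RtoC (y - x) <> RtoC 0) by (apply RtoC_neq_0; lra).
  assert (N2 : RtoC (x - y) <> RtoC 0) by (apply RtoC_neq_0; lra).
  replace (RtoC (x - y)) with (- RtoC (y - x))%C by (rewrite -RtoC_opp; f_equal; ring).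
  field. exact N1.
Qed.

(** The quotient over [x,z] is a convex combination of those over [x,y] and
[y,z]. *)
Lemma dq_split f x y z : x < y -> y < z ->
  (dq f x y - dq f x z)%C = (RtoC ((z - y) / (z - x)) * (dq f x y - dq f y z))%C /\
  (dq f y z - dq f x z)%C = (RtoC ((y - x) / (z - x)) * (dq f y z - dq f x y))%C.
Proof.
  intros Hxy Hyz. unfold dq, Rdiv.
  rewrite !RtoC_mult !RtoC_inv; try lra.
  assert (N1 : RtoC (y - x) <> RtoC 0) by (apply RtoC_neq_0; lra).
  assert (N2 : RtoC (z - x) <> RtoC 0) by (apply RtoC_neq_0; lra).
  assert (N3 : RtoC (z - y) <> RtoC 0) by (apply RtoC_neq_0; lra).
  rewrite !RtoC_minus in N1 N2 N3 |- *.
  split; field; auto.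
Qed.

Lemma holder_limit_at_0 (q : R -> C) H delta a : 0 < a -> 0 < H -> 0 < delta ->
  (forall u v, 0 < u -> u < v -> v <= a -> Cmod (q u - q v)%C <= H * Rpower v delta) ->
  exists l, forall v, 0 < v <= a -> Cmod (l - q v)%C <= H * Rpower v delta.
Proof.
  intros Ha HH Hd Hq.
  destruct (gauge_left_limit (fun u => q (a - u)) (fun u => H * Rpower (a - u) delta) a) as [l Hl].
  - intros u v Hu Huv Hv. destruct Huv as [Huv| ->].
    + apply Hq; lra.
    + replace (_ - _)%C with (RtoC 0) by ring. rewrite Cmod_0.
      apply Rmult_le_pos; [lra | left; apply Rpower_pos].
  - intros e He. destruct (holder_gauge_vanishes H delta e HH Hd He) as (d & Hdp & B).
    exists (a - Rmin a d). assert (0 < Rmin a d) by (apply Rmin_pos; lra).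
    pose proof (Rmin_l a d). pose proof (Rmin_r a d). split; [lra|]. apply B. lra.
  - exists l. intros v Hv. assert (Q := Hl (a - v) ltac:(lra)).
    replace (a - (a - v)) with v in Q by ring. exact Q.
Qed.

(** Quotients on either side of x are Cauchy by [dq_split]; the two one-sided
limits agree because the hypothesis compares a left with a right quotient. *)
Lemma derivative_of_quotients (f : R -> C) L H delta : 0 < L -> 0 < H -> 0 < delta ->
  (forall x y z, 0 <= x -> x < y -> y < z -> z <= L ->
     Cmod (dq f x y - dq f y z)%C <= H * Rpower (z - x) delta) ->
  forall x, 0 <= x <= L -> exists l, forall y, 0 <= y <= L -> y <> x ->
    Cmod (l - dq f x y)%C <= H * Rpower (Rabs (y - x)) delta.
Proof.
  intros HL HH Hd Hq x Hx.
  assert (Hw : forall w z, 0 <= w <= 1 -> Cmod (RtoC w * z)%C <= Cmod z).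
  { intros w z Hw. rewrite Cmod_mult Cmod_R Rabs_pos_eq; [|lra].
    pose proof (Cmod_ge_0 z). nra. }
  assert (Hright : x < L -> exists l, forall y, x < y <= L ->
    Cmod (l - dq f x y)%C <= H * Rpower (y - x) delta).
  { intros HxL. destruct (holder_limit_at_0 (fun u => dq f x (x + u)) H delta (L - x)) as [l Hl]; try lra.
    - intros u v Hu Huv Hv. destruct (dq_split f x (x + u) (x + v)) as [E _]; try lra.
      rewrite E. eapply Rle_trans.
      + apply Hw. split; [apply Rdiv_le_0_compat; lra | apply Rle_div_l; lra].
      + assert (Q := Hq x (x + u) (x + v) ltac:(lra) ltac:(lra) ltac:(lra) ltac:(lra)).
        replace (x + v - x) with v in Q by ring. exact Q.
    - exists l. intros y Hy. assert (Q := Hl (y - x) ltac:(lra)).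
      replace (x + (y - x)) with y in Q by ring. exact Q. }
  assert (Hleft : 0 < x -> exists l, forall y, 0 <= y < x ->
    Cmod (l - dq f x y)%C <= H * Rpower (x - y) delta).
  { intros Hx0. destruct (holder_limit_at_0 (fun u => dq f x (x - u)) H delta x) as [l Hl]; try lra.
    - intros u v Hu Huv Hv. rewrite !(dq_sym f x).
      destruct (dq_split f (x - v) (x - u) x) as [_ E]; try lra.
      rewrite E. eapply Rle_trans.
      + apply Hw. split; [apply Rdiv_le_0_compat; lra | apply Rle_div_l; lra].
      + assert (Q := Hq (x - v) (x - u) x ltac:(lra) ltac:(lra) ltac:(lra) ltac:(lra)).
        replace (x - (x - v)) with v in Q by ring. rewrite Cmod_minus_sym. exact Q.
    - exists l. intros y Hy. assert (Q := Hl (x - y) ltac:(lra)).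
      replace (x - (x - y)) with y in Q by ring. exact Q. }
  destruct (Rlt_dec x L) as [HxL|HxL]; [destruct (Rlt_dec 0 x) as [Hx0|Hx0]|].
  - destruct (Hright HxL) as [l Hl]. destruct (Hleft Hx0) as [l' Hl'].
    assert (E : l' = l).
    { assert (Z : Cmod (l' - l)%C <= 0).
      { apply le_epsilon. intros e He.
        destruct (holder_gauge_vanishes H delta (e / 3) HH Hd ltac:(lra)) as (d & Hdp & B).
        set (u := Rmin (d / 2) (Rmin x (L - x))).
        assert (Hu : 0 < u /\ u <= d / 2 /\ u <= x /\ u <= L - x).
        { unfold u. repeat split.
          - repeat apply Rmin_pos; lra.
          - apply Rmin_l.
          - eapply Rle_trans; [apply Rmin_r | apply Rmin_l].
          - eapply Rle_trans; [apply Rmin_r | apply Rmin_r]. }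
        assert (Q1 := Hl (x + u) ltac:(lra)). assert (Q2 := Hl' (x - u) ltac:(lra)).
        assert (Q3 := Hq (x - u) x (x + u) ltac:(lra) ltac:(lra) ltac:(lra) ltac:(lra)).
        replace (x + u - x) with u in Q1 by ring. replace (x - (x - u)) with u in Q2 by ring.
        replace (x + u - (x - u)) with (2 * u) in Q3 by ring.
        assert (B1 := B u ltac:(lra)). assert (B2 := B (2 * u) ltac:(lra)).
        rewrite (dq_sym f x (x - u)) in Q2.
        replace (l' - l)%C with ((l' - dq f (x - u) x) + ((dq f (x - u) x - dq f x (x + u)) + - (l - dq f x (x + u))))%C by ring.
        eapply Rle_trans; [apply Cmod_triangle|].
        eapply Rle_trans; [apply Rplus_le_compat_l, Cmod_triangle|]. rewrite Cmod_opp. lra. }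
      pose proof (Cmod_ge_0 (l' - l)%C).
      assert (Z0 : (l' - l)%C = RtoC 0) by (apply Cmod_eq_0; lra).
      replace l' with ((l' - l) + l)%C by ring. rewrite Z0. ring. }
    exists l. intros y Hy Hne. destruct (Rlt_dec x y).
    + rewrite Rabs_pos_eq; [|lra]. apply Hl; lra.
    + rewrite Rabs_left; [|lra]. replace (- (y - x)) with (x - y) by ring. rewrite -E. apply Hl'; lra.
  - destruct (Hright HxL) as [l Hl]. exists l. intros y Hy Hne.
    rewrite Rabs_pos_eq; [|lra]. apply Hl; lra.
  - destruct (Hleft ltac:(lra)) as [l Hl]. exists l. intros y Hy Hne.
    rewrite Rabs_left; [|lra]. replace (- (y - x)) with (x - y) by ring. apply Hl; lra.
Qed.

Lemma is_derive_on_of_quotients (f : R -> C) L H delta x l : 0 < H -> 0 < delta -> 0 <= x <= L ->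
  (forall y, 0 <= y <= L -> y <> x -> Cmod (l - dq f x y)%C <= H * Rpower (Rabs (y - x)) delta) ->
  is_derive_on 0 L f x l.
Proof.
  intros HH Hd Hx Hl. apply is_derive_on_iff; [exact Hx|]. intros e He.
  destruct (holder_gauge_vanishes H delta e HH Hd He) as (d & Hdp & B).
  exists d; split; [exact Hdp|]. intros s Hs Hsx.
  destruct (Req_dec s x) as [->|Hne].
  - replace (_ - _)%C with (RtoC 0); [rewrite Cmod_0; apply Rmult_le_pos; [lra | apply Rabs_pos]|].
    replace (x - x) with 0 by ring. ring.
  - assert (N : RtoC (s - x) <> RtoC 0) by (apply RtoC_neq_0; lra).
    replace (f s - f x - RtoC (s - x) * l)%C with (- (RtoC (s - x) * (l - dq f x s)))%C
      by (unfold dq; field; exact N).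
    rewrite Cmod_opp Cmod_mult Cmod_R Rmult_comm. apply Rmult_le_compat_r; [apply Rabs_pos|].
    eapply Rle_trans; [apply Hl; auto|]. apply B. split; [apply Rabs_pos_lt; lra | lra].
Qed.

Lemma is_derive_on_unique a b f t l l' : a < b -> a <= t <= b ->
  is_derive_on a b f t l -> is_derive_on a b f t l' -> l' = l.
Proof.
  intros Hab Ht H H'. apply is_derive_on_iff in H; auto. apply is_derive_on_iff in H'; auto.
  assert (Z : Cmod (l' - l)%C <= 0).
  { apply le_epsilon. intros e He.
    destruct (H (e / 2) ltac:(lra)) as (d1 & D1 & B1). destruct (H' (e / 2) ltac:(lra)) as (d2 & D2 & B2).
    assert (Hs : exists s, Icc a b s /\ 0 < Rabs (s - t) /\ Rabs (s - t) < d1 /\ Rabs (s - t) < d2).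
    { set (m := Rmin d1 d2). assert (Hm : 0 < m) by (apply Rmin_pos; lra).
      assert (M1 : m <= d1) by apply Rmin_l. assert (M2 : m <= d2) by apply Rmin_r.
      destruct (Rlt_dec t b) as [Htb|Htb].
      - set (u := Rmin (m / 2) (b - t)).
        assert (Hu : 0 < u) by (apply Rmin_pos; lra).
        assert (u <= m / 2) by apply Rmin_l. assert (u <= b - t) by apply Rmin_r.
        exists (t + u). unfold Icc. replace (t + u - t) with u by ring. rewrite Rabs_pos_eq; lra.
      - set (u := Rmin (m / 2) (t - a)).
        assert (Hu : 0 < u) by (apply Rmin_pos; lra).
        assert (u <= m / 2) by apply Rmin_l. assert (u <= t - a) by apply Rmin_r.
        exists (t - u). unfold Icc. replace (t - u - t) with (- u) by ring.
        rewrite Rabs_Ropp Rabs_pos_eq; lra. }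
    destruct Hs as (s & Hs & Hp & H1 & H2).
    assert (Q1 := B1 s Hs H1). assert (Q2 := B2 s Hs H2).
    apply Rmult_le_reg_r with (Rabs (s - t)); [exact Hp|].
    rewrite -(Cmod_R (s - t)) -Cmod_mult.
    replace ((l' - l) * RtoC (s - t))%C with
      ((f s - f t - RtoC (s - t) * l) + - (f s - f t - RtoC (s - t) * l'))%C by ring.
    eapply Rle_trans; [apply Cmod_triangle|]. rewrite Cmod_opp Cmod_R. lra. }
  pose proof (Cmod_ge_0 (l' - l)%C).
  assert (Z0 : (l' - l)%C = RtoC 0) by (apply Cmod_eq_0; lra).
  replace l' with ((l' - l) + l)%C by ring. rewrite Z0. ring.
Qed.

Lemma Derive_on_unique a b f t l : a < b -> a <= t <= b ->
  is_derive_on a b f t l -> Derive_on a b f t = l.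
Proof.
  intros Hab Ht H. unfold Derive_on.
  apply (iota_unique (V := C_R_CompleteNormedModule) (is_derive_on a b f t) l); [|exact H].
  intros y Hy. exact (is_derive_on_unique a b f t l y Hab Ht H Hy).
Qed.

Lemma Lub_Rbar_bounded (E : R -> Prop) b : (exists x, E x) -> (forall x, E x -> 0 <= x <= b) ->
  exists r, Lub_Rbar E = Finite r /\ r <= b.
Proof.
  intros [x0 Hx0] HE. destruct (Lub_Rbar_correct E) as [H1 H2].
  assert (B : Rbar_le (Lub_Rbar E) (Finite b)) by (apply H2; intros x Hx; apply HE; exact Hx).
  assert (B0 := H1 x0 Hx0).
  destruct (Lub_Rbar E) as [r| |]; simpl in *; try contradiction. exists r; auto.
Qed.

(** The derivative inherits the bounds on quotients by taking one with a nearby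
point.  In the third conclusion that point lies to the left of t, so that the
bound at t applies.  The Hölder bound compares two derivatives with the quotient
over their common interval, hence the factor 2. *)
Lemma regularity_of_quotients (f : R -> C) L E H c delta : 0 < L -> 0 < E -> 0 < H -> 0 < c -> 0 < delta ->
  (forall x y, 0 <= x -> x < y -> y <= L ->
     Cmod (dq f x y - RtoC 2 * Ci)%C <= E * Rpower y (2 * delta) /\ c <= Cmod (dq f x y)) ->
  (forall x y z, 0 <= x -> x < y -> y < z -> z <= L ->
     Cmod (dq f x y - dq f y z)%C <= H * Rpower (z - x) delta) ->
  let S := 2 + E * Rpower L (2 * delta) in
  (forall t, 0 <= t <= L -> is_derive_on 0 L f t (Derive_on 0 L f t)) /\
  (forall t, 0 <= t <= L -> c <= Cmod (Derive_on 0 L f t)) /\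
  (forall t, 0 < t <= L -> Cmod (Derive_on 0 L f t - RtoC 2 * Ci)%C <= E * Rpower t (2 * delta)) /\
  exists r, Cna_norm 1 delta 0 L f = Finite r /\
    r <= Cmod (f 0) + S * L + (S + H * Rpower L delta) + 2 * H.
Proof.
  intros HL HE HH Hc Hd Hq Hv S.
  assert (HD : forall t, 0 <= t <= L -> is_derive_on 0 L f t (Derive_on 0 L f t) /\
     forall y, 0 <= y <= L -> y <> t -> Cmod (Derive_on 0 L f t - dq f t y)%C <= H * Rpower (Rabs (y - t)) delta).
  { intros t Ht. destruct (derivative_of_quotients f L H delta HL HH Hd Hv t Ht) as [l Hl].
    assert (B := is_derive_on_of_quotients f L H delta t l HH Hd Ht Hl).
    rewrite (Derive_on_unique 0 L f t l HL Ht B). auto. }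
  assert (Happ : forall t e, 0 <= t <= L -> 0 < e -> exists y, 0 <= y <= L /\ y <> t /\ (0 < t -> y < t) /\
     H * Rpower (Rabs (y - t)) delta <= e).
  { intros t e Ht He. destruct (holder_gauge_vanishes H delta e HH Hd He) as (d & Hdp & B).
    destruct (Rlt_dec 0 t) as [H0|H0].
    - set (u := Rmin d t). assert (0 < u) by (apply Rmin_pos; lra).
      assert (u <= d) by apply Rmin_l. assert (u <= t) by apply Rmin_r.
      exists (t - u). repeat split; try lra. replace (t - u - t) with (- u) by ring.
      rewrite Rabs_Ropp Rabs_pos_eq; [|lra]. apply B; lra.
    - set (u := Rmin d L). assert (0 < u) by (apply Rmin_pos; lra).
      assert (u <= d) by apply Rmin_l. assert (u <= L) by apply Rmin_r.
      exists (t + u). repeat split; try lra. replace (t + u - t) with u by ring.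
      rewrite Rabs_pos_eq; [|lra]. apply B; lra. }
  assert (Hq' : forall x y, 0 <= x <= L -> 0 <= y <= L -> x <> y -> c <= Cmod (dq f x y) <= S).
  { assert (W : forall x y, 0 <= x <= L -> 0 <= y <= L -> x < y -> c <= Cmod (dq f x y) <= S).
    { intros x y Hx Hy Hxy. destruct (Hq x y) as [Q1 Q2]; try lra. split; [exact Q2|].
      replace (dq f x y) with (RtoC 2 * Ci + (dq f x y - RtoC 2 * Ci))%C by ring.
      eapply Rle_trans; [apply Cmod_triangle|]. rewrite Cmod_mult Cmod_Ci Cmod_R Rabs_pos_eq; [|lra].
      unfold S. assert (Rpower y (2 * delta) <= Rpower L (2 * delta)) by (apply Rle_Rpower_l; lra).
      assert (E * Rpower y (2 * delta) <= E * Rpower L (2 * delta)) by (apply Rmult_le_compat_l; lra). lra. }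
    intros x y Hx Hy Hne. destruct (Rlt_dec x y); [apply W; auto|]. rewrite dq_sym. apply W; auto; lra. }
  assert (HS : 0 <= S).
  { unfold S. assert (0 <= E * Rpower L (2 * delta)) by (apply Rmult_le_pos; [lra | left; apply Rpower_pos]). lra. }
  split; [intros t Ht; apply HD; exact Ht|].
  assert (Hlow : forall t, 0 <= t <= L -> c <= Cmod (Derive_on 0 L f t)).
  { intros t Ht. apply le_epsilon. intros e He. destruct (Happ t e Ht He) as (y & Hy & Hne & _ & B).
    destruct (HD t Ht) as [_ Q]. specialize (Q y Hy Hne). destruct (Hq' t y Ht Hy ltac:(auto)) as [Q1 _].
    rewrite Cmod_minus_sym in Q.
    replace (dq f t y) with ((dq f t y - Derive_on 0 L f t) + Derive_on 0 L f t)%C in Q1 by ring.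
    assert (Q2 := Cmod_triangle (dq f t y - Derive_on 0 L f t)%C (Derive_on 0 L f t)). lra. }
  split; [exact Hlow|].
  split.
  { intros t Ht. apply le_epsilon. intros e He. destruct (Happ t e ltac:(lra) He) as (y & Hy & Hne & Hlt & B).
    destruct (HD t ltac:(lra)) as [_ Q]. specialize (Q y Hy Hne).
    specialize (Hlt ltac:(lra)). destruct (Hq y t) as [Q1 _]; try lra. rewrite dq_sym in Q1.
    replace (Derive_on 0 L f t - RtoC 2 * Ci)%C with ((Derive_on 0 L f t - dq f t y) + (dq f t y - RtoC 2 * Ci))%C by ring.
    eapply Rle_trans; [apply Cmod_triangle|]. lra. }
  destruct (Lub_Rbar_bounded (fun x => exists t, 0 <= t <= L /\ x = Cmod (f t)) (Cmod (f 0) + S * L)) as (r0 & R0 & B0).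
  { exists (Cmod (f 0)), 0. split; [lra|reflexivity]. }
  { intros x (t & Ht & ->). split; [apply Cmod_ge_0|].
    assert (Hpos : 0 <= S * L) by (apply Rmult_le_pos; lra).
    destruct (Req_dec t 0) as [->|Hne]; [lra|].
    destruct (Hq' 0 t) as [_ Q]; try lra.
    assert (N : RtoC (t - 0) <> RtoC 0) by (apply RtoC_neq_0; lra).
    replace (f t) with (f 0 + dq f 0 t * RtoC (t - 0))%C by (unfold dq; field; exact N).
    eapply Rle_trans; [apply Cmod_triangle|]. rewrite Cmod_mult Cmod_R Rabs_pos_eq; [|lra].
    apply Rplus_le_compat_l. apply Rmult_le_compat; try lra. apply Cmod_ge_0. }
  destruct (Lub_Rbar_bounded (fun x => exists t, 0 <= t <= L /\ x = Cmod (Derive_on 0 L f t)) (S + H * Rpower L delta)) as (r1 & R1 & B1).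
  { exists (Cmod (Derive_on 0 L f 0)), 0. split; [lra|reflexivity]. }
  { intros x (t & Ht & ->). split; [apply Cmod_ge_0|].
    assert (Hy : exists y, 0 <= y <= L /\ y <> t).
    { destruct (Req_dec t 0) as [->|]; [exists L | exists 0]; split; auto; lra. }
    destruct Hy as (y & Hy & Hne). destruct (HD t Ht) as [_ Q]. specialize (Q y Hy Hne).
    destruct (Hq' t y Ht Hy ltac:(auto)) as [_ Q1].
    replace (Derive_on 0 L f t) with (dq f t y + (Derive_on 0 L f t - dq f t y))%C by ring.
    eapply Rle_trans; [apply Cmod_triangle|].
    assert (Rpower (Rabs (y - t)) delta <= Rpower L delta).
    { apply Rle_Rpower_l; [lra|]. split; [apply Rabs_pos_lt; lra | apply Rabs_le_between; lra]. }
    assert (H * Rpower (Rabs (y - t)) delta <= H * Rpower L delta) by (apply Rmult_le_compat_l; lra). lra. }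
  destruct (Lub_Rbar_bounded (fun x => exists t1 t2,
    0 <= t1 <= L /\ 0 <= t2 <= L /\ t1 <> t2 /\
    x = Cmod (Derive_on 0 L f t1 - Derive_on 0 L f t2)%C / Rpower (Rabs (t1 - t2)) delta) (2 * H)) as (r2 & R2 & B2).
  { eexists; exists 0, L. repeat split; try lra. }
  { intros x (t1 & t2 & Ht1 & Ht2 & Hne & ->).
    assert (Hp : 0 < Rpower (Rabs (t1 - t2)) delta) by apply Rpower_pos.
    split; [apply Rdiv_le_0_compat; [apply Cmod_ge_0 | exact Hp]|].
    apply Rle_div_l; [exact Hp|].
    destruct (HD t1 Ht1) as [_ Q1]. destruct (HD t2 Ht2) as [_ Q2].
    specialize (Q1 t2 Ht2 ltac:(auto)). specialize (Q2 t1 Ht1 Hne).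
    rewrite dq_sym in Q2. rewrite Rabs_minus_sym in Q1.
    replace (Derive_on 0 L f t1 - Derive_on 0 L f t2)%C with
      ((Derive_on 0 L f t1 - dq f t1 t2) + - (Derive_on 0 L f t2 - dq f t1 t2))%C by ring.
    eapply Rle_trans; [apply Cmod_triangle|]. rewrite Cmod_opp. lra. }
  exists (r0 + r1 + r2). split.
  - unfold Cna_norm, sum_sup_norm, sup_norm, holder_seminorm, Derive_n_on.
    rewrite R0 R1 R2. reflexivity.
  - lra.
Qed.

(** Driving functions are extended from [0,T] to the line as constants. *)
Definition clamp (T r : R) : R := Rmax 0 (Rmin T r).

Lemma clamp_in T r : 0 <= T -> 0 <= clamp T r <= T.
Proof.
  intros HT. unfold clamp. split; [apply Rmax_l|]. apply Rmax_lub; [lra | apply Rmin_l].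
Qed.

Lemma clamp_id T r : 0 <= r <= T -> clamp T r = r.
Proof. intros Hr. unfold clamp. rewrite Rmin_right; [rewrite Rmax_right|]; lra. Qed.

Lemma clamp_lipschitz T a b : 0 <= T -> Rabs (clamp T a - clamp T b) <= Rabs (a - b).
Proof.
  intros HT. unfold clamp, Rmin. destruct (Rle_dec T a), (Rle_dec T b); unfold Rmax;
  repeat match goal with |- context [Rle_dec 0 ?v] => destruct (Rle_dec 0 v) end;
  unfold Rabs; repeat destruct (Rcase_abs _); lra.
Qed.

Lemma holder_line_clamp M delta T lam : 0 < T -> 0 < M -> 0 < delta ->
  holder_driving M (1 / 2 + delta) T lam -> holder_line M delta (fun r => lam (clamp T r)).
Proof.
  intros HT HM Hd H a b Hab.
  assert (Hp : 0 < Rabs (a - b)) by (apply Rabs_pos_lt; lra).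
  rewrite -Rpower_sqrt_split; [|exact Hp].
  destruct (Req_dec (clamp T a) (clamp T b)) as [E|Hne].
  - rewrite E. replace (_ - _) with 0 by ring. rewrite Rabs_R0.
    apply Rmult_le_pos; [lra | left; apply Rpower_pos].
  - eapply Rle_trans; [apply H; apply clamp_in; lra|].
    apply Rmult_le_compat_l; [lra|]. apply Rle_Rpower_l; [lra|].
    split; [apply Rabs_pos_lt; lra | apply clamp_lipschitz; lra].
Qed.

Lemma loewner_domain_ext lam lam' t z :
  (forall s, 0 <= s <= t -> lam s = lam' s) -> loewner_domain lam t z -> loewner_domain lam' t z.
Proof.
  intros He (Hz & g & H0 & H). split; [exact Hz|]. exists g. split; [exact H0|].
  intros s Hs. rewrite -(He s Hs). apply H; exact Hs.
Qed.

Lemma generates_slit_clamp lam T gam : 0 < T -> generates_slit lam T gam ->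
  generates_slit (fun r => lam (clamp T r)) T gam.
Proof.
  intros HT (H1 & H2 & H3 & H4 & H5).
  assert (E : forall t, 0 <= t <= T -> forall s, 0 <= s <= t -> lam s = lam (clamp T s)).
  { intros t Ht s Hs. rewrite clamp_id //. lra. }
  split; [exact H1|]. split; [exact H2|].
  split; [rewrite clamp_id; [exact H3 | lra]|]. split; [exact H4|].
  intros t Ht z. rewrite -(H5 t Ht z). split; apply loewner_domain_ext.
  - intros s Hs. symmetry. apply (E t Ht s Hs).
  - exact (E t Ht).
Qed.

(** The point gam t lies in all the domains of index s < t but not in the one of
index t, so its solution cannot be continued to time t. *)
Lemma slit_tip_flow lam T gam t : (forall x, continuity_pt lam x) ->
  generates_slit lam T gam -> 0 < t <= T ->
  exists g, g 0 = gam t /\ tip_flow lam t g.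
Proof.
  intros Hc (_ & Hinj & _ & Hup & Hdom) Ht.
  assert (Hz : 0 < snd (gam t)) by (apply (Hup t Ht)).
  destruct (flow_glue lam t (gam t) Hc ltac:(lra) Hz) as (g & H0 & Hg).
  { intros s Hs. assert (D : loewner_domain lam s (gam t)).
    { apply Hdom; [lra|]. split; [exact Hz|]. intros (r & Hr & E).
      apply Hinj in E; lra. }
    destruct D as (_ & g & Hsol). apply (flow_of_solution lam s (gam t) g); [lra | exact Hsol]. }
  exists g. split; [exact H0|]. split; [lra|]. split; [exact Hg|].
  rewrite H0. split; [exact Hz|]. intros c Hcp.
  apply NNPP. intros Hn.
  destruct (flow_extends lam t g c Hc ltac:(lra) Hcp Hg) as [h Hh].
  { intros s Hs. apply Rnot_lt_le. intros Hlt. apply Hn. exists s; auto. }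
  rewrite H0 in Hh.
  assert (D : loewner_domain lam t (gam t)) by (split; [exact Hz | exists h; exact Hh]).
  apply Hdom in D; [|lra]. destruct D as [_ D]. apply D. exists t. split; [lra|reflexivity].
Qed.

Lemma tip_curve_of_tip_flow lam delta c0 C1 t g : tip_flow lam t g ->
  (forall s, 0 <= s < t -> c0 * sqrt (t - s) <= snd (g s) /\
    Cmod (g s - RtoC (lam s) - RtoC (2 * sqrt (t - s)) * Ci)%C
      <= C1 * (sqrt (t - s) * Rpower (t - s) delta)) ->
  exists h, h 0 = g 0 /\ tip_curve lam delta c0 C1 t h.
Proof.
  intros (Ht & Hg & _) HB.
  set (h := fun s => if Rlt_dec s t then g s else RtoC (lam s)).
  assert (hlt : forall s, s < t -> h s = g s).
  { intros s Hs; unfold h; destruct (Rlt_dec s t); [reflexivity|lra]. }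
  exists h. split; [apply hlt; exact Ht|]. split; [|split].
  - unfold h; destruct (Rlt_dec t t); [lra|reflexivity].
  - intros s Hs r Hr. rewrite hlt; [|lra]. destruct (Hg s Hs r Hr) as [N D]. split; [exact N|].
    apply: cder_ext_loc D. assert (Hd : 0 < t - r) by lra.
    exists (mkposreal _ Hd). intros y Hy. symmetry; apply hlt.
    apply Rabs_lt_between in Hy. simpl in Hy. unfold minus, plus, opp in Hy; simpl in Hy. lra.
  - intros s Hs. rewrite hlt; [|lra]. destruct (HB s Hs) as [B1 B2]. split; [|exact B2].
    eapply Rle_trans; [exact B1 | apply flow_Im_le_Cmod].
Qed.

(** y^2 - x^2 = (y - x)(y + x), and x + y is the sum of the square roots in
[slope] at s = 0. *)
Lemma dq_square_slope gam t1 t2 g1 g2 x y : 0 <= x -> x < y -> t1 = x ^ 2 -> t2 = y ^ 2 ->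
  g1 0 = gam t1 -> g2 0 = gam t2 ->
  dq (square_param gam) x y = (RtoC 2 * slope t1 t2 g1 g2 0)%C.
Proof.
  intros Hx Hxy -> -> E1 E2. unfold dq, square_param, slope. rewrite E1 E2 !Rminus_0_r !sqrt_pow2; try lra.
  replace ((x + y) / (2 * (y ^ 2 - x ^ 2))) with (/ (2 * (y - x))) by (field; nra).
  rewrite RtoC_inv; [|lra]. rewrite RtoC_mult.
  assert (N : RtoC (y - x) <> RtoC 0) by (apply RtoC_neq_0; lra).
  assert (N2 : RtoC 2 <> RtoC 0) by (apply RtoC_neq_0; lra).
  field. auto.
Qed.

(** Bounds in the variable x^2 are turned into bounds in x; the factor
(2 sqrt T)^delta comes from z^2 - x^2 <= 2 sqrt T (z - x). *)
Lemma slit_quotients T M delta : 0 < T -> 0 < M -> 0 < delta <= 1 / 2 ->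
  exists E H c, 0 < E /\ 0 < H /\ 0 < c /\
  forall lam gam, holder_driving M (1 / 2 + delta) T lam -> generates_slit lam T gam ->
  (forall x y, 0 <= x -> x < y -> y <= sqrt T ->
     Cmod (dq (square_param gam) x y - RtoC 2 * Ci)%C <= E * Rpower y (2 * delta) /\
     c <= Cmod (dq (square_param gam) x y)) /\
  (forall x y z, 0 <= x -> x < y -> y < z -> z <= sqrt T ->
     Cmod (dq (square_param gam) x y - dq (square_param gam) y z)%C <= H * Rpower (z - x) delta).
Proof.
  intros HT HM Hd.
  destruct (tip_estimate T M delta HT HM ltac:(lra)) as (c0 & C1 & Hc0 & HC1 & Htip).
  destruct (slope_estimate T M delta c0 C1 HT HM Hd Hc0 ltac:(lra)) as (C2 & c2 & HC2 & Hc2 & HS).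
  destruct (slope_variation T M delta c0 C1 HT HM Hd Hc0 ltac:(lra)) as (C3 & HC3 & HV).
  exists (2 * C2), (2 * C3 * Rpower (2 * sqrt T) delta), (2 * c2).
  split; [lra|]. split; [apply Rmult_lt_0_compat; [lra | apply Rpower_pos]|]. split; [lra|].
  intros lam0 gam Hhol0 Hgen0.
  set (lam := fun r => lam0 (clamp T r)).
  assert (HL : holder_line M delta lam) by (apply holder_line_clamp; lra || assumption).
  assert (Hgen : generates_slit lam T gam) by (apply generates_slit_clamp; assumption).
  assert (Hc := holder_continuity M delta lam HM ltac:(lra) HL).
  assert (Hcurve : forall t, 0 <= t <= T -> exists g, g 0 = gam t /\ tip_curve lam delta c0 C1 t g).
  { intros t Ht. destruct (Req_dec t 0) as [->|Hne].
    - exists (fun s => RtoC (lam s)). split.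
      + symmetry. apply Hgen.
      + split; [reflexivity|]. split; [intros s Hs r Hr; lra | intros s Hs; lra].
    - destruct (slit_tip_flow lam T gam t Hc Hgen ltac:(lra)) as (g & H0 & Hg).
      destruct (tip_curve_of_tip_flow lam delta c0 C1 t g Hg) as (h & Hh0 & Hh).
      + intros s Hs. apply (Htip lam t g HL ltac:(lra) Hg s Hs).
      + exists h. rewrite Hh0. auto. }
  assert (Hsq : forall x, 0 <= x <= sqrt T -> 0 <= x ^ 2 <= T).
  { intros x Hx. split; [nra|]. rewrite -(sqrt_sqrt T); [|lra]. nra. }
  assert (HP2 : forall y, 0 < y -> Rpower (y ^ 2) delta = Rpower y (2 * delta)).
  { intros y Hy. rewrite -Rpower_mult. f_equal. rewrite -(Rpower_pow 2 y Hy). f_equal. }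
  split.
  - intros x y Hx Hxy Hy.
    destruct (Hcurve (x ^ 2) (Hsq x ltac:(lra))) as (g1 & E1 & T1).
    destruct (Hcurve (y ^ 2) (Hsq y ltac:(lra))) as (g2 & E2 & T2).
    assert (Hy2 := Hsq y ltac:(lra)).
    rewrite (dq_square_slope gam _ _ g1 g2 x y Hx Hxy eq_refl eq_refl E1 E2).
    destruct (HS lam (x ^ 2) (y ^ 2) g1 g2 0 HL T1 T2 ltac:(nra) ltac:(nra)) as [B1 B2].
    rewrite Rminus_0_r HP2 in B1; [|lra].
    split.
    + replace (RtoC 2 * slope (x ^ 2) (y ^ 2) g1 g2 0 - RtoC 2 * Ci)%C with
        (RtoC 2 * (slope (x ^ 2) (y ^ 2) g1 g2 0 - Ci))%C by ring.
      rewrite Cmod_mult Cmod_R Rabs_pos_eq; lra.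
    + rewrite Cmod_mult Cmod_R Rabs_pos_eq; lra.
  - intros x y z Hx Hxy Hyz Hz.
    destruct (Hcurve (x ^ 2) (Hsq x ltac:(lra))) as (g1 & E1 & T1).
    destruct (Hcurve (y ^ 2) (Hsq y ltac:(lra))) as (g2 & E2 & T2).
    destruct (Hcurve (z ^ 2) (Hsq z ltac:(lra))) as (g3 & E3 & T3).
    assert (Hz2 := Hsq z ltac:(lra)).
    rewrite (dq_square_slope gam _ _ g1 g2 x y Hx Hxy eq_refl eq_refl E1 E2).
    rewrite (dq_square_slope gam _ _ g2 g3 y z ltac:(lra) Hyz eq_refl eq_refl E2 E3).
    assert (B := HV lam (x ^ 2) (y ^ 2) (z ^ 2) g1 g2 g3 HL T1 T2 T3 ltac:(nra) ltac:(nra) ltac:(split; nra)).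
    match goal with |- Cmod (?two * ?a - ?two * ?b)%C <= _ =>
      replace (two * a - two * b)%C with (two * (a - b))%C by ring end.
    rewrite Cmod_mult Cmod_R Rabs_pos_eq; [|lra].
    assert (0 < sqrt T) by (apply sqrt_lt_R0; lra).
    rewrite Rmult_assoc Rpower_mult_distr; [|lra|lra].
    assert (Q : Rpower (z ^ 2 - x ^ 2) delta <= Rpower (2 * sqrt T * (z - x)) delta)
      by (apply Rle_Rpower_l; nra).
    assert (C3 * Rpower (z ^ 2 - x ^ 2) delta <= C3 * Rpower (2 * sqrt T * (z - x)) delta)
      by (apply Rmult_le_compat_l; lra).
    lra.
Qed.

(** gam t - gam 0 is sqrt t times a quotient tending to 2i, whose argument tends
to acos 0 = PI/2. *)
Lemma vertical_of_quotients gam L E c delta : 0 < L -> 0 < E -> 0 < c -> 0 < delta ->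
  snd (gam 0) = 0 -> (forall t, 0 < t <= L ^ 2 -> 0 < snd (gam t)) ->
  (forall y, 0 < y <= L ->
     Cmod (dq (square_param gam) 0 y - RtoC 2 * Ci)%C <= E * Rpower y (2 * delta) /\
     c <= Cmod (dq (square_param gam) 0 y)) ->
  grows_vertically gam.
Proof.
  intros HL HE Hc Hd H0 Hup Hq.
  assert (Hac : continuous acos 0).
  { apply continuity_pt_filterlim, derivable_continuous_pt, derivable_pt_acos; lra. }
  unfold grows_vertically. rewrite -acos_0. intros P HP. specialize (Hac P HP).
  destruct Hac as [e He]. pose proof (cond_pos e) as Hep.
  destruct (holder_gauge_vanishes (E / c) (2 * delta) (e / 2)) as (d & Hdp & B); try lra.
  { apply Rdiv_lt_0_compat; lra. }
  set (m := Rmin d L). assert (Hm : 0 < m) by (apply Rmin_pos; lra).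
  assert (m <= d) by apply Rmin_l. assert (m <= L) by apply Rmin_r.
  assert (Hmm : 0 < m * m) by nra.
  exists (mkposreal _ Hmm). intros t Ht Ht0.
  apply Rabs_lt_between in Ht. simpl in Ht. unfold minus, plus, opp in Ht; simpl in Ht.
  set (y := sqrt t). assert (Hy : 0 < y) by (apply sqrt_lt_R0; exact Ht0).
  assert (Hyy : y * y = t) by (apply sqrt_sqrt; lra).
  assert (Hym : y <= m) by nra.
  destruct (Hq y ltac:(lra)) as [Q1 Q2].
  set (Q := dq (square_param gam) 0 y) in *.
  assert (EQ : (gam t - gam 0)%C = (RtoC y * Q)%C).
  { unfold Q, dq, square_param. replace (y ^ 2) with t by (simpl; lra). replace (0 ^ 2) with 0 by ring.
    rewrite Rminus_0_r. assert (RtoC y <> RtoC 0) by (apply RtoC_neq_0; lra). field. assumption. }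
  clearbody Q. unfold Carg. destruct (Rle_dec 0 (Im (gam t - gam 0)%C)) as [Hi|Hi].
  2: { exfalso. apply Hi. simpl. rewrite H0. assert (0 < snd (gam t)) by (apply Hup; nra). lra. }
  apply He. rewrite EQ.
  assert (Hr : Re (RtoC y * Q)%C / Cmod (RtoC y * Q)%C = fst Q / Cmod Q).
  { rewrite Cmod_mult Cmod_R Rabs_pos_eq; [|lra]. simpl. field. lra. }
  rewrite Hr. unfold ball; simpl. unfold AbsRing_ball, abs, minus, plus, opp; simpl.
  rewrite Ropp_0 Rplus_0_r. unfold Rdiv. rewrite Rabs_mult Rabs_inv (Rabs_pos_eq (Cmod Q)); [|lra].
  assert (Q3 : Rabs (fst Q) <= E * Rpower y (2 * delta)).
  { eapply Rle_trans; [|exact Q1]. eapply Rle_trans; [|apply re_le_Cmod]. right; f_equal.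
    simpl. ring. }
  assert (B' := B y ltac:(lra)).
  apply Rle_lt_trans with (E / c * Rpower y (2 * delta)); [|lra].
  replace (E / c * Rpower y (2 * delta)) with (E * Rpower y (2 * delta) * / c) by (field; lra).
  apply Rmult_le_compat; [apply Rabs_pos | left; apply Rinv_0_lt_compat; lra | exact Q3 |].
  apply Rinv_le_contravar; lra.
Qed.

Theorem theorem4p7 :
  forall T M delta : R, 0 < T -> 0 < M -> 0 < delta <= 1 / 2 ->
  (forall (lam : R -> R) (gam : R -> C),
     holder_driving M (1 / 2 + delta) T lam ->
     generates_slit lam T gam ->
     Cna_regular 1 delta 0 (sqrt T) (square_param gam) /\
     grows_vertically gam) /\
  (exists N : R, 0 < N /\
   forall (lam : R -> R) (gam : R -> C),
     holder_driving M (1 / 2 + delta) T lam ->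
     generates_slit lam T gam ->
     Rbar_le (lip_half_norm T lam) (Finite 1) ->
     Rbar_le (Cna_norm 1 delta 0 (sqrt T) (square_param gam))
             (Finite (N + Rabs (lam 0))) /\
     Rbar_le (Finite (1 / N))
       (Glb_Rbar (fun x => exists t, 0 <= t <= sqrt T /\
          x = Cmod (Derive_on 0 (sqrt T) (square_param gam) t))) /\
     (forall t : R, 0 < t <= sqrt T ->
        Cmod (Derive_on 0 (sqrt T) (square_param gam) t - RtoC 2 * Ci)%C
          <= N * Rpower t (2 * delta))).
Proof.
  intros T M delta HT HM Hd.
  assert (HL : 0 < sqrt T) by (apply sqrt_lt_R0; lra).
  destruct (slit_quotients T M delta HT HM Hd) as (E & H & c & HE & HH & Hc & Hquot).
  set (S := 2 + E * Rpower (sqrt T) (2 * delta)).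
  assert (HS : 0 < S).
  { unfold S. assert (0 < E * Rpower (sqrt T) (2 * delta)) by (apply Rmult_lt_0_compat; [lra | apply Rpower_pos]). lra. }
  assert (Hreg := fun lam gam h1 h2 => regularity_of_quotients (square_param gam) (sqrt T) E H c delta
    HL HE HH Hc ltac:(lra) (proj1 (Hquot lam gam h1 h2)) (proj2 (Hquot lam gam h1 h2))).
  cbv zeta in Hreg. fold S in Hreg.
  split.
  - intros lam gam Hhol Hgen.
    destruct (Hreg lam gam Hhol Hgen) as (R1 & R2 & R3 & r & R4 & R5).
    split; [split; [split|]|].
    + intros k Hk t Ht. replace k with 0%nat by lia. eexists; apply (R1 t Ht).
    + rewrite R4. reflexivity.
    + intros t Ht E0. specialize (R2 t Ht). rewrite E0 Cmod_0 in R2. lra.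
    + destruct (Hquot lam gam Hhol Hgen) as [Q _]. destruct Hgen as (_ & _ & G0 & Gup & _).
      apply (vertical_of_quotients gam (sqrt T) E c delta); auto; try lra.
      * rewrite G0. reflexivity.
      * intros t Ht. apply Gup. rewrite pow2_sqrt in Ht; lra.
      * intros y Hy. apply Q; lra.
  - set (N0 := S * sqrt T + (S + H * Rpower (sqrt T) delta) + 2 * H).
    assert (HN0 : 0 < N0).
    { unfold N0. assert (0 < S * sqrt T) by (apply Rmult_lt_0_compat; lra).
      assert (0 < H * Rpower (sqrt T) delta) by (apply Rmult_lt_0_compat; [lra | apply Rpower_pos]). lra. }
    assert (Hic : 0 < / c) by (apply Rinv_0_lt_compat; lra).
    exists (N0 + / c + E). split; [lra|].
    intros lam gam Hhol Hgen _.
    destruct (Hreg lam gam Hhol Hgen) as (R1 & R2 & R3 & r & R4 & R5).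
    split; [|split].
    + rewrite R4. simpl.
      assert (EG : Cmod (square_param gam 0) = Rabs (lam 0)).
      { unfold square_param. replace (0 ^ 2) with 0 by ring.
        destruct Hgen as (_ & _ & G0 & _). rewrite G0 Cmod_R. reflexivity. }
      rewrite EG in R5. unfold N0 in *. lra.
    + apply Glb_Rbar_correct. intros x (t & Ht & ->). simpl.
      eapply Rle_trans; [|apply R2; exact Ht].
      unfold Rdiv. rewrite Rmult_1_l -{2}(Rinv_inv c). apply Rinv_le_contravar; lra.
    + intros t Ht. eapply Rle_trans; [apply R3; exact Ht|].
      apply Rmult_le_compat_r; [left; apply Rpower_pos | lra].
Qed.
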